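(* Let $\mathcal{M}$ be a regular or chiral map on a surface $S$, and let $\mathrm{Aut}(\mathcal{M})$ be the automorphism group of the map $\mathcal{M}$. Then the spaces $\mathrm{Ends}(S)$ and $\mathrm{Ends}(\mathrm{Aut}(\mathcal{M}))$ are in bijection.
   Context: **Surfaces.** A surface is a connected (Hausdorff, second countable) topological 2-manifold without boundary, compact or not, orientable or not. **Maps.** A map $\mathcal{M}=\mathcal{M}(\Gamma,i,S)$ on a surface $S$ is a 2-cell embedding $i:\Gamma\hookrightarrow S$ of (the geometric realization of) a locally finite simple graph $\Gamma$: only finitely many edges are incident to each vertex, the endpoints of each edge are different vertices, $i$ is a topological embedding, and each connected component of $S\setminus i(\Gamma)$ (a face) is homeomorphic to a disc. **Automorphisms.** A preautomorphism of $\mathcal{M}$ is a homeomorphism $f$ of $S$ for which there is a graph isomorphism $g_f:\Gamma\to\Gamma$ with $i\circ g_f=f\circ i$. Such $g_f$ is unique, and $f\mapsto g_f$ is a group homomorphism $\varphi$ from the group $\widetilde{\mathrm{Aut}}(\mathcal{M})$ of preautomorphisms to the group of isomorphisms of $\Gamma$. Set $\mathrm{Aut}(\mathcal{M}):=\widetilde{\mathrm{Aut}}(\mathcal{M})/\ker\varphi$. **Flags.** A flag of $\mathcal{M}$ is a triangle on $S$ whose vertices are a vertex $i(v)$ of the map, the midpoint of an edge $i(e)$ containing $i(v)$, and an interior point of a face $F$ whose boundary contains $i(e)$ (the same interior point being chosen for all flags of the same face). The flags triangulate $S$. A flag is identified with the ordered incident triple (vertex, edge, face). Given a flag $\Phi$,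 for $j=0,1,2$ there is a unique $j$-adjacent flag $\Phi^j$, differing from $\Phi$ precisely in the vertex, edge, face, respectively. The group $\mathrm{Aut}(\mathcal{M})$ acts on the set $\mathcal{F}$ of flags, and for any two flags there is at most one automorphism mapping the first to the second. **Regular and chiral.** $\mathcal{M}$ is regular if $\mathrm{Aut}(\mathcal{M})$ has exactly one orbit on $\mathcal{F}$. It is chiral if $\mathrm{Aut}(\mathcal{M})$ has exactly two orbits on $\mathcal{F}$ and adjacent flags always belong to different orbits. Regular and chiral maps have a Schläfli type $\{p,q\}$ with $p,q$ finite: every vertex has the same degree $q\in\mathbb{N}$, and the boundary of every face is a cycle of $i(\Gamma)$ of the same finite length $p$. **Ends.** Let $X$ be a locally compact, locally connected, connected Hausdorff space. Consider nested sequences $U_1\supseteq U_2\supseteq\cdots$ of non-empty connected open subsets of $X$ such that each boundary $\partial U_n$ is compact, $\bigcap_n\overline{U_n}=\emptyset$, and for every compact $K\subset X$ there is $m$ with $K\cap U_m=\emptyset$. Two such sequences $(U_n)$, $(U'_n)$ are equivalent if for every $l$ there is $k$ with $U_l\supseteq U'_k$, and for every $n$ there is $m$ with $U'_n\supseteq U_m$. $\mathrm{Ends}(X)$ is the set of equivalence classes. For a finitely generated group $G$, $\mathrm{Ends}(G)$ is the space of ends of (the geometric realization of) the Cayley graph of $G$ with respect to a finite generating set. *)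

(* Defs.v *)
From HB Require Import structures.
From mathcomp Require Import all_boot all_order all_algebra.
From mathcomp Require Import all_classical all_reals all_analysis.
Import Order.TTheory GRing.Theory Num.Theory.
Import numFieldNormedType.Exports.
Local Open Scope classical_set_scope.
Local Open Scope card_scope.
Local Open Scope quotient_scope.
Local Open Scope ring_scope.

Set Implicit Arguments.
Unset Strict Implicit.
Unset Printing Implicit Defensive.

Definition homeomorphic (X Y : topologicalType) : Prop :=
  exists (f : X -> Y) (g : Y -> X),
    [/\ cancel f g, cancel g f, continuous f & continuous g].

Definition is_embedding (X Y : topologicalType) (f : X -> Y) : Prop :=
  injective f /\
  forall A : set X, open A <-> exists2 B : set Y, open B & A = f @^-1` B.

Definition frontier (X : topologicalType) (A : set X) : set X :=
  closure A `\` interior A.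

Definition open_disc (R : realType) : set (R * R) :=
  [set z | z.1 ^+ 2 + z.2 ^+ 2 < 1].
Arguments open_disc R : clear implicits.

(* Subsets such as [U] are coerced to types carrying the subspace topology. *)
Definition is_surface (R : realType) (S : topologicalType) : Prop :=
  [/\ hausdorff_space S, @second_countable S, connected [set: S] &
      forall x : S, exists U : set S,
        [/\ open U, U x & homeomorphic U (R * R)%type]].

Definition end_sequence (X : topologicalType) (U : nat -> set X) : Prop :=
  [/\ forall n, U n.+1 `<=` U n,
      forall n, [/\ U n !=set0, connected (U n), open (U n) &
                    compact (frontier (U n))],
      \bigcap_n closure (U n) = set0 &
      forall K : set X, compact K -> exists m, K `&` U m = set0].

Definition end_equiv (X : topologicalType) (U U' : nat -> set X) : Prop :=
  (forall l, exists k, U' k `<=` U l) /\ (forall n, exists m, U m `<=` U' n).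

Definition Ends (X : topologicalType) : set (set (nat -> set X)) :=
  [set [set U' | end_sequence U' /\ end_equiv U U'] | U in @end_sequence X].
Arguments Ends X : clear implicits.

Record simple_graph (V : choiceType) := SimpleGraph {
  adj :> rel V;
  adj_sym : symmetric adj;
  adj_irr : irreflexive adj }.

Definition locally_finite (V : choiceType) (G : simple_graph V) : Prop :=
  forall v : V, finite_set [set w | adj G v w].

Definition is_edge (V : choiceType) (G : simple_graph V) (e : set V) : Prop :=
  exists u v, adj G u v /\ e = [set u; v].

Section Realization.
Variables (R : realType) (V : choiceType) (G : simple_graph V).

Definition bary (u v : V) (t : R) : {ptws V -> R} :=
  fun w => (1 - t) * (w == u)%:R + t * (w == v)%:R.

(* Points are given by their barycentric coordinates, and the topology is that
   of pointwise convergence of these coordinates; on a locally finite graph it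
   coincides with the CW topology. *)
Definition realization_set : set {ptws V -> R} :=
  [set x | (exists u, x = bary u u 0) \/
           (exists u v t, [/\ adj G u v, 0 <= t <= 1 & x = bary u v t])].

Definition realization : topologicalType := set_type realization_set.

(* For an edge [e], this is the closed edge of the realization. *)
Definition segment (e : set V) : set realization :=
  [set x | forall w, ~ e w -> val x w = 0].

Lemma vertex_point_subproof (v : V) : bary v v 0 \in realization_set.
Proof. by rewrite inE; left; exists v. Qed.

Definition vertex_point (v : V) : realization :=
  exist (fun x => x \in realization_set) _ (vertex_point_subproof v).

End Realization.

Record graph_aut (V : choiceType) (G : simple_graph V) := GraphAut {
  ga_fun :> V -> V;
  ga_inv : V -> V;
  ga_funK : cancel ga_fun ga_inv;
  ga_invK : cancel ga_inv ga_fun;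
  ga_adj : forall u v, adj G (ga_fun u) (ga_fun v) = adj G u v }.

Section GraphAutGroup.
Variables (V : choiceType) (G : simple_graph V).

Lemma graph_aut_ext (g h : graph_aut G) : g =1 h -> g = h.
Proof.
case: g h => [f f' fK f'K fa] [h h' hK h'K ha] /= /funext fh; subst h.
have E : f' = h' by apply/funext => x; rewrite -{1}(h'K x) fK.
by subst h'; congr GraphAut; exact: Prop_irrelevance.
Qed.

HB.instance Definition _ := gen_eqMixin (graph_aut G).
HB.instance Definition _ := gen_choiceMixin (graph_aut G).

Definition ga_one : graph_aut G :=
  @GraphAut V G id id (fun=> erefl) (fun=> erefl) (fun _ _ => erefl).

Lemma ga_inv_adj (g : graph_aut G) u v :
  adj G (ga_inv g u) (ga_inv g v) = adj G u v.
Proof. by rewrite -(ga_adj g) !ga_invK. Qed.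

Definition ga_inverse (g : graph_aut G) : graph_aut G :=
  GraphAut (ga_invK g) (ga_funK g) (ga_inv_adj g).

Lemma ga_mul_adj (g h : graph_aut G) u v :
  adj G ((g \o h) u) ((g \o h) v) = adj G u v.
Proof. by rewrite /= !ga_adj. Qed.

Definition ga_mul (g h : graph_aut G) : graph_aut G :=
  GraphAut (can_comp (ga_funK g) (ga_funK h))
           (can_comp (ga_invK h) (ga_invK g)) (ga_mul_adj g h).

Lemma ga_mulA : associative ga_mul.
Proof. by move=> f g h; exact: graph_aut_ext. Qed.
Lemma ga_mul1 : left_id ga_one ga_mul.
Proof. by move=> f; exact: graph_aut_ext. Qed.
Lemma ga_1mul : right_id ga_one ga_mul.
Proof. by move=> f; exact: graph_aut_ext. Qed.
Lemma ga_mulV : left_inverse ga_one ga_inverse ga_mul.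
Proof. by move=> f; apply: graph_aut_ext => x /=; rewrite ga_funK. Qed.
Lemma ga_Vmul : right_inverse ga_one ga_inverse ga_mul.
Proof. by move=> f; apply: graph_aut_ext => x /=; rewrite ga_invK. Qed.

HB.instance Definition _ := isGroup.Build (graph_aut G)
  ga_mulA ga_mul1 ga_1mul ga_mulV ga_Vmul.

Variable R : realType.

Lemma realization_map_subproof (g : graph_aut G) (x : realization R G) :
  (val x \o ga_inv g : {ptws V -> R}) \in @realization_set R V G.
Proof.
have D u v t : @bary R V u v t \o ga_inv g = bary (g u) (g v) t.
  apply/funext => w; rewrite /bary /=.
  by rewrite !(can2_eq (ga_invK g) (ga_funK g)).
have := valP x; rewrite !inE => -[[u ->]|[u [v [t [uv t01 ->]]]]].
  by left; exists (g u); rewrite D.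
by right; exists (g u), (g v), t; rewrite ga_adj D.
Qed.

(* The simplicial map induced by [g]. *)
Definition realization_map (g : graph_aut G) (x : realization R G) :
  realization R G := 
  exist (fun y => y \in @realization_set R V G) _ (realization_map_subproof g x).

End GraphAutGroup.

Section QuotientByKernel.
Local Open Scope group_scope.
Variables (G H : groupType) (f : UMagmaMorphism.type G H).

Definition group_ker : set G := [set x | f x = 1].

Definition ker_rel : rel G := fun x y => x^-1 * y \in group_ker.

Lemma ker_relE x y : ker_rel x y = (f x == f y).
Proof.
rewrite /ker_rel; apply/idP/eqP; rewrite inE /group_ker /= gmulfM gmulfV.
  by move=> E; rewrite -[LHS]mulg1 -E mulgA mulgV mul1g.
by move=> ->; rewrite mulVg.
Qed.

Lemma ker_rel_refl : reflexive ker_rel.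
Proof. by move=> x; rewrite ker_relE. Qed.
Lemma ker_rel_sym : symmetric ker_rel.
Proof. by move=> x y; rewrite !ker_relE eq_sym. Qed.
Lemma ker_rel_trans : transitive ker_rel.
Proof. by move=> y x z; rewrite !ker_relE => /eqP->. Qed.

Canonical ker_equiv := EquivRel ker_rel ker_rel_refl ker_rel_sym ker_rel_trans.

Definition quotient_ker := {eq_quot ker_equiv}.
HB.instance Definition _ := Choice.on quotient_ker.

Definition quotient_pi (x : G) : quotient_ker := \pi_({eq_quot ker_equiv}) x.

Lemma quotient_piP x y : quotient_pi x = quotient_pi y <-> f x = f y.
Proof.
split=> [/eqmodP|E]; first by rewrite /= ker_relE => /eqP.
by apply/eqmodP; rewrite /= ker_relE E.
Qed.

Lemma quotient_piK (x : quotient_ker) : exists y, x = quotient_pi y.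
Proof. by exists (repr (x : {eq_quot ker_equiv})); rewrite /quotient_pi reprK. Qed.

Definition q_one : quotient_ker := quotient_pi 1.
Definition q_inv (x : quotient_ker) : quotient_ker :=
  quotient_pi (repr (x : {eq_quot ker_equiv}))^-1.
Definition q_mul (x y : quotient_ker) : quotient_ker :=
  quotient_pi (repr (x : {eq_quot ker_equiv}) * repr (y : {eq_quot ker_equiv})).

Lemma f_repr x : f (repr (quotient_pi x : {eq_quot ker_equiv})) = f x.
Proof. by apply/quotient_piP; rewrite /quotient_pi reprK. Qed.

Lemma q_mulE x y : q_mul (quotient_pi x) (quotient_pi y) = quotient_pi (x * y).
Proof. by apply/quotient_piP; rewrite !gmulfM !f_repr. Qed.

Lemma q_invE x : q_inv (quotient_pi x) = quotient_pi x^-1.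
Proof. by apply/quotient_piP; rewrite !gmulfV f_repr. Qed.

Lemma q_mulA : associative q_mul.
Proof.
move=> x y z; case: (quotient_piK x) (quotient_piK y) (quotient_piK z).
by move=> ? -> [? ->] [? ->]; rewrite !q_mulE mulgA.
Qed.
Lemma q_mul1 : left_id q_one q_mul.
Proof. by move=> x; case: (quotient_piK x) => ? ->; rewrite q_mulE mul1g. Qed.
Lemma q_1mul : right_id q_one q_mul.
Proof. by move=> x; case: (quotient_piK x) => ? ->; rewrite q_mulE mulg1. Qed.
Lemma q_mulV : left_inverse q_one q_inv q_mul.
Proof.
by move=> x; case: (quotient_piK x) => ? ->; rewrite q_invE q_mulE mulVg.
Qed.
Lemma q_Vmul : right_inverse q_one q_inv q_mul.
Proof.
by move=> x; case: (quotient_piK x) => ? ->; rewrite q_invE q_mulE mulgV.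
Qed.

HB.instance Definition _ := isGroup.Build quotient_ker
  q_mulA q_mul1 q_1mul q_mulV q_Vmul.

End QuotientByKernel.

Section Cayley.
Local Open Scope group_scope.
Variables (G : groupType) (A : set G).

Definition generates : Prop :=
  forall H : set G, group_closed [in H] -> A `<=` H -> H = [set: G].

Definition cayley_rel : rel G := fun g h =>
  (g != h) && `[< exists2 s, A s & h = g * s \/ g = h * s >].

Lemma cayley_sym : symmetric cayley_rel.
Proof.
move=> g h; rewrite /cayley_rel eq_sym; congr andb.
by apply/asbool_equiv_eq; split=> -[s As []]; exists s => //; [right|left|right|left].
Qed.

Lemma cayley_irr : irreflexive cayley_rel.
Proof. by move=> g; rewrite /cayley_rel eqxx. Qed.

Definition cayley_graph : simple_graph G := SimpleGraph cayley_sym cayley_irr.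

End Cayley.

(* For a finite generating set [A], the space of ends of [G]. *)
Definition group_ends (R : realType) (G : groupType) (A : set G) :=
  Ends (realization R (cayley_graph A)).
Arguments group_ends R {G} A.

Section Maps.
Variables (R : realType) (S : topologicalType).
Variables (V : choiceType) (G : simple_graph V).

Definition face_of (i : realization R G -> S) : set (set S) :=
  [set connected_component (~` range i) x | x in ~` range i].

Record graph_map := GraphMap {
  emb :> realization R G -> S;
  map_locally_finite : locally_finite G;
  map_embedding : is_embedding emb;
  map_disc : forall F : set S, face_of emb F -> homeomorphic F (open_disc R) }.

Variable M : graph_map.

Record preaut := Preaut {
  pa_fun :> S -> S;
  pa_inv : S -> S;
  pa_funK : cancel pa_fun pa_inv;
  pa_invK : cancel pa_inv pa_fun;
  pa_cont : continuous pa_fun;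
  pa_inv_cont : continuous pa_inv;
  pa_graph : exists g : graph_aut G,
    forall x, M (realization_map g x) = pa_fun (M x) }.

Lemma preaut_ext (f h : preaut) : f =1 h -> f = h.
Proof.
case: f h => [f f' fK f'K fc fc' fg] [h h' hK h'K hc hc' hg] /= /funext fh.
subst h; have E : f' = h' by apply/funext => x; rewrite -{1}(h'K x) fK.
by subst h'; congr Preaut; exact: Prop_irrelevance.
Qed.

HB.instance Definition _ := gen_eqMixin preaut.
HB.instance Definition _ := gen_choiceMixin preaut.

Lemma realization_map1 x : realization_map (ga_one G) x = x :> realization R G.
Proof. exact: val_inj. Qed.

Lemma realization_mapM g h x :
  realization_map (ga_mul g h) x =
  realization_map g (realization_map h x) :> realization R G.
Proof. exact: val_inj. Qed.

Lemma pa_one_subproof :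
  exists g : graph_aut G, forall x, M (realization_map g x) = M x.
Proof. by exists (ga_one G) => x; rewrite realization_map1. Qed.

Definition pa_one : preaut :=
  @Preaut id id (fun=> erefl) (fun=> erefl) 
    (fun=> cvg_id) (fun=> cvg_id)
    pa_one_subproof.

Lemma pa_inverse_subproof (f : preaut) :
  exists g : graph_aut G, forall x, M (realization_map g x) = pa_inv f (M x).
Proof.
have [g gf] := pa_graph f; exists (ga_inverse g) => x.
apply: (can_inj (pa_funK f)); rewrite pa_invK -gf -realization_mapM.
by rewrite ga_Vmul realization_map1.
Qed.

Definition pa_inverse (f : preaut) : preaut :=
  Preaut (pa_invK f) (pa_funK f) (@pa_inv_cont f) (@pa_cont f)
    (pa_inverse_subproof f).

Lemma pa_mul_subproof (f h : preaut) :
  exists g : graph_aut G, forall x, M (realization_map g x) = (f \o h) (M x).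
Proof.
have [[g gf] [k kh]] := (pa_graph f, pa_graph h).
by exists (ga_mul g k) => x; rewrite realization_mapM gf kh.
Qed.

Definition pa_mul (f h : preaut) : preaut :=
  Preaut (can_comp (pa_funK f) (pa_funK h)) (can_comp (pa_invK h) (pa_invK f))
    (fun x => continuous_comp (@pa_cont h x) (@pa_cont f _))
    (fun x => continuous_comp (@pa_inv_cont f x) (@pa_inv_cont h _))
    (pa_mul_subproof f h).

Lemma pa_mulA : associative pa_mul.
Proof. by move=> f g h; exact: preaut_ext. Qed.
Lemma pa_mul1 : left_id pa_one pa_mul.
Proof. by move=> f; exact: preaut_ext. Qed.
Lemma pa_1mul : right_id pa_one pa_mul.
Proof. by move=> f; exact: preaut_ext. Qed.
Lemma pa_mulV : left_inverse pa_one pa_inverse pa_mul.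
Proof. by move=> f; apply: preaut_ext => x /=; rewrite pa_funK. Qed.
Lemma pa_Vmul : right_inverse pa_one pa_inverse pa_mul.
Proof. by move=> f; apply: preaut_ext => x /=; rewrite pa_invK. Qed.

HB.instance Definition _ := isGroup.Build preaut
  pa_mulA pa_mul1 pa_1mul pa_mulV pa_Vmul.

(* The unique graph automorphism induced by a preautomorphism. *)
Definition map_phi (f : preaut) : graph_aut G := projT1 (cid (pa_graph f)).

Lemma map_phiE (f : preaut) x : M (realization_map (map_phi f) x) = f (M x).
Proof. by rewrite /map_phi; case: cid. Qed.

Lemma map_phi_unique (f : preaut) (g : graph_aut G) :
  (forall x, M (realization_map g x) = f (M x)) -> map_phi f = g.
Proof.
move=> gf; apply: graph_aut_ext => v; set h := map_phi f.
have /(map_embedding M).1 /(congr1 val) /= E :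
    M (realization_map h (vertex_point R G v)) =
    M (realization_map g (vertex_point R G v)) by rewrite map_phiE gf.
have := congr1 (@^~ (h v)) E.
rewrite /bary /= subr0 !mul1r !mul0r !addr0 ga_funK eqxx.
case: eqVneq => [E' _|_ /eqP]; last by rewrite oner_eq0.
by rewrite -{2}E' ga_invK.
Qed.

Lemma map_phiM : {morph map_phi : f h / (f * h)%g}.
Proof.
move=> f h; apply: map_phi_unique => x.
by rewrite [LHS](congr1 M (realization_mapM _ _ _)) !map_phiE.
Qed.

Lemma map_phi1 : map_phi 1%g = 1%g.
Proof. by apply: map_phi_unique => x; rewrite [LHS](congr1 M (realization_map1 _)). Qed.

HB.instance Definition _ := isUMagmaMorphism.Build preaut (graph_aut G)
  map_phi (map_phi1, map_phiM).

Definition Aut : groupType := quotient_ker map_phi.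

(* Vertex, edge, face. *)
Definition flag_data := (V * set V * set S)%type.

Definition flags : set flag_data :=
  [set P | [/\ is_edge G P.1.2, P.1.2 P.1.1, face_of M P.2 &
               M @` segment (P.1.2) `<=` frontier P.2]].

Definition flag_adjacent (P Q : flag_data) : Prop :=
  [\/ [/\ P.1.1 <> Q.1.1, P.1.2 = Q.1.2 & P.2 = Q.2],
      [/\ P.1.1 = Q.1.1, P.1.2 <> Q.1.2 & P.2 = Q.2] |
      [/\ P.1.1 = Q.1.1, P.1.2 = Q.1.2 & P.2 <> Q.2]].

Definition preaut_flag (f : preaut) (P : flag_data) : flag_data :=
  (map_phi f P.1.1, map_phi f @` P.1.2, f @` P.2).

(* The action of an automorphism is through its representatives.  Stated as a
   relation, because when two faces have the same boundary (S is then a sphere)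
   a representative of the identity may exchange them. *)
Definition aut_flag (a : Aut) (P Q : flag_data) : Prop :=
  exists2 f : preaut, quotient_pi map_phi f = a & preaut_flag f P = Q.

Definition flag_orbit (P : flag_data) : set flag_data :=
  [set Q | exists a : Aut, aut_flag a P Q].

Definition flag_orbits : set (set flag_data) := [set flag_orbit P | P in flags].

Definition schlafli_type (p q : nat) : Prop :=
  (forall v, [set w | adj G v w] #= `I_q) /\
  (forall F, face_of M F -> exists c : seq V,
     [/\ size c = p, (2 < p)%N, ucycle (adj G) c &
         frontier F = \bigcup_(v in [set` c]) M @` segment [set v; next c v]]).

(* The finite Schläfli type is part of what it means to be regular or chiral:
   an open-disc face may otherwise be unbounded with an infinite boundary path,
   as for the trivalent tree in the plane. *)
Definition regular_map : Prop :=
  (exists p q, schlafli_type p q) /\ flag_orbits #= `I_1.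

Definition chiral_map : Prop :=
  [/\ exists p q, schlafli_type p q, flag_orbits #= `I_2 &
      forall P Q, flags P -> flags Q -> flag_adjacent P Q ->
        flag_orbit P <> flag_orbit Q].

End Maps.

(* Main.v *)
(* Cover the surface by the open stars of the vertices: connected, relatively compact and
   locally finite.  An end of a space covered in this way is the same thing as an ultrafilter,
   without finite members, on the sets of cells with finite coboundary in the nerve of the
   cover.  Aut(M) acts transitively on the vertices with finite stabilizers, so its elements
   may index the stars, and two stars meet only if their indices differ by one of finitely many
   automorphisms; the sets with finite coboundary are then the almost invariant subsets of
   Aut(M), which do not depend on the cover.  The open stars of a Cayley graph give the same
   Boolean algebra.
   Finiteness of the stabilizers rests on the fact that at most two faces contain a given edge:
   then an automorphism fixing a flag fixes the neighbouring faces, and so everything, because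
   the surface minus the vertices is connected.  For three faces along an arc of the plane, a
   nontrivial integral combination of the angles at points of these faces lifts to the real
   numbers on the arc together with the rest of the boundary; Tietze's theorem then turns one
   angle into a function modulo 1 defined on the whole plane, of nonzero degree on a large
   circle, although every such function lifts. *)
From HB Require Import structures.
Require Import Defs.
From mathcomp Require Import all_boot all_order all_algebra.
From mathcomp Require Import all_classical all_reals all_analysis.
From mathcomp Require Import ring lra zify.
Import Order.TTheory GRing.Theory Num.Theory.
Import numFieldNormedType.Exports.
Local Open Scope classical_set_scope.
Local Open Scope card_scope.
Local Open Scope ring_scope.

Set Implicit Arguments.
Unset Strict Implicit.
Unset Printing Implicit Defensive.

(** * Ends of a covered space as ultrafilters *)

(** Nothing is assumed about how the faces lie along an edge, and an edge is merely a topologically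
    embedded arc, so that a normal form of the surface near it would amount to the Schoenflies
    theorem. What is needed is weaker: not that an edge has two sides, but that it does not have
    three. Three points give two independent differences of angles, each with a single integer jump
    as its obstruction, and two integers always satisfy a linear relation; two points would give
    only one jump, which need not vanish. Regularity and chirality enter only through the Schläfli
    type and transitivity on the vertices. The finite boundary cycles of the faces serve three
    times: they make the faces open, their closures compact, and their incidence with edges a finite
    matter. *)

(** [Q] is an ideal of sets that contains a neighbourhood of each point of [K]. The tails of the
    ideal, directed by inclusion, generate a filter, and by the near-covering form of compactness
    the late members contain [K]. *)
Lemma compact_induction (X : topologicalType) (Q : set X -> Prop) (K : set X) :
  Q set0 -> (forall A B, Q A -> Q B -> Q (A `|` B)) ->
  (forall A B, A `<=` B -> Q B -> Q A) ->
  compact K -> (forall x, K x -> exists2 N, nbhs x N & Q N) -> Q K.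
Proof.
move=> Q0 QU QS /compact_near_coveringP cK KN.
pose F : set_system (set X) :=
  [set P | exists2 A, Q A & forall B, Q B -> A `<=` B -> P B].
have FF : Filter F.
  split.
  - by exists set0.
  - move=> P P' [A QA PA] [A' QA' PA']; exists (A `|` A'); first exact: QU.
    move=> B QB; rewrite subUset => -[AB A'B].
    by split; [exact: PA|exact: PA'].
  - by move=> P P' PP' [A QA PA]; exists A => // B QB AB; exact/PP'/PA.
have [|A QA KA] := cK _ F (fun B x => B x) FF.
  move=> x Kx; have [N Nx QN] := KN x Kx.
  exists (N, [set B | N `<=` B]); last by move=> [y B] /= [Ny]; apply.
  by split => //; exists N.
exact: QS (KA A QA (@subset_refl _ A)) QA.
Qed.

Lemma connected_subset_openU (X : topologicalType) (C A B : set X) :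
  connected C -> open A -> open B -> C `<=` A `|` B -> C `&` A `&` B = set0 ->
  C `<=` A \/ C `<=` B.
Proof.
move=> cC oA oB CAB dAB; have [CA0|CA0] := eqVneq (C `&` A) set0.
  right=> x Cx; have [Ax|//] := CAB x Cx.
  by have : (C `&` A) x by []; rewrite CA0.
left; rewrite -(cC (C `&` A)); [exact: subIsetr|exact/set0P|by exists A|].
exists (~` B); first exact: open_closedC.
apply/seteqP; split=> x [Cx Hx]; split=> //.
  by move=> Bx; have : (C `&` A `&` B) x by []; rewrite dAB.
by have [|/Hx] := CAB x Cx.
Qed.

(** Otherwise the interior of [A] and the complement of its closure would separate [C]. *)
Lemma connected_meets_frontier (X : topologicalType) (C A : set X) :
  connected C -> C `&` A !=set0 -> ~ C `<=` A -> C `&` frontier A !=set0.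
Proof.
move=> cC [x [Cx Ax]] nCA; apply: contrapT => /set0P/negP.
rewrite negbK => /eqP CF; apply: nCA.
have [||||CA|CA] := @connected_subset_openU X C (interior A) (~` closure A) cC.
- exact: open_interior.
- exact/closed_openC/closed_closure.
- move=> y Cy; have [cy|] := pselect (closure A y); last by right.
  left; apply: contrapT => iy.
  by have : (C `&` frontier A) y by []; rewrite CF.
- rewrite -subset0 => y [[Cy iy] /(_ (subset_closure (interior_subset iy)))].
  by [].
- by move=> y /CA /interior_subset.
- by case: (CA x Cx); exact: subset_closure.
Qed.

Lemma compact_locally_finite (X : topologicalType) (D : Type) (O : D -> set X)
    (K : set X) : compact K ->
  (forall x, exists2 N, nbhs (x : X) N & finite_set [set d | N `&` O d !=set0]) ->
  finite_set [set d | K `&` O d !=set0].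
Proof.
move=> cK lf.
apply: (@compact_induction X (fun A => finite_set [set d | A `&` O d !=set0])) cK _.
- apply: sub_finite_set (finite_set0 D) => d [x []] //.
- move=> A B fA fB; apply: (@sub_finite_set _ _
    ([set d | A `&` O d !=set0] `|` [set d | B `&` O d !=set0])).
    by move=> d [x [[Ax|Bx] Ox]]; [left|right]; exists x.
  by rewrite finite_setU.
- move=> A B AB; apply: sub_finite_set => d [x [Ax Ox]].
  by exists x; split=> //; exact: AB.
- by move=> x _; exact: lf.
Qed.

Lemma seq_setU1 (T : eqType) (x : T) (s : seq T) :
  [set` x :: s] = x |` [set` s].
Proof.
apply/seteqP; split=> y /=; rewrite inE; first by move=> /orP[/eqP|]; [left|right].
by move=> [->|->]; rewrite ?eqxx ?orbT.
Qed.

Lemma finite_bigcup_compact_in (X : topologicalType) (D : choiceType)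
    (I : set D) (C : D -> set X) :
  finite_set I -> (forall i, I i -> compact (C i)) -> compact (\bigcup_(i in I) C i).
Proof.
move=> /finite_seqP[s sE] cC.
have {cC} : [set` s] `<=` [set i | compact (C i)] by rewrite -sE.
rewrite sE => {sE}; elim: s => [_|i s IHs].
  by rewrite classical_sets.set_nil bigcup_set0; exact: compact0.
rewrite seq_setU1 subUset bigcup_setU1 => -[Ci /IHs].
by apply: compactU; exact: Ci.
Qed.

Lemma finite_bigcup_compact (X : topologicalType) (D : choiceType)
    (I : set D) (C : D -> set X) :
  finite_set I -> (forall i, compact (C i)) -> compact (\bigcup_(i in I) C i).
Proof. by move=> fI cC; apply: finite_bigcup_compact_in => // i _. Qed.

(** * Ends of a locally finite connected graph *)

Section CombinatorialEnds.
Variables (D : choiceType) (r : D -> D -> Prop).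

(** Only the inner ends of the boundary edges are counted; with finite degrees the outer ends are
    then finitely many too ([coboundaryC_finite]). *)
Definition coboundary (E : set D) : set D :=
  [set d | E d /\ exists2 e, ~ E e & r d e].

Definition finite_coboundary : set (set D) :=
  [set E | finite_set (coboundary E)].

Definition graph_connected :=
  forall E : set D, E !=set0 -> (forall d e, E d -> r d e -> E e) -> E = setT.

(** For [d] outside [K] this is the component of [d] in the graph without [K]. The impredicative
    form turns induction along a path into an application. *)
Definition reach (K : set D) (d : D) : set D :=
  [set e | forall P : set D, P d ->
     (forall x y, P x -> r x y -> ~ K y -> P y) -> P e].

Fixpoint graph_ball (d : D) (n : nat) : set D :=
  if n is m.+1 then
    graph_ball d m `|` \bigcup_(x in graph_ball d m) [set e | r x e]
  else [set d].

Lemma reach_refl K d : reach K d d. Proof. by move=> P. Qed.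

Lemma reach_step K d x y : reach K d x -> r x y -> ~ K y -> reach K d y.
Proof. by move=> dx rxy Ky P Pd Pr; apply: (Pr x) => //; exact: dx. Qed.

Lemma reach_trans K : forall d e f, reach K d e -> reach K e f -> reach K d f.
Proof.
by move=> d e f de; apply; [exact: de|exact: reach_step].
Qed.

Lemma reach_sub K d : ~ K d -> reach K d `<=` ~` K.
Proof. by move=> Kd e; apply. Qed.

Lemma reach_subset K K' d : K `<=` K' -> reach K' d `<=` reach K d.
Proof.
move=> KK' e; apply; first exact: reach_refl.
by move=> x y dx rxy K'y; apply: reach_step rxy _ => // /KK'.
Qed.

Hypothesis r_sym : forall d e, r d e -> r e d.

Lemma reach_sym K d e : ~ K d -> reach K d e -> reach K e d.
Proof.
move=> Kd de; suff [] : (~` K `&` [set e | reach K e d]) e by [].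
apply: de; first by split=> //; exact: reach_refl.
move=> x y [Kx xd] rxy Ky; split=> //=.
by apply: reach_trans xd; apply: (reach_step (@reach_refl _ _)) => //; exact: r_sym.
Qed.

Lemma reach_eq K d e : ~ K d -> reach K d e -> reach K e = reach K d.
Proof.
move=> Kd de; apply/seteqP; split=> f; first exact: reach_trans.
by apply: reach_trans; exact: reach_sym.
Qed.

Hypothesis r_fin : forall d, finite_set [set e | r d e].

Lemma graph_ball_finite d n : finite_set (graph_ball d n).
Proof.
elim: n => [|n IHn]; first exact: finite_set1.
by rewrite finite_setU; split=> //; exact: bigcup_finite.
Qed.

Lemma graph_ball_subset d m n : (m <= n)%N -> graph_ball d m `<=` graph_ball d n.
Proof.
move=> /subnK <-; elim: (n - m)%N => [//|k IHk] x /IHk xb.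
by rewrite addSn; left.
Qed.

Hypothesis r_conn : graph_connected.

Lemma graph_ball_cover d x : exists n, graph_ball d n x.
Proof.
suff : [set x | exists n, graph_ball d n x] x by [].
rewrite (r_conn (E := [set x | exists n, graph_ball d n x])) //.
  by exists d, 0%N.
by move=> y z [n yn] ryz; exists n.+1; right; exists y.
Qed.

Lemma graph_ball_exhaust d A : finite_set A -> exists n, A `<=` graph_ball d n.
Proof.
move=> /finite_seqP[s ->]; elim: s => [|x s [n sn]].
  by exists 0%N; rewrite classical_sets.set_nil.
have [m xm] := graph_ball_cover d x; exists (maxn n m) => y.
rewrite seq_setU1 => -[->|/sn]; last exact/graph_ball_subset/leq_maxl.
exact: graph_ball_subset (leq_maxr n m) _ xm.
Qed.

Lemma coboundaryC_finite E :
  finite_coboundary E -> finite_coboundary (~` E).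
Proof.
move=> fE; apply: (@sub_finite_set _ _
  (\bigcup_(d in coboundary E) [set e | r d e])).
  move=> e [Ee [d /contrapT Ed red]]; exists d; last exact: r_sym.
  by split=> //; exists e => //; exact: r_sym.
exact: bigcup_finite.
Qed.

Lemma finite_coboundary_finite E : finite_set E -> finite_coboundary E.
Proof. by apply: sub_finite_set => d []. Qed.

Definition neighbours (K : set D) : set D :=
  [set d | ~ K d /\ exists2 k, K k & r k d].

Lemma neighbours_finite K : finite_set K -> finite_set (neighbours K).
Proof.
move=> fK; apply: (@sub_finite_set _ _ (\bigcup_(k in K) [set e | r k e])).
  by move=> d [Kd [k Kk rkd]]; exists k.
exact: bigcup_finite.
Qed.

Lemma reach_finite_coboundary K d :
  finite_set K -> ~ K d -> finite_coboundary (reach K d).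
Proof.
move=> fK Kd; apply: sub_finite_set (neighbours_finite fK) => x [dx [y dy rxy]].
split; first exact: reach_sub dx.
exists y; last exact: r_sym.
by apply: contrapT => Ky; apply: dy; apply: reach_step rxy _.
Qed.

(** Closure under larger sets is implied: if [F] contains a member and is not one itself, then its
    complement is a member, and the two meet in the empty set, which is finite. *)
Definition end_ultrafilters : set (set (set D)) :=
  [set w | [/\ w `<=` finite_coboundary,
     forall E F, w E -> w F -> w (E `&` F),
     forall E, finite_coboundary E -> w E \/ w (~` E) &
     forall E, w E -> ~ finite_set E]].

Lemma end_ultrafilters_eq w w' :
  end_ultrafilters w -> end_ultrafilters w' -> w `<=` w' -> w = w'.
Proof.
move=> [wA _ wC _] [w'A w'I _ w'F] ww'; apply/seteqP; split=> // E w'E.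
have [//|/ww' w'EC] := wC E (w'A _ w'E).
by have := w'F _ (w'I _ _ w'E w'EC); rewrite setICr => /(_ (finite_set0 _)).
Qed.

Lemma end_ultrafilter_meet w E F :
  end_ultrafilters w -> w E -> w F -> E `&` F !=set0.
Proof.
move=> [_ wI _ wF] wE wEF; apply/set0P/eqP => EF0.
by have := wF _ (wI _ _ wE wEF); rewrite EF0; apply; exact: finite_set0.
Qed.

(** The complement of [K] has finitely many components, as each contains one of the finitely many
    neighbours of [K]. An ultrafilter without finite members must choose one of them. *)
Lemma end_ultrafilter_reach w K : end_ultrafilters w ->
  K !=set0 -> finite_set K -> exists2 x, ~ K x & w (reach K x).
Proof.
move=> ww [k0 Kk0] fK; have [wA wI wC wF] := ww.
apply: contrapT => H.
have nw x : ~ K x -> w (~` reach K x).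
  move=> Kx; have [|//] := wC _ (reach_finite_coboundary fK Kx).
  by move=> wx; case: H; exists x.
have wK : w (~` K).
  have [wK|//] := wC _ (finite_coboundary_finite fK).
  by case: (wF _ wK).
have [s sE] := (finite_seqP _).1 (neighbours_finite fK).
have wI' : w (~` K `&` \bigcap_(x in [set` s]) ~` reach K x).
  have sK x : x \in s -> ~ K x.
    by move=> xs; have : [set` s] x by []; rewrite -sE => -[].
  elim: s {sE} sK => [|x s IHs] sK.
    by rewrite classical_sets.set_nil bigcap_set0 setIT.
  rewrite seq_setU1 bigcap_setU1 setICA; apply: wI.
    by apply: nw; apply: sK; rewrite mem_head.
  by apply: IHs => y ys; apply: sK; rewrite inE ys orbT.
case: (wF _ wI'); suff -> : ~` K `&` \bigcap_(x in [set` s]) ~` reach K x = set0.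
  exact: finite_set0.
rewrite -sE -subset0 => x [Kx Hx].
(* By connectedness of the graph, every vertex outside [K] lies in the component of a neighbour of
   [K]. *)
have : [set x | K x \/ exists2 y, neighbours K y & reach K y x] x.
  rewrite (r_conn (E := [set x | K x \/ exists2 y, neighbours K y & reach K y x])) //.
    by exists k0; left.
  move=> d e Hd rde; have [Ke|Ke] := pselect (K e); [by left|right].
  case: Hd => [Kd|[y Ny yd]].
    by exists e; [split=> //; exists d|exact: reach_refl].
  by exists y => //; exact: reach_step rde _.
by case=> // -[y Ny yx]; exact: (Hx y Ny).
Qed.

End CombinatorialEnds.

(** * Ends of a space covered by relatively compact connected cells *)

Section EndsOfCover.
Variables (X : topologicalType) (D : choiceType) (O : D -> set X).

Definition nerve (d e : D) : Prop := O d `&` O e !=set0.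

Definition cells (E : set D) : set X := \bigcup_(d in E) O d.

Hypothesis O_open : forall d, open (O d).
Hypothesis O_conn : forall d, connected (O d).
Hypothesis O_neq0 : forall d, O d !=set0.
Hypothesis O_cpt : forall d, compact (closure (O d)).
Hypothesis O_cover : forall x, exists d, O d x.
Hypothesis O_lf :
  forall x, exists2 N, nbhs (x : X) N & finite_set [set d | N `&` O d !=set0].

Lemma nerve_sym d e : nerve d e -> nerve e d.
Proof. by rewrite /nerve setIC. Qed.

Lemma nerve_finite d : finite_set [set e | nerve d e].
Proof.
apply: sub_finite_set (compact_locally_finite (O_cpt (d := d)) O_lf).
move=> e [x [dx ex]]; by exists x; split=> //; exact: subset_closure.
Qed.

Lemma cells_open E : open (cells E). Proof. exact: bigcup_open. Qed.

Lemma cellsC E x : cells E x \/ cells (~` E) x.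
Proof.
have [d Odx] := O_cover x.
by have [Ed|Ed] := pselect (E d); [left|right]; exists d.
Qed.

Lemma cellsIC E : cells E `&` cells (~` E) `<=` cells (coboundary nerve E).
Proof.
move=> x [[d Ed dx] [e Ee ex]]; exists d => //.
by split=> //; exists e => //; exists x.
Qed.

Lemma finite_cells_compact E : finite_set E ->
  exists2 K, compact K & cells E `<=` K.
Proof.
move=> fE; exists (\bigcup_(d in E) closure (O d)).
  exact: finite_bigcup_compact.
by apply: subset_bigcup => d _; exact: subset_closure.
Qed.

Lemma end_sequence_subset (U : nat -> set X) m n :
  end_sequence U -> (m <= n)%N -> U n `<=` U m.
Proof.
move=> [dec _ _ _] /subnK <-; elim: (n - m)%N => [//|k IHk] x.
by rewrite addSn => /dec /IHk.
Qed.

Lemma end_sequence_avoid (U : nat -> set X) E : end_sequence U -> finite_set E ->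
  exists n, U n `&` cells E = set0.
Proof.
move=> [_ _ _ esc] /finite_cells_compact[K cK EK].
have [n Kn] := esc K cK; exists n.
rewrite -subset0 => x [Ux /EK Kx].
by have : (K `&` U n) x by []; rewrite Kn.
Qed.

(** Since cells overlap, avoiding all cells outside [E] says more than being contained in [cells E];
    this stronger form is the one that passes to intersections. *)
Definition end_filter (U : nat -> set X) : set (set D) :=
  [set E | finite_coboundary nerve E /\ exists n, U n `&` cells (~` E) = set0].

Lemma end_filter_sub (U : nat -> set X) E n : U n `&` cells (~` E) = set0 -> U n `<=` cells E.
Proof.
move=> UE x Ux; have [//|xE] := cellsC E x.
by have : (U n `&` cells (~` E)) x by []; rewrite UE.
Qed.

(** [cells E] and the cells of the complement overlap only in the coboundary of [E], whose finitely
    many cells [U n] avoids for large [n]; the connected [U n] then lies on one side. *)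
Lemma end_filter_ultra (U : nat -> set X) : end_sequence U -> end_ultrafilters nerve (end_filter U).
Proof.
move=> endU; have [dec op _ _] := endU; split.
- by move=> E [].
- move=> E F [fE [n En]] [fF [m Fm]]; split.
    apply: (@sub_finite_set _ _ (coboundary nerve E `|` coboundary nerve F)).
      move=> d [[Ed Fd] [e /not_andP[Ee|Fe] de]].
        by left; split=> //; exists e.
      by right; split=> //; exists e.
    by rewrite finite_setU.
  exists (maxn n m); rewrite setCI -subset0 => x [Ux [d [Ed|Fd] dx]].
    have : (U n `&` cells (~` E)) x.
      split; last by exists d.
      exact: end_sequence_subset (leq_maxl n m) _ Ux.
    by rewrite En.
  have : (U m `&` cells (~` F)) x.
    split; last by exists d.
    exact: end_sequence_subset (leq_maxr n m) _ Ux.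
  by rewrite Fm.
- move=> E fE; have [n nE] := end_sequence_avoid endU fE.
  have [_ Uc _ _] := op n.
  have dis : U n `&` cells E `&` cells (~` E) = set0.
    rewrite -subset0 -setIA => x [Ux /cellsIC xE].
    by have : (U n `&` cells (coboundary nerve E)) x by []; rewrite nE.
  have [|UE|UE] := connected_subset_openU Uc (cells_open E) (cells_open (~` E)) _ dis.
  + by move=> x _; exact: cellsC.
  + left; split=> //; exists n; rewrite -subset0 => x [Ux xE].
    by rewrite -dis; split=> //; split=> //; exact: UE.
  + right; split; first exact: (coboundaryC_finite nerve_sym nerve_finite).
    exists n; rewrite setCK -subset0 => x [Ux xE].
    by rewrite -dis; split; [split|exact: UE].
- move=> E [_ [n En]] fE; have [m mE] := end_sequence_avoid endU fE.
  have [[x Ux] _ _ _] := op (maxn n m).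
  have xn := end_sequence_subset endU (leq_maxl n m) Ux.
  have xm := end_sequence_subset endU (leq_maxr n m) Ux.
  have xE := end_filter_sub En xn.
  by have : (U m `&` cells E) x by []; rewrite mE.
Qed.

Lemma end_filter_equiv (U U' : nat -> set X) : end_equiv U U' -> end_filter U = end_filter U'.
Proof.
move=> [UU' U'U]; apply/seteqP; split=> E [fE [n nE]]; split=> //.
  have [k kn] := UU' n; exists k.
  by rewrite -subset0 -nE => x [/kn Ux xE].
have [k kn] := U'U n; exists k.
by rewrite -subset0 -nE => x [/kn Ux xE].
Qed.

(* For [U l] in an end sequence, the cells inside [U l] have finite coboundary,
   because a cell meeting but not inside [U l] meets the compact frontier. *)
Lemma end_filter_refine (U U' : nat -> set X) : end_sequence U -> end_filter U `<=` end_filter U' ->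
  forall l, exists k, U' k `<=` U l.
Proof.
move=> endU UU' l; have [dec op _ _] := endU.
have [_ _ _ cF] := op l.
pose B := [set d | frontier (U l) `&` O d !=set0].
have fB : finite_set B := compact_locally_finite cF O_lf.
pose E := [set d | O d `<=` U l].
have meet d : O d `&` U l !=set0 -> ~ E d -> B d.
  move=> dU Ed; rewrite /B /= setIC.
  by apply: connected_meets_frontier => //.
have EU : cells E `<=` U l by move=> x [d]; apply.
have wE : end_filter U E.
  split.
    apply: (@sub_finite_set _ _ (\bigcup_(e in B) [set d | nerve e d])).
      move=> d [Ed [e Ee [x [dx ex]]]]; exists e; last by exists x.
      by apply: meet => //; exists x; split=> //; exact: Ed.
    by apply: bigcup_finite => // e _; exact: nerve_finite.
  have [n nB] := end_sequence_avoid endU fB.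
  exists (maxn l n); rewrite -subset0 => x [Ux [d Ed dx]].
  suff : (U n `&` cells B) x by rewrite nB.
  split; first exact: (end_sequence_subset endU (leq_maxr l n)).
  exists d => //; apply: meet => //; exists x; split=> //.
  exact: (end_sequence_subset endU (leq_maxl l n)).
have [_ [k kE]] := UU' _ wE.
by exists k; apply: subset_trans EU; exact: end_filter_sub.
Qed.

Lemma cells_reach_connected K d : connected (cells (reach nerve K d)).
Proof.
pose P := [set C : set X | [/\ connected C, O d `<=` C & C `<=` cells (reach nerve K d)]].
have -> : cells (reach nerve K d) = \bigcup_(C in P) C.
  apply/seteqP; split=> [x [e de ex]|x [C [_ _ CE] Cx]]; last exact: CE.
  suff [C PC eC] : [set e | exists2 C, P C & O e `<=` C] e.
    by exists C => //; exact: eC.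
  have [] : (reach nerve K d `&` [set e | exists2 C, P C & O e `<=` C]) e.
    apply: de.
      split; first exact: reach_refl.
      by exists (O d) => //; split=> // y dy; exists d => //; exact: reach_refl.
    move=> f g [df [C [cC dC CE] fC]] fg Kg.
    have dg : reach nerve K d g by exact: reach_step fg Kg.
    split=> //; exists (C `|` O g); last by right.
    split; last 1 first.
    - by rewrite subUset; split=> // y gy; exists g.
    - apply: connectedU => //; have [y [fy gy]] := fg.
      by exists y; split=> //; exact: fC.
    - by move=> y /dC; left.
  by [].
apply: bigcup_connected; last by move=> C [].
by have [x dx] := O_neq0 d; exists x => C [_ dC _]; exact: dC.
Qed.

Lemma nerve_connected : connected [set: X] -> graph_connected nerve.
Proof.
move=> cX E [d Ed] Er.
have dis : cells E `&` cells (~` E) = set0.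
  by rewrite -subset0 => x [[a Ea ax] [b Eb bx]]; apply: Eb; apply: (Er a) => //; exists x.
have [||XE|XE] := connected_subset_openU cX (cells_open E) (cells_open (~` E)).
- by move=> x _; exact: cellsC.
- by rewrite setTI.
- apply/seteqP; split=> // e _; apply: contrapT => Ee.
  have [x ex] := O_neq0 e; have : (cells E `&` cells (~` E)) x.
    by split; [exact: XE|exists e].
  by rewrite dis.
- have [x dx] := O_neq0 d; have : (cells E `&` cells (~` E)) x.
    by split; [exists d|exact: XE].
  by rewrite dis.
Qed.

Hypothesis D_conn : graph_connected nerve.
Hypothesis D_neq0 : [set: D] !=set0.

(** The ultrafilter chooses a component [E n] outside each ball [K n] of the nerve, and the cells of
    these components form the required sequence. The balls exhaust the nerve, so the sequence leaves
    every compact set. *)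
Lemma end_filter_surj w : end_ultrafilters nerve w ->
  exists2 U : nat -> set X, end_sequence U & end_filter U = w.
Proof.
move=> ww; have [d0 _] := D_neq0.
pose K := graph_ball nerve d0.
have fK n : finite_set (K n) := graph_ball_finite nerve_finite d0 n.
have K0 n : K n !=set0.
  by exists d0; exact: (graph_ball_subset (leq0n n)).
have /choice[c cP] n : exists x, ~ K n x /\ w (reach nerve (K n) x).
  have [x Kx wx] := end_ultrafilter_reach nerve_sym nerve_finite D_conn ww (K0 n) (fK n).
  by exists x.
pose E n := reach nerve (K n) (c n).
have wE n : w (E n) by have [] := cP n.
have EK n : E n `<=` ~` K n by apply: reach_sub; have [] := cP n.
(* Two members of [w] share a vertex [x], and each of the components is that of [x]; removing a
   larger ball leaves a smaller component. *)
have dec n : E n.+1 `<=` E n.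
  have [x [x1 x0]] := end_ultrafilter_meet ww (wE n.+1) (wE n).
  rewrite /E -(reach_eq nerve_sym (cP n).1 x0) -(reach_eq nerve_sym (cP n.+1).1 x1).
  by apply: reach_subset; exact: (graph_ball_subset (leqnSn n)).
have esc d : exists n, O d `&` cells (E n) = set0.
  have [n nK] := graph_ball_exhaust D_conn d0 (nerve_finite d).
  exists n; rewrite -subset0 => x [dx [e Ee ex]].
  by apply: (EK n e Ee); apply: nK; exists x.
have endU : end_sequence (fun n => cells (E n)).
  split.
  - by move=> n x [d /dec Ed dx]; exists d.
  - move=> n; split.
    + have [x dx] := O_neq0 (c n).
      by exists x, (c n) => //; exact: reach_refl.
    + exact: cells_reach_connected.
    + exact: cells_open.
    + have [C cC KC] := finite_cells_compact (fK n).
      apply: (subclosed_compact _ (finite_bigcup_compact (fK n) O_cpt)).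
        apply: closedI; first exact: closed_closure.
        exact/open_closedC/open_interior.
      (* The frontier lies in the closed cells of [K n]: if a cell [d] around [x] were outside
         [K n], it would meet a cell of the component, hence belong to the component, and [x] would
         be an interior point. *)
      move=> x [cx ix]; have [d dx] := O_cover x.
      suff Kd : K n d by exists d => //; exact: subset_closure.
      apply: contrapT => Kd; apply: ix; rewrite (interior_id _).1; last exact: cells_open.
      exists d => //.
      have [y [[e Ee ey] dy]] := cx (O d) (open_nbhs_nbhs (conj (O_open d) dx)).
      by apply: reach_step Ee _ Kd; exists y.
  - rewrite -subset0 => x Hx; have [d dx] := O_cover x.
    have [n nd] := esc d.
    have [y [yE yd]] := Hx n I (O d) (open_nbhs_nbhs (conj (O_open d) dx)).
    by have : (O d `&` cells (E n)) y by []; rewrite nd.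
  - move=> C cC.
    have [n nK] := graph_ball_exhaust D_conn d0 (compact_locally_finite cC O_lf).
    exists n; rewrite -subset0 => x [Cx [e Ee ex]].
    by apply: (EK n e Ee); apply: nK; exists x.
exists (fun n => cells (E n)) => //.
apply/esym; apply: (end_ultrafilters_eq ww (end_filter_ultra endU)) => F wF.
have [wA _ _ _] := ww; have [_ _ uC _] := end_filter_ultra endU.
have [//|[_ [n nF]]] := uC F (wA _ wF).
have [d [Fd Ed]] := end_ultrafilter_meet ww wF (wE n).
have [x dx] := O_neq0 d.
have : (cells (E n) `&` cells (~` ~` F)) x by split; exists d => //; rewrite setCK.
by rewrite nF.
Qed.

Lemma end_equiv_refl (U : nat -> set X) : end_equiv U U.
Proof. by split=> n; exists n. Qed.

Lemma end_equiv_sym (U U' : nat -> set X) : end_equiv U U' -> end_equiv U' U.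
Proof. by case. Qed.

Lemma end_equiv_trans (U U' U'' : nat -> set X) :
  end_equiv U U' -> end_equiv U' U'' -> end_equiv U U''.
Proof.
move=> [a b] [a' b']; split=> n.
  have [k kn] := a n; have [l lk] := a' k.
  by exists l; exact: subset_trans kn.
have [k kn] := b' n; have [l lk] := b k.
by exists l; exact: subset_trans kn.
Qed.

Theorem Ends_end_ultrafilters : Ends X #= end_ultrafilters nerve.
Proof.
suff [f bf] : exists f, set_bij (Ends X) (end_ultrafilters nerve) f.
  by have /Pbij[g _] := bf; exact: pcard_eq g.
(* Equivalent sequences have equal filters, so this union over a class is the filter of any
   representative. *)
pose f (c : set (nat -> set X)) :=
  [set E | exists2 U, c U & end_filter U E].
have fE U : end_sequence U ->
    f [set U' | end_sequence U' /\ end_equiv U U'] = end_filter U.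
  move=> endU; apply/seteqP; split=> E.
    by move=> [U' [_ /end_filter_equiv ->]].
  by exists U => //; split=> //; exact: end_equiv_refl.
exists f; split.
- by move=> _ [U endU <-]; rewrite fE //; exact: end_filter_ultra.
- move=> c c'; rewrite !inE => -[U endU <-] [U' endU' <-]; rewrite !fE // => UU'.
  have eqU : end_equiv U U'.
    by split; apply: end_filter_refine => //; rewrite UU'.
  apply/seteqP; split=> V [endV eV]; split=> //.
    exact: end_equiv_trans (end_equiv_sym eqU) eV.
  exact: end_equiv_trans eqU eV.
- move=> w /end_filter_surj[U endU <-].
  by exists [set U' | end_sequence U' /\ end_equiv U U']; [exists U|exact: fE].
Qed.

End EndsOfCover.

(** * Almost invariant sets of a group *)

Section GroupEnds.
Local Open Scope group_scope.
Variable H : groupType.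

(** The sets that differ from each of their right translates by a finite set; the other one-sided
    difference is covered by the inverse of [s]. *)
Definition almost_invariant : set (set H) :=
  [set E | forall s, finite_set [set g | E g /\ ~ E (g * s)]].

Lemma finite_set_mulg (P : set H) t :
  finite_set P -> finite_set [set g | P (g * t)].
Proof.
move=> fP; apply: (@sub_finite_set _ _ ((fun k => k * t^-1) @` P)).
  by move=> g Pg; exists (g * t) => //; rewrite mulgK.
exact: finite_image.
Qed.

Variables (r : H -> H -> Prop) (A B : set H).
Hypothesis B_fin : finite_set B.
Hypothesis A_gen : generates A.
Hypothesis rA : forall g s, A s -> r g (g * s).
Hypothesis rB : forall g h, r g h -> B (g^-1 * h).
Hypothesis r_sym : forall g h, r g h -> r h g.

Lemma group_graph_connected : graph_connected r.
Proof.
move=> E [g0 Eg0] Er.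
(* The right translations that preserve [E] form a subgroup, and closure of [E] under [r] puts the
   generators in it. *)
pose S := [set s : H | forall g, E g <-> E (g * s)].
have ST : S = setT.
  apply: A_gen.
    split=> [|s t]; first by rewrite inE => g; rewrite mulg1.
    rewrite !inE => Ss St g; have := Ss g; have := St (g * s / t).
    by rewrite mulgA divgK; tauto.
  move=> s As g; split=> Eg; first exact: Er (rA g As).
  by apply: Er Eg _; apply: r_sym; exact: rA.
apply/seteqP; split=> // h _.
have : S (g0^-1 * h) by rewrite ST.
by move=> /(_ g0) [/(_ Eg0)]; rewrite mulgA mulgV mul1g.
Qed.

(** The relation [r] lies between the right translations by the generators [A] and those by the
    finite set [B]. The first make finite coboundary a condition strong enough, the second keep it
    weak enough. *)
Lemma group_finite_coboundary : finite_coboundary r = almost_invariant.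
Proof.
apply/seteqP; split=> E fE; last first.
  apply: (@sub_finite_set _ _ (\bigcup_(b in B) [set g | E g /\ ~ E (g * b)])).
    move=> g [Eg [h Eh gh]]; exists (g^-1 * h); first exact: rB.
    by rewrite /= mulgA mulgV mul1g.
  by apply: bigcup_finite => // b _; exact: fE.
(* Both differences are recorded so that [S] is closed under division: moving by [s / t] is compared
   with moving by [s], and the error is a translate of a difference for [t]. *)
pose S := [set s : H | finite_set [set g | E g /\ ~ E (g * s)] /\
                       finite_set [set g | ~ E g /\ E (g * s)]].
suff ST : S = setT by move=> s; have [] : S s by rewrite ST.
apply: A_gen.
  split=> [|s t].
    rewrite inE; split; apply: sub_finite_set (finite_set0 H) => g /=;
      by rewrite mulg1 => -[].
  rewrite !inE => -[s1 s2] [t1 t2]; split.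
    apply: (@sub_finite_set _ _ ([set g | E g /\ ~ E (g * s)] `|`
        [set g | [set k | ~ E k /\ E (k * t)] (g * (s / t))])).
      move=> g [Eg nE]; have [Egs|] := pselect (E (g * s)); last by left.
      by right; split=> //=; rewrite mulgA divgK.
    by rewrite finite_setU; split=> //; exact: finite_set_mulg.
  apply: (@sub_finite_set _ _ ([set g | ~ E g /\ E (g * s)] `|`
      [set g | [set k | E k /\ ~ E (k * t)] (g * (s / t))])).
    move=> g [Eg nE]; have [Egs|] := pselect (E (g * s)); first by left.
    by right; split=> //=; rewrite mulgA divgK.
  by rewrite finite_setU; split=> //; exact: finite_set_mulg.
move=> s As; split.
  by apply: sub_finite_set fE => g [Eg nE]; split=> //; exists (g * s) => //; exact: rA.
apply: (@sub_finite_set _ _ [set g | coboundary r E (g * s)]).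
  by move=> g [nE Eg]; split=> //; exists g => //; apply: r_sym; exact: rA.
exact: finite_set_mulg.
Qed.

End GroupEnds.

(** * Realizations of graphs *)

Section Clamp.
Variable R : realType.
Implicit Types a b t : R.

(** The retraction of the line onto [a, b], written with norms so that its continuity is immediate.
    It replaces maps on intervals by maps on the whole line. *)
Definition clamp a b t : R := (a + b + `|t - a| - `|t - b|) / 2.

Lemma clamp_continuous a b : continuous (clamp a b).
Proof.
move=> t; apply: cvgM; last exact: cvg_cst.
apply: cvgB; first apply: cvgD; first exact: cvg_cst.
  by apply: cvg_norm; apply: cvgB; [exact: cvg_id|exact: cvg_cst].
by apply: cvg_norm; apply: cvgB; [exact: cvg_id|exact: cvg_cst].
Qed.

Lemma clamp_id a b t : a <= t <= b -> clamp a b t = t.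
Proof.
move=> /andP[at_ tb]; rewrite /clamp ger0_norm ?subr_ge0 //.
by rewrite distrC ger0_norm ?subr_ge0 //; lra.
Qed.

Lemma clamp_itv a b t : a <= b -> a <= clamp a b t <= b.
Proof.
move=> ab; rewrite /clamp.
case: (ger0P (t - a)) => ta; case: (ger0P (t - b)) => tb; apply/andP; split; lra.
Qed.

End Clamp.

Section RealizationTopology.
Variables (R : realType) (V : choiceType) (G : simple_graph V).
Local Notation Y := (realization R G).

Definition coord (v : V) (y : Y) : R := val y v.

Lemma coord_continuous v : continuous (coord v).
Proof.
move=> y; rewrite /coord -set_valE.
apply: (@continuous_comp Y {ptws V -> R} R set_val (@^~ v)).
  exact: initial_continuous.
exact: (@proj_continuous V (fun=> R) v).
Qed.

Lemma continuous_realization (X : topologicalType) (f : X -> Y) :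
  (forall v, continuous (coord v \o f)) -> continuous f.
Proof.
move=> cf; apply/continuousP => _ [B oB <-].
suff: continuous (set_val \o f : X -> {ptws V -> R}).
  by move=> /continuousP /(_ _ oB).
move=> x; apply/cvg_sup => v.
move: x; apply/(@continuousP _ (initial_topology (@^~ v))) => A [C oC <-].
have -> : (set_val \o f) @^-1` ((@^~ v) @^-1` C) = (coord v \o f) @^-1` C.
  by apply/seteqP; split=> x; rewrite /preimage /= /coord set_valE.
by have /continuousP /(_ _ oC) := cf v.
Qed.

Lemma realization_hausdorff : hausdorff_space Y.
Proof.
move=> p q pq; apply: val_inj; apply/funext => v.
apply: (@Rhausdorff R) => A B Ap Bq.
have [y [Ay By]] := pq _ _ (coord_continuous Ap) (coord_continuous Bq).
by exists (coord v y).
Qed.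

Lemma coord_vertex u v : coord u (vertex_point R G v) = (u == v)%:R.
Proof. by rewrite /coord /= /bary subr0 mul1r mul0r addr0. Qed.

Lemma edge_path_subproof u v (t : R) : adj G u v ->
  bary u v (clamp 0 1 t) \in @realization_set R V G.
Proof.
by move=> uv; rewrite inE; right; exists u, v, (clamp 0 1 t); split=> //; apply: clamp_itv.
Qed.

(** The edge is parametrized by the whole line, constant outside [0, 1], to avoid subspace
    topologies. *)
Definition edge_path u v (uv : adj G u v) (t : R) : Y :=
  exist (fun x => x \in @realization_set R V G) _ (edge_path_subproof t uv).

Lemma coord_edge_path u v (uv : adj G u v) t w : 0 <= t <= 1 ->
  coord w (edge_path uv t) = (1 - t) * (w == u)%:R + t * (w == v)%:R.
Proof. by move=> t01; rewrite /coord /= /bary clamp_id. Qed.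

Lemma edge_path_continuous u v (uv : adj G u v) : continuous (edge_path uv).
Proof.
apply: continuous_realization => w t; rewrite /coord /= /bary.
apply: cvgD; apply: cvgM; try exact: cvg_cst; last exact: clamp_continuous.
by apply: cvgB; [exact: cvg_cst|exact: clamp_continuous].
Qed.

Lemma adj_neq u v : adj G u v -> u != v.
Proof. by move=> uv; apply/eqP => E; rewrite E adj_irr in uv. Qed.

Lemma edge_path0 u v (uv : adj G u v) : edge_path uv 0 = vertex_point R G u.
Proof.
apply: val_inj; apply/funext => w; rewrite -[LHS]/(coord w _) -[RHS]/(coord w _).
by rewrite coord_edge_path ?lexx ?ler01 // coord_vertex subr0 mul1r mul0r addr0.
Qed.

Lemma edge_path_sym u v (uv : adj G u v) (vu : adj G v u) t : 0 <= t <= 1 ->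
  edge_path uv t = edge_path vu (1 - t).
Proof.
move=> /andP[t0 t1]; apply: val_inj; apply/funext => w.
rewrite -[LHS]/(coord w _) -[RHS]/(coord w _) !coord_edge_path ?t0 //.
  by rewrite subKr addrC.
by rewrite subr_ge0 t1 lerBlDr lerDl.
Qed.

Lemma edge_path1 u v (uv : adj G u v) : edge_path uv 1 = vertex_point R G v.
Proof.
have vu : adj G v u by rewrite adj_sym.
by rewrite (edge_path_sym uv vu) ?ler01 ?lexx // subrr edge_path0.
Qed.

Lemma realizationP (y : Y) : (exists u, y = vertex_point R G u) \/
  exists u v (uv : adj G u v) t, 0 <= t <= 1 /\ y = edge_path uv t.
Proof.
have := valP y; rewrite inE => -[[u E]|[u [v [t [uv t01 E]]]]]; [left|right].
  by exists u; exact: val_inj.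
by exists u, v, uv, t; split=> //; apply: val_inj; rewrite /= clamp_id.
Qed.

Definition star (v : V) : set Y := [set y | 0 < coord v y].

Lemma star_open v : open (star v).
Proof.
have -> : star v = coord v @^-1` [set x | 0 < x] by [].
by apply: open_comp; [move=> y _; exact: coord_continuous|exact: open_gt].
Qed.

Lemma star_vertex v : star v (vertex_point R G v).
Proof. by rewrite /star /= coord_vertex eqxx ltr01. Qed.

Lemma star_edge_path u v (uv : adj G u v) t : 0 <= t < 1 -> star u (edge_path uv t).
Proof.
move=> /andP[t0 t1]; rewrite /star /= coord_edge_path ?t0 ?ltW //.
by rewrite eqxx (negbTE (adj_neq uv)) mulr1 mulr0 addr0 subr_gt0.
Qed.

Lemma star_edge_path_r u v (uv : adj G u v) t : 0 < t <= 1 -> star v (edge_path uv t).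
Proof.
move=> /andP[t0 t1]; rewrite /star /= coord_edge_path ?t1 ?ltW //.
by rewrite eqxx eq_sym (negbTE (adj_neq uv)) mulr1 mulr0 add0r.
Qed.

Lemma starP v y : star v y -> y = vertex_point R G v \/
  exists w (vw : adj G v w) t, 0 <= t < 1 /\ y = edge_path vw t.
Proof.
rewrite /star /=; have [[u ->]|[u [w [uw [t [t01 ->]]]]]] := realizationP y.
  rewrite coord_vertex; case: eqVneq => [->|_]; first by left.
  by rewrite ltxx.
rewrite coord_edge_path //; case: (eqVneq v u) => [E|_].
  subst u; rewrite (negbTE (adj_neq uw)) mulr1 mulr0 addr0 subr_gt0 => t1.
  by right; exists w, uw, t; rewrite t1 andbT; case/andP: t01.
case: (eqVneq v w) => [E|_]; last by rewrite !mulr0 addr0 ltxx.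
subst w; rewrite mulr0 add0r mulr1 => t0; right.
have wu : adj G v u by rewrite adj_sym.
exists u, wu, (1 - t); rewrite -edge_path_sym //; split=> //.
by case/andP: t01 => _ t1; rewrite subr_ge0 t1 ltrBlDr ltrDl.
Qed.

Lemma realization_star (y : Y) : exists v, star v y.
Proof.
have [[u ->]|[u [v [uv [t [/andP[t0 t1] ->]]]]]] := realizationP y.
  by exists u; exact: star_vertex.
move: t1; rewrite le_eqVlt => /orP[/eqP->|t1].
  by exists v; rewrite edge_path1; exact: star_vertex.
by exists u; apply: star_edge_path; rewrite t0.
Qed.

Lemma star_meet u v y : star u y -> star v y -> u = v \/ adj G u v.
Proof.
move=> /starP[->|[w [uw [t [/andP[t0 t1] ->]]]]]; rewrite /star /=.
  by rewrite coord_vertex; case: eqVneq => [->|]; [left|rewrite ltxx].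
rewrite coord_edge_path ?t0 ?ltW //.
case: (eqVneq v u) => [->|_]; first by left.
by case: (eqVneq v w) => [->|_]; [right|rewrite !mulr0 addr0 ltxx].
Qed.

Lemma edge_path_image_compact u v (uv : adj G u v) (a b : R) :
  compact (edge_path uv @` `[a, b]).
Proof.
apply: continuous_compact; last exact: segment_compact.
by apply: continuous_subspaceT; exact: edge_path_continuous.
Qed.

Lemma edge_path_image_connected u v (uv : adj G u v) (a b : R) :
  connected (edge_path uv @` `[a, b]).
Proof.
apply: connected_continuous_connected.
  by apply/connected_intervalP; exact: interval_is_interval.
by apply: continuous_subspaceT; exact: edge_path_continuous.
Qed.

Lemma star_path v y : star v y -> exists C : set Y,
  [/\ connected C, C (vertex_point R G v), C y & C `<=` star v].
Proof.
move=> /starP[->|[w [vw [t [/andP[t0 t1] ->]]]]].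
  exists [set vertex_point R G v]; split=> //; first exact: connected1.
  by move=> _ ->; exact: star_vertex.
exists (edge_path vw @` `[0, t]); split.
- exact: edge_path_image_connected.
- by exists 0; rewrite ?edge_path0 //= in_itv /= lexx t0.
- by exists t => //=; rewrite in_itv /= t0 lexx.
- move=> z [s]; rewrite /= in_itv /= => /andP[s0 st] <-.
  by apply: star_edge_path; rewrite s0 (le_lt_trans st).
Qed.

Lemma segment_edge_path u v (uv : adj G u v) :
  @segment R V G [set u; v] = edge_path uv @` `[0, 1].
Proof.
have vu : adj G v u by rewrite adj_sym.
apply/seteqP; split=> [y ye|z [t]]; last first.
  rewrite /= in_itv /= => t01 <- w /= /not_orP[wu wv].
  rewrite -[LHS]/(coord w (edge_path uv t)) coord_edge_path //.
  by move/eqP/negbTE: wu => ->; move/eqP/negbTE: wv => ->; rewrite !mulr0 addr0.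
have sup w : star w y -> w = u \/ w = v.
  rewrite /star /=; apply: contraPP => /ye; rewrite /coord => ->.
  by rewrite ltxx.
have [w wy] := realization_star y.
have [] := sup w wy => E; subst w.
  case: (starP wy) => [->|[w [uw [t [t01 yE]]]]].
    by exists 0; rewrite ?edge_path0 //= in_itv /= lexx ler01.
  move: (t01) => /andP[]; rewrite le_eqVlt => /orP[/eqP t0|t0] t1.
    by exists 0; rewrite ?edge_path0 /= ?in_itv /= ?lexx ?ler01 // yE -t0 edge_path0.
  have : star w y by rewrite yE; apply: star_edge_path_r; rewrite t0 ltW.
  move=> /sup[] E; subst w; first by move: (uw); rewrite adj_irr.
  exists t; first by rewrite /= in_itv /= !ltW.
  by rewrite yE; congr (edge_path _ _); exact: bool_irrelevance.
case: (starP wy) => [->|[w [vw [t [t01 yE]]]]].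
  by exists 1; rewrite ?edge_path1 //= in_itv /= lexx ler01.
move: (t01) => /andP[]; rewrite le_eqVlt => /orP[/eqP t0|t0] t1.
  by exists 1; rewrite ?edge_path1 /= ?in_itv /= ?lexx ?ler01 // yE -t0 edge_path0.
have : star w y by rewrite yE; apply: star_edge_path_r; rewrite t0 ltW.
move=> /sup[] E; subst w; last by move: (vw); rewrite adj_irr.
exists (1 - t); first by rewrite /= in_itv /= subr_ge0 ltW // lerBlDr lerDl ltW.
rewrite yE (edge_path_sym vw uv) //; rewrite ltW //=; exact: ltW.
Qed.

Lemma star_closed_star v : star v `<=` [set vertex_point R G v] `|`
  \bigcup_(w in [set w | adj G v w]) @segment R V G [set v; w].
Proof.
move=> y /starP[->|[w [vw [t [/andP[t0 t1] ->]]]]]; [by left|right].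
by exists w => //; rewrite (segment_edge_path vw); exists t; rewrite //= in_itv /= t0 ltW.
Qed.

Lemma star_connected v : connected (star v).
Proof.
have -> : star v = \bigcup_(C in [set C : set Y |
    [/\ connected C, C (vertex_point R G v) & C `<=` star v]]) C.
  apply/seteqP; split=> [y /star_path[C [cC Cv Cy CS]]|y [C [_ _ CS] /CS]//].
  by exists C.
apply: bigcup_connected; last by move=> C [].
by exists (vertex_point R G v) => C [].
Qed.

Hypothesis G_lf : locally_finite G.

Lemma star_closure_compact v : compact (closure (star v)).
Proof.
have [s sE] := (finite_seqP _).1 (G_lf v).
have cK : compact ([set vertex_point R G v] `|`
    \bigcup_(w in [set w | adj G v w]) @segment R V G [set v; w]).
  apply: compactU; first exact: compact_set1.
  rewrite sE; have : [set` s] `<=` [set w | adj G v w] by rewrite sE.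
  elim: s {sE} => [_|w s IHs].
    by rewrite classical_sets.set_nil bigcup_set0; exact: compact0.
  rewrite seq_setU1 subUset => -[vw sv]; rewrite bigcup_setU1.
  apply: compactU; last exact: IHs.
  have vw' : adj G v w by apply: vw.
  by rewrite (segment_edge_path vw'); exact: edge_path_image_compact.
apply: (subclosed_compact (@closed_closure _ _) cK).
rewrite [X in _ `<=` X](closure_id _).1; last exact: (compact_closed realization_hausdorff).
by apply: closureS; exact: star_closed_star.
Qed.

Lemma star_locally_finite (y : Y) :
  exists2 N, nbhs (y : Y) N & finite_set [set v | N `&` star v !=set0].
Proof.
have [u uy] := realization_star y; exists (star u).
  by apply: open_nbhs_nbhs; split=> //; exact: star_open.
apply: (@sub_finite_set _ _ ([set u] `|` [set w | adj G u w])).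
  by move=> v [z [uz vz]]; have [->|] := star_meet uz vz; [left|right].
by rewrite finite_setU; split; [exact: finite_set1|exact: G_lf].
Qed.

End RealizationTopology.

(** * The Cayley graph covered by its open stars *)

Section CayleyEnds.
Local Open Scope group_scope.
Variables (R : realType) (H : groupType) (A : set H).
Hypotheses (A_fin : finite_set A) (A_gen : generates A).

(** The identity accounts for a star meeting itself, the inverses for the edges having no
    direction. *)
Let B : set H := [set 1] `|` A `|` (fun s => s^-1) @` A.

Lemma cayley_locally_finite : locally_finite (cayley_graph A).
Proof.
move=> g; apply: (@sub_finite_set _ _ ((fun b => g * b) @` B)); last first.
  apply: finite_image; rewrite !finite_setU; split; last exact: finite_image.
  by split=> //; exact: finite_set1.
move=> h /= /andP[_ /asboolP[s As [->|->]]].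
  by exists s => //; left; right.
by exists s^-1; [right; exists s|rewrite mulgK].
Qed.

Let cell (g : H) : set (realization R (cayley_graph A)) := star g.

Lemma cayley_nerveB g h : nerve cell g h -> B (g^-1 * h).
Proof.
move=> [y [gy hy]]; have [->|] := star_meet gy hy.
  by rewrite mulVg; left; left.
move=> /andP[_ /asboolP[s As [->|->]]]; first by rewrite mulKg; left; right.
by right; exists s => //; rewrite invgM mulgVK.
Qed.

Lemma cayley_nerveA g s : A s -> nerve cell g (g * s).
Proof.
move=> As; have [E|ne] := eqVneq g (g * s).
  rewrite -E; exists (vertex_point R (cayley_graph A) g).
  by split; exact: star_vertex.
have adjs : adj (cayley_graph A) g (g * s).
  by rewrite /= /cayley_rel ne; apply/asboolP; exists s => //; left.
have half : (0 < 2^-1 :> R)%R /\ (2^-1 < 1 :> R)%R by split; lra.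
case: half => h0 h1.
exists (edge_path (R := R) adjs 2^-1%R); split.
  by apply: star_edge_path; rewrite h1 ltW.
by apply: star_edge_path_r; rewrite h0 ltW.
Qed.

Lemma group_ends_ultrafilters :
  group_ends R A #= end_ultrafilters (nerve cell) /\
  finite_coboundary (nerve cell) = almost_invariant (H := H).
Proof.
have B_fin : finite_set B.
  rewrite !finite_setU; split; last exact: finite_image.
  by split=> //; exact: finite_set1.
have nsym g h : nerve cell g h -> nerve cell h g by exact: nerve_sym.
split; last exact: (group_finite_coboundary B_fin A_gen cayley_nerveA cayley_nerveB nsym).
apply: Ends_end_ultrafilters.
- by move=> g; exact: star_open.
- by move=> g; exact: star_connected.
- by move=> g; exists (vertex_point R (cayley_graph A) g); exact: star_vertex.
- by move=> g; exact: (star_closure_compact cayley_locally_finite).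
- exact: realization_star.
- exact: (star_locally_finite cayley_locally_finite).
- exact: (group_graph_connected A_gen cayley_nerveA nsym).
- by exists 1.
Qed.

End CayleyEnds.

(** * Lifting functions modulo 1 *)

Section ModZ.
Variable R : realType.

(** Continuity of the induced map to the circle R/Z; keeping real representatives avoids the
    quotient. *)
Definition continuous_modZ (T : topologicalType) (h : T -> R) (x : T) :=
  forall e : R, 0 < e ->
    \forall y \near x, exists n : int, `|h y - h x - n%:~R| < e.

(** Near [x] each value of [H] may follow either branch, as long as both agree with [H] at [x]
    itself. This serves where the angle crosses the axis, and at the frontier of a region. *)
Lemma continuous_modZ_glue (T : topologicalType) (h k H : T -> R) (x : T) :
  continuous_modZ h x -> continuous_modZ k x ->
  H x - h x \is a Num.int -> H x - k x \is a Num.int ->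
  (\forall y \near x, H y - h y \is a Num.int \/ H y - k y \is a Num.int) ->
  continuous_modZ H x.
Proof.
move=> ch ck /intrP[m mE] /intrP[n nE] Hy e e0.
near=> y.
have [/intrP[j jE]|/intrP[j jE]] : H y - h y \is a Num.int \/ H y - k y \is a Num.int.
  by near: y.
- have [i] : exists i : int, `|h y - h x - i%:~R| < e by near: y; exact: ch.
  exists (i + j - m)%R; rewrite !(intrD, intrN) -jE -mE.
  by apply: le_lt_trans p; rewrite le_eqVlt; apply/orP; left; apply/eqP; congr (`| _ |); ring.
- have [i] : exists i : int, `|k y - k x - i%:~R| < e by near: y; exact: ck.
  exists (i + j - n)%R; rewrite !(intrD, intrN) -jE -nE.
  by apply: le_lt_trans p; rewrite le_eqVlt; apply/orP; left; apply/eqP; congr (`| _ |); ring.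
Unshelve. all: by end_near. Qed.

Lemma continuous_continuous_modZ (T : topologicalType) (h : T -> R) (x : T) :
  {for x, continuous h} -> continuous_modZ h x.
Proof.
move=> ch e e0; have /cvgrPdist_lt /(_ e e0) : h y @[y --> x] --> h x := ch.
by apply: filterS => y hy; exists 0; rewrite subr0 distrC.
Qed.

Lemma continuous_modZD (T : topologicalType) (h k : T -> R) (x : T) :
  continuous_modZ h x -> continuous_modZ k x ->
  continuous_modZ (fun y => h y + k y) x.
Proof.
move=> ch ck e e0; have e20 : 0 < e / 2 by rewrite divr_gt0.
near=> y.
have [i hi] : exists i : int, `|h y - h x - i%:~R| < e / 2 by near: y; exact: ch.
have [j kj] : exists j : int, `|k y - k x - j%:~R| < e / 2 by near: y; exact: ck.
exists (i + j)%R; rewrite intrD.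
have -> : h y + k y - (h x + k x) - (i%:~R + j%:~R) =
  (h y - h x - i%:~R) + (k y - k x - j%:~R) by ring.
by rewrite (le_lt_trans (ler_normD _ _)) // [ltRHS]splitr ltrD.
Unshelve. all: by end_near. Qed.

Lemma continuous_modZM (T : topologicalType) (c : int) (h : T -> R) (x : T) :
  continuous_modZ h x -> continuous_modZ (fun y => c%:~R * h y) x.
Proof.
move=> ch e e0; have c0 : 0 < `|c|%:~R + 1 :> R by rewrite ltr_pwDr // ler0z.
have d0 : 0 < e / (`|c|%:~R + 1) by rewrite divr_gt0.
have := ch _ d0; apply: filterS => y [i hi]; exists (c * i)%R.
rewrite intrM -!mulrBr normrM -intr_norm.
move: hi; rewrite ltr_pdivlMr // => hi.
by rewrite (le_lt_trans _ hi) // mulrC ler_wpM2l // lerDl.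
Qed.

Lemma continuous_modZ_comp (T U : topologicalType) (f : T -> U) (h : U -> R) (x : T) :
  {for x, continuous f} -> continuous_modZ h (f x) ->
  continuous_modZ (h \o f) x.
Proof. by move=> cf ch e e0; have := cf _ (ch e e0). Qed.

(** As a function on the circle R/Z, this representative jumps only at the class of one half. *)
Definition centered_rem (u : R) : R := u - (Num.floor (u + 2^-1))%:~R.

Lemma centered_rem_itv u : - 2^-1 <= centered_rem u < 2^-1.
Proof.
have /andP[l r] := floor_itv (u + 2^-1); rewrite /centered_rem.
by move: r; rewrite intrD => r; apply/andP; split; lra.
Qed.

Lemma centered_rem_int u : u - centered_rem u \is a Num.int.
Proof. by rewrite /centered_rem opprB addrC subrK intr_int. Qed.

Lemma int_lt1 (x : R) : x \is a Num.int -> -1 < x < 1 -> x = 0.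
Proof.
move=> /intrP[m ->] /andP[m1 m2].
have {}m1 : -1 < m by rewrite -(ltr_int R) intrN.
have {}m2 : m < 1 by rewrite -(ltr_int R).
by have -> : m = 0 by lia.
Qed.

Lemma half_not_int : (2^-1 : R) \isn't a Num.int.
Proof.
apply/negP => /int_lt1 H; suff : (2^-1 : R) = 0 by lra.
by apply: H; apply/andP; split; lra.
Qed.

Lemma centered_rem_uniq u v : u - v \is a Num.int -> - 2^-1 <= v < 2^-1 ->
  centered_rem u = v.
Proof.
move=> uv /andP[v1 v2]; have /andP[u1 u2] := centered_rem_itv u.
apply/eqP; rewrite -subr_eq0; apply/eqP; apply: int_lt1.
  have -> : centered_rem u - v = (u - v) - (u - centered_rem u) by ring.
  by rewrite rpredB // centered_rem_int.
by apply/andP; split; lra.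
Qed.

Lemma centered_rem_continuous (T : topologicalType) (h : T -> R) (x : T) :
  continuous_modZ h x -> h x - 2^-1 \isn't a Num.int ->
  {for x, continuous (centered_rem \o h)}.
Proof.
move=> ch hx; set r := centered_rem (h x).
have /andP[r1 r2] : - 2^-1 <= r < 2^-1 := centered_rem_itv _.
have r1' : - 2^-1 < r.
  rewrite lt_neqAle r1 andbT; apply: contra hx => /eqP rE.
  have -> : h x - 2^-1 = (h x - r) - 1 by rewrite -rE; field.
  by rewrite rpredB ?centered_rem_int ?rpred1.
apply/cvgrPdist_lt => e e0 /=.
(* The bound keeps [r] plus the deviation inside [-1/2, 1/2), where the representative is unique. *)
have d0 : 0 < Num.min e (Num.min (2^-1 - r) (2^-1 + r)).
  by rewrite !lt_min e0 /= subr_gt0 r2 /=; lra.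
have := ch _ d0; apply: filterS => y [n]; rewrite !lt_min !ltr_norml.
move=> /and3P[/andP[a1 a2] /andP[b1 b2] /andP[c1 c2]].
rewrite -/r (@centered_rem_uniq (h y) (r + (h y - h x - n%:~R))).
- by apply/andP; split; lra.
- have -> : h y - (r + (h y - h x - n%:~R)) = (h x - r) + n%:~R by ring.
  by rewrite rpredD ?centered_rem_int ?intr_int.
- by apply/andP; split; lra.
Qed.

Lemma int_valued_const (f : R -> R) :
  continuous f -> (forall t, f t \is a Num.int) -> forall s t, f s = f t.
Proof.
move=> cf fZ; suff H s t : s <= t -> f s = f t.
  by move=> s t; have [/H//|/ltW/H] := leP s t.
move=> st; apply/eqP; apply: contraT => ne.
pose m := Num.min (f s) (f t); pose M := Num.max (f s) (f t).
have mM : m + 1 <= M.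
  have /intrP[i iE] := fZ s; have /intrP[j jE] := fZ t.
  have ij : i != j by apply: contraNneq ne => E; rewrite iE jE E.
  rewrite /m /M iE jE; case: (ltP (i%:~R : R) j%:~R); rewrite ?ltr_int ?ler_int => h;
    rewrite -(intrD _ _ 1) ler_int; lia.
(* The two integers differ by at least 1, so that the value [m + 2^-1] lies between them and is
   attained. *)
have [||c _ fc] := @IVT R f s t (m + 2^-1) st.
- exact: continuous_subspaceT.
- by rewrite -/m -/M; apply/andP; split; lra.
have : 2^-1 \is a @Num.int R.
  have -> : 2^-1 = (m + 2^-1) - m by ring.
  by rewrite rpredB // -?fc // /m; have [] := leP (f s) (f t).
by rewrite (negbTE half_not_int).
Qed.

(** The supremum of the [t] for which [Q a t] holds is [b], since near the supremum the local
    hypothesis extends [Q] beyond it. *)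
Lemma interval_induction (Q : R -> R -> Prop) :
  (forall x, exists2 d, 0 < d &
     forall s t, x - d <= s -> s <= t -> t <= x + d -> Q s t) ->
  (forall s m t, s <= m -> m <= t -> Q s m -> Q m t -> Q s t) ->
  forall a b, a <= b -> Q a b.
Proof.
move=> loc glue a b ab.
pose E := [set t | a <= t <= b /\ Q a t].
have Ea : E a.
  split; first by rewrite lexx.
  by have [d d0] := loc a; apply; lra.
have ubE : ubound E b by move=> t [/andP[]].
have hsE : has_sup E by split; [exists a|exists b].
have sb : sup E <= b by apply: ge_sup => //; exists a.
have as_ : a <= sup E by apply: ub_le_sup => //; exists b.
have [d d0 dP] := loc (sup E).
have [t [/andP[at_ tb] Qt] ts] := sup_adherent d0 hsE.
have tsup : t <= sup E by apply: ub_le_sup; [exists b|split; rewrite ?at_].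
have step u : sup E <= u -> u <= b -> u <= sup E + d -> E u.
  move=> su ub ud; split; first by rewrite ub andbT (le_trans as_).
  by apply: (glue a t u) => //; [lra|apply: dP; lra].
have [bs|sb'] := leP b (sup E).
  by apply: (step b _ _ _).2; lra.
have : E (Num.min b (sup E + d)).
  by apply: step; rewrite ?ge_min ?lexx ?orbT // le_min ltW //=; lra.
move=> /(ub_le_sup (ex_intro _ b ubE)).
by rewrite ge_min; lra.
Qed.


Lemma continuous_pair (T U W : topologicalType) (f : T -> U) (g : T -> W) x :
  {for x, continuous f} -> {for x, continuous g} ->
  {for x, continuous (fun y => (f y, g y))}.
Proof. by move=> cf cg; exact: cvg_pair. Qed.

Lemma fst_continuous (T U : topologicalType) : continuous (@fst T U).
Proof. by move=> x; exact: cvg_fst. Qed.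

Lemma snd_continuous (T U : topologicalType) : continuous (@snd T U).
Proof. by move=> x; exact: cvg_snd. Qed.

Lemma clamp_ge a b t : a <= b -> b <= t -> clamp a b t = b :> R.
Proof.
move=> ab bt; rewrite /clamp !ger0_norm ?subr_ge0 ?(le_trans ab) //; lra.
Qed.

Lemma clamp_le a b t : a <= b -> t <= a -> clamp a b t = a :> R.
Proof.
move=> ab ta; rewrite /clamp !ler0_norm ?subr_le0 ?(le_trans ta) //; lra.
Qed.

(** * Lifts over rectangles *)

(** The lift is continuous on the whole plane and compared with [h] only on the rectangle; clamping
    the arguments makes this no restriction. *)
Definition liftable (h : R * R -> R) (a b c d : R) := exists2 L : R * R -> R,
  continuous L & forall x y, a <= x <= b -> c <= y <= d ->
    L (x, y) - h (x, y) \is a Num.int.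

Lemma liftableS h a b c d a' b' c' d' : a <= a' -> b' <= b -> c <= c' -> d' <= d ->
  liftable h a b c d -> liftable h a' b' c' d'.
Proof.
move=> aa bb cc dd [L cL LP]; exists L => // x y /andP[x1 x2] /andP[y1 y2].
by apply: LP; apply/andP; split; lra.
Qed.

Lemma clamp_pair_continuous a b c d :
  continuous (fun z : R * R => (clamp a b z.1, clamp c d z.2)).
Proof.
move=> z; apply: (@continuous_pair _ _ _ (fun z : R * R => clamp a b z.1)
  (fun z => clamp c d z.2) z).
  by apply: continuous_comp; [exact: fst_continuous|exact: clamp_continuous].
by apply: continuous_comp; [exact: snd_continuous|exact: clamp_continuous].
Qed.

Lemma liftable_glue h a m b c d : a <= m -> m <= b -> c <= d ->
  liftable h a m c d -> liftable h m b c d -> liftable h a b c d.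
Proof.
move=> am mb cd [L1 c1 P1] [L2 c2 P2].
(* Left of [m] the last two terms cancel. Right of [m] the first and the last are frozen on the line
   of abscissa [m], where they differ by integers, whose constancy need not be known. *)
exists (fun z => L1 (clamp a m z.1, clamp c d z.2) + L2 (clamp m b z.1, clamp c d z.2)
                 - L2 (clamp m m z.1, clamp c d z.2)).
  move=> z; apply: cvgB; first apply: cvgD.
  - by apply: (continuous_comp (@clamp_pair_continuous a m c d z)); exact: c1.
  - by apply: (continuous_comp (@clamp_pair_continuous m b c d z)); exact: c2.
  - by apply: (continuous_comp (@clamp_pair_continuous m m c d z)); exact: c2.
move=> x y /andP[ax xb] cyd /=.
rewrite (clamp_id cyd); have -> : clamp m m x = m.
  by apply/eqP; rewrite eq_le andbC; exact: clamp_itv.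
have [xm|mx] := leP x m.
  rewrite (@clamp_le m b) // clamp_id ?ax // addrK.
  by apply: P1; rewrite ?ax.
have mx' := ltW mx; rewrite (@clamp_ge a m) // (@clamp_id _ m b) ?xb ?mx' //.
have -> : L1 (m, y) + L2 (x, y) - L2 (m, y) - h (x, y) =
  (L1 (m, y) - h (m, y)) + (L2 (x, y) - h (x, y)) - (L2 (m, y) - h (m, y)) by ring.
have h1 : L1 (m, y) - h (m, y) \is a Num.int by apply: P1; rewrite ?am ?lexx.
have h2 : L2 (x, y) - h (x, y) \is a Num.int by apply: P2; rewrite ?mx' ?xb.
have h3 : L2 (m, y) - h (m, y) \is a Num.int by apply: P2; rewrite ?lexx.
by rewrite rpredB // rpredD.
Qed.

Lemma liftable_swap h a b c d :
  liftable (fun z => h (z.2, z.1)) c d a b -> liftable h a b c d.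
Proof.
move=> [L cL LP]; exists (fun z => L (z.2, z.1)).
  move=> z; apply: (@continuous_comp _ _ _ (fun z : R * R => (z.2, z.1)) L); last exact: cL.
  by apply: (@continuous_pair _ _ _ snd fst); [exact: snd_continuous|exact: fst_continuous].
by move=> x y xab ycd; have := LP y x ycd xab.
Qed.

Lemma near_box (Q : set (R * R)) (z : R * R) : nbhs z Q ->
  exists2 d, 0 < d & forall w, `|w.1 - z.1| <= d -> `|w.2 - z.2| <= d -> Q w.
Proof.
move=> /nbhs_ballP[e /= e0 eQ]; exists (e / 2); first by rewrite divr_gt0.
move=> w w1 w2; apply: eQ; split; rewrite /ball /= distrC.
  by apply: (le_lt_trans w1); lra.
by apply: (le_lt_trans w2); lra.
Qed.

(** Near the centre [h] stays within a quarter of its central value modulo 1. The centered remainder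
    of the difference is thus away from its jump at one half, and gives the lift. *)
Lemma liftable_local h (x y : R) : (forall z, continuous_modZ h z) ->
  exists2 d, 0 < d & liftable h (x - d) (x + d) (y - d) (y + d).
Proof.
move=> ch; have e0 : 0 < 4^-1 :> R by lra.
have [d d0 dP] := near_box (ch (x, y) _ e0); exists d => //.
pose cl (z : R * R) := (clamp (x - d) (x + d) z.1, clamp (y - d) (y + d) z.2).
exists (fun z => h (x, y) + (centered_rem \o (fun w => h w - h (x, y))) (cl z)).
  move=> z; apply: cvgD; first exact: cvg_cst.
  apply: (continuous_comp (@clamp_pair_continuous _ _ _ _ z)).
  apply: centered_rem_continuous.
    apply: continuous_modZD; first exact: ch.
    by apply: continuous_continuous_modZ; exact: cvg_cst.
  have /andP[a1 a2] := @clamp_itv _ (x - d) (x + d) z.1 ltac:(lra).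
  have /andP[b1 b2] := @clamp_itv _ (y - d) (y + d) z.2 ltac:(lra).
  have [||n] := dP (cl z); rewrite ?ler_norml /=; try (apply/andP; split; lra).
  rewrite -/(cl z) ltr_norml => /andP[n1 n2]; apply/negP => hZ.
  have hn : h (cl z) - h (x, y) - n%:~R = 2^-1.
    apply/eqP; rewrite -subr_eq0; apply/eqP; apply: int_lt1.
      by rewrite addrAC rpredB // intr_int.
    by apply/andP; split; lra.
  lra.
move=> x' y' x'P y'P; rewrite /cl /= !clamp_id //.
rewrite -[X in X \is a _]opprK rpredN opprB opprD addrA.
exact: centered_rem_int.
Qed.

(** Two inductions along intervals: along [y], where the width of a strip about the fixed [x]
    shrinks to a minimum at each gluing, then along [x] to join the strips. *)
Lemma liftable_box h a b c d : (forall z, continuous_modZ h z) -> a <= b -> c <= d ->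
  liftable h a b c d.
Proof.
move=> ch ab cd.
suff strip (x : R) : exists2 e, 0 < e & liftable h (x - e) (x + e) c d.
  apply: (@interval_induction (fun s t => liftable h s t c d)) ab => [x|s m t sm mt].
    have [e e0 le] := strip x; exists e => // s t xs st tx.
    by apply: liftableS le.
  exact: liftable_glue.
move: c d cd; apply: interval_induction => [y|s m t sm mt [d d0 Ld] [e e0 Le]].
  have [e e0 le] := liftable_local x y ch; exists e => // s t ys st ty.
  by exists e => //; apply: liftableS le.
exists (Num.min d e); first by rewrite lt_min d0.
have m1 : Num.min d e <= d by rewrite ge_min lexx.
have m2 : Num.min d e <= e by rewrite ge_min lexx orbT.
have m0 : 0 < Num.min d e by rewrite lt_min d0.
apply: liftable_swap; apply: (@liftable_glue _ s m t) => //; first lra.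
  apply: liftable_swap; apply: liftableS Ld; lra.
apply: liftable_swap; apply: liftableS Le; lra.
Qed.

Lemma lift_path (h : R -> R) a b : (forall t, continuous_modZ h t) -> a <= b ->
  exists2 l : R -> R, continuous l & forall t, a <= t <= b -> l t - h t \is a Num.int.
Proof.
move=> ch ab; have [|L cL LP] := @liftable_box (h \o fst) a b 0 0 _ ab (lexx 0).
  by move=> z; apply: continuous_modZ_comp; [exact: fst_continuous|exact: ch].
exists (fun t => L (t, 0)).
  move=> t; apply: (@continuous_comp _ _ _ (fun t : R => (t, 0)) L); last exact: cL.
  by apply: (@continuous_pair _ _ _ id (fun=> 0)); [exact: cvg_id|exact: cvg_cst].
by move=> t tab; apply: LP; rewrite ?lexx.
Qed.


(** * An angle modulo 1 and its degree on a circle *)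

Definition diamond_ratio (z : R * R) : R := z.1 / (`|z.1| + `|z.2|).

(* A piecewise rational angle with values in [-1/2, 1/2], continuous modulo 1 except at the
   origin, where division by 0 makes it 1/4; it parametrizes the circles of |x| + |y|. *)
Definition angle (z : R * R) : R :=
  if 0 <= z.2 then (1 - diamond_ratio z) / 4 else - ((1 - diamond_ratio z) / 4).

Lemma norm1_gt0 (z : R * R) : z <> (0, 0) -> 0 < `|z.1| + `|z.2|.
Proof.
case: z => x y /= xy; rewrite lt_neqAle addr_ge0 // andbT eq_sym.
by rewrite paddr_eq0 // !normr_eq0; apply/negP => /andP[/eqP x0 /eqP y0]; apply: xy; rewrite x0 y0.
Qed.

Lemma diamond_ratio_norm (z : R * R) : z <> (0, 0) ->
  `|diamond_ratio z| + `|z.2 / (`|z.1| + `|z.2|)| = 1.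
Proof.
move=> /norm1_gt0 s0; rewrite /diamond_ratio !normrM !normfV (ger0_norm (ltW s0)).
by rewrite -mulrDl divff // gt_eqF.
Qed.

Lemma diamond_ratio_continuous z : z <> (0, 0) -> {for z, continuous diamond_ratio}.
Proof.
move=> /norm1_gt0 s0; apply: cvgM; first exact: fst_continuous.
apply: cvgV; first by rewrite gt_eqF.
by apply: cvgD; apply: cvg_norm; [exact: fst_continuous|exact: snd_continuous].
Qed.

Lemma angle_continuous_modZ z : z <> (0, 0) -> continuous_modZ angle z.
Proof.
move=> z0; have s0 := norm1_gt0 z0.
pose h (w : R * R) : R := (1 - diamond_ratio w) / 4.
have ch : continuous_modZ h z.
  apply: continuous_continuous_modZ; apply: cvgM; last exact: cvg_cst.
  by apply: cvgB; [exact: cvg_cst|exact: diamond_ratio_continuous].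
have ck := continuous_modZM (-1) ch.
have E w : angle w = if 0 <= w.2 then h w else (-1)%:~R * h w.
  by rewrite /angle intrN mulN1r.
(* Only the horizontal axis needs gluing: the two branches are both 0 on its positive half, and 1/2
   and -1/2 on its negative half. *)
have [z2|z2] := eqVneq z.2 0.
  apply: (continuous_modZ_glue ch ck).
  - by rewrite E z2 lexx subrr rpred0.
  - have x0 : z.1 != 0 by apply/eqP => x0; apply: z0; rewrite [z]surjective_pairing x0 z2.
    rewrite E z2 lexx intrN mulN1r opprK /h /diamond_ratio z2 normr0 addr0.
    have [xp|xn] : 0 < z.1 \/ z.1 < 0.
    + by move: x0; rewrite neq_lt => /orP[]; [right|left].
    + by rewrite gtr0_norm // divff // subrr mul0r addr0 rpred0.
    + rewrite ltr0_norm // invrN mulrN divff // opprK.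
      have -> : (1 + 1) / 4 + (1 + 1) / 4 = 1 :> R by field.
      exact: rpred1.
  - by near=> w; rewrite !E; case: ifP => _; [left|right]; rewrite subrr rpred0.
move: z2; rewrite neq_lt => /orP[z2|z2].
  apply: (continuous_modZ_glue ck ck); rewrite ?E ?leNgt ?z2 /= ?subrr ?rpred0 //.
  near=> w; left; rewrite E leNgt.
  have -> : w.2 < 0.
    near: w; have : open [set w : R * R | w.2 < 0].
      apply: (@open_comp _ _ (@snd R R) [set t | t < 0]); last exact: open_lt.
      by move=> w _; exact: snd_continuous.
    by move=> o; apply: open_nbhs_nbhs; split.
  by rewrite /= subrr rpred0.
apply: (continuous_modZ_glue ch ch); rewrite ?E ?ltW ?z2 /= ?subrr ?rpred0 //.
near=> w; left; rewrite E.
have -> : 0 <= w.2.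
  apply: ltW; near: w; have : open [set w : R * R | 0 < w.2].
    apply: (@open_comp _ _ (@snd R R) [set t | 0 < t]); last exact: open_gt.
    by move=> w _; exact: snd_continuous.
  by move=> o; apply: open_nbhs_nbhs; split.
by rewrite subrr rpred0.
Unshelve. all: by end_near. Qed.

Lemma lerNnorm (x : R) : - `|x| <= x.
Proof. by rewrite lerNl -normrN ler_norm. Qed.

Lemma int_half_diff (x : R) :
  -1 <= x <= 1 -> x - 2^-1 \is a Num.int -> x = 2^-1 \/ x = - 2^-1.
Proof.
move=> /andP[x1 x2] xZ; have [xl|xl] := ltP x 0.
  right; apply/eqP; rewrite -subr_eq0; apply/eqP; apply: int_lt1; last by lra.
  have -> : x - - 2^-1 = (x - 2^-1) + 1 by field.
  by rewrite rpredD ?rpred1.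
left; apply/eqP; rewrite -subr_eq0; apply/eqP; apply: int_lt1 => //; lra.
Qed.

(** The difference of the angles is 1/2 or -1/2. If [b] and [d] have the same sign, this is possible
    only at the two ends of the horizontal diagonal; if not, it gives [a = - c] at once, and the
    norms give the rest. *)
Lemma angle_opposite_aux (a b c d : R) :
  `|a| + `|b| = 1 -> `|c| + `|d| = 1 ->
  (if 0 <= b then (1 - a) / 4 else - ((1 - a) / 4)) -
  (if 0 <= d then (1 - c) / 4 else - ((1 - c) / 4)) - 2^-1 \is a Num.int ->
  a = - c /\ b = - d.
Proof.
have la := ler_norm a; have la' := lerNnorm a.
have lc := ler_norm c; have lc' := lerNnorm c.
have same (u v : R) : 0 <= u -> 0 <= v -> `|a| + u = 1 -> `|c| + v = 1 ->
    (c - a = 2 \/ c - a = - 2) -> a = - c /\ (u = 0 /\ v = 0).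
  by move=> u0 v0 au cv [] E; (split; [lra|split; lra]).
have opp (u v : R) : `|a| + u = 1 -> `|c| + v = 1 -> a = - c -> u = v.
  by move=> au cv ac; move: au; rewrite ac normrN; lra.
case: (ger0P b) => b0; case: (ger0P d) => d0 nz nw /int_half_diff.
- case; first by apply/andP; split; lra.
    by move=> E; have [|-> [-> ->]] := same b d b0 d0 nz nw; [left; lra|rewrite oppr0].
  by move=> E; have [|-> [-> ->]] := same b d b0 d0 nz nw; [right; lra|rewrite oppr0].
- case; first by apply/andP; split; lra.
    by move=> E; (have ac : a = - c by lra); split; [|exact: (opp b (- d) nz nw ac)].
  by move=> E; (have ac : a = - c by lra); split; [|exact: (opp b (- d) nz nw ac)].
- case; first by apply/andP; split; lra.
    move=> E; (have ac : a = - c by lra); split=> //.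
    by apply: oppr_inj; rewrite opprK; exact: (opp (- b) d nz nw ac).
  move=> E; (have ac : a = - c by lra); split=> //.
  by apply: oppr_inj; rewrite opprK; exact: (opp (- b) d nz nw ac).
- case; first by apply/andP; split; lra.
    by move=> E; exfalso; lra.
  by move=> E; exfalso; lra.
Qed.

(** Together with [centered_rem_continuous] this locates the jumps of the centered difference of two
    angles. *)
Lemma angle_opposite z w : z <> (0, 0) -> w <> (0, 0) ->
  angle z - angle w - 2^-1 \is a Num.int ->
  exists2 k, 0 < k & z.1 = - k * w.1 /\ z.2 = - k * w.2.
Proof.
move=> z0 w0; have sz := norm1_gt0 z0; have sw := norm1_gt0 w0.
set s := `|z.1| + `|z.2| in sz; set t := `|w.1| + `|w.2| in sw.
move=> ZZ.
suff [e1 e2] : z.1 / s = - (w.1 / t) /\ z.2 / s = - (w.2 / t).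
  exists (s / t); first by rewrite divr_gt0.
  have s1 : s != 0 by rewrite gt_eqF.
  split; [rewrite -[LHS](divfK s1) e1|rewrite -[LHS](divfK s1) e2]; field; rewrite gt_eqF //.
have nz := diamond_ratio_norm z0; have nw := diamond_ratio_norm w0.
move: ZZ nz nw; rewrite /angle /diamond_ratio -/s -/t.
set a := z.1 / s; set b := z.2 / s; set c := w.1 / t; set d := w.2 / t.
have bz : (0 <= z.2) = (0 <= b) by rewrite /b pmulr_lge0 // invr_gt0.
have dw : (0 <= w.2) = (0 <= d) by rewrite /d pmulr_lge0 // invr_gt0.
rewrite bz dw => ZZ nz nw.
exact: angle_opposite_aux.
Qed.

(** The circle |x| + |y| = 1 parametrized by its angle [t] in [-1/2, 1/2]; the second coordinate is
    a triangle wave, again written with norms for continuity. *)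
Definition diamond (t : R) : R * R :=
  (1 - 4 * `|t|, 4 * (`|t + 4^-1| - `|t - 4^-1|) - 4 * t).

Lemma diamond_continuous : continuous diamond.
Proof.
move=> t.
have c1 : {for t, continuous (fun t : R => 1 - 4 * `|t|)}.
  by apply: cvgB; [exact: cvg_cst|apply: cvgM; [exact: cvg_cst|exact: norm_continuous]].
have c2 : {for t, continuous (fun t : R => 4 * (`|t + 4^-1| - `|t - 4^-1|) - 4 * t)}.
  apply: cvgB; last by apply: cvgM; [exact: cvg_cst|exact: cvg_id].
  apply: cvgM; first exact: cvg_cst.
  by apply: cvgB; apply: cvg_norm; [apply: cvgD|apply: cvgB];
    (exact: cvg_id || exact: cvg_cst).
exact: (continuous_pair c1 c2).
Qed.

Lemma diamond_norm t : - 2^-1 <= t <= 2^-1 ->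
  `|(diamond t).1| + `|(diamond t).2| = 1.
Proof.
rewrite /diamond /= => /andP[t1 t2].
case: (ger0P t) => t0; case: (ger0P (t + 4^-1)) => t3; case: (ger0P (t - 4^-1)) => t4;
  match goal with |- `|?u| + `|?v| = _ => case: (ger0P u) => h1; case: (ger0P v) => h2 end;
  lra.
Qed.

Lemma angle_diamond t s : 0 < s -> - 2^-1 <= t <= 2^-1 ->
  angle (s * (diamond t).1, s * (diamond t).2) - t \is a Num.int.
Proof.
move=> s0 tP; have dn := diamond_norm tP; move: (tP) => /andP[t1 t2].
have r : diamond_ratio (s * (diamond t).1, s * (diamond t).2) = (diamond t).1.
  rewrite /diamond_ratio /= !normrM -mulrDr dn mulr1 (ger0_norm (ltW s0)).
  by rewrite mulrAC divff ?mul1r // gt_eqF.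
rewrite /angle r /= pmulr_rge0 //.
case: (ger0P t) => t0.
  have -> : 0 <= 4 * (`|t + 4^-1| - `|t - 4^-1|) - 4 * t.
    case: (ger0P (t + 4^-1)) => t3; case: (ger0P (t - 4^-1)) => t4; lra.
  have -> : (1 - (1 - 4 * t)) / 4 - t = 0 by field.
  exact: rpred0.
have [e|ne] := eqVneq t (- 2^-1).
  have -> : 0 <= 4 * (`|t + 4^-1| - `|t - 4^-1|) - 4 * t.
    case: (ger0P (t + 4^-1)) => t3; case: (ger0P (t - 4^-1)) => t4; lra.
  have -> : (1 - (1 - 4 * - t)) / 4 - t = 1 by rewrite e; field.
  exact: rpred1.
have -> : 0 <= 4 * (`|t + 4^-1| - `|t - 4^-1|) - 4 * t = false.
  apply/negP; have : - 2^-1 < t by rewrite lt_neqAle eq_sym ne.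
  case: (ger0P (t + 4^-1)) => t3; case: (ger0P (t - 4^-1)) => t4; lra.
have -> : - ((1 - (1 - 4 * - t)) / 4) - t = 0 by field.
exact: rpred0.
Qed.

(** Along the circle, parametrized by its angle [t], the lift minus [c] times [t] is continuous with
    integer values, hence constant. The circle closes up at -1/2 and 1/2, where the two values
    differ by [c]. *)
Lemma angle_no_lift (L : R * R -> R) (p : R * R) (s : R) (c : int) :
  continuous L -> 0 < s ->
  (forall w, `|w.1| + `|w.2| = s ->
     L (p.1 + w.1, p.2 + w.2) - c%:~R * angle w \is a Num.int) ->
  c = 0.
Proof.
move=> cL s0 LP.
pose w t := (s * (diamond t).1, s * (diamond t).2).
pose pw t := (p.1 + (w t).1, p.2 + (w t).2).
have cpw : continuous pw.
  move=> t; have cd := diamond_continuous (x := t).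
  apply: (@continuous_pair _ _ _ (fun t => p.1 + s * (diamond t).1)
    (fun t => p.2 + s * (diamond t).2)); (apply: cvgD; first exact: cvg_cst);
  (apply: cvgM; first exact: cvg_cst).
    exact: (continuous_comp cd (@fst_continuous _ _ _)).
  exact: (continuous_comp cd (@snd_continuous _ _ _)).
pose cl := clamp (- 2^-1) (2^-1 : R).
have clP t : - 2^-1 <= cl t <= 2^-1 by apply: clamp_itv; lra.
pose f t := L (pw (cl t)) - c%:~R * cl t.
have cf : continuous f.
  move=> t; have ccl : {for t, continuous cl} by exact: clamp_continuous.
  apply: cvgB; last by apply: cvgM; [exact: cvg_cst|exact: ccl].
  apply: (@continuous_comp _ _ _ (pw \o cl) L); last exact: cL.
  by apply: (@continuous_comp _ _ _ cl pw); [exact: ccl|exact: cpw].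
have fZ t : f t \is a Num.int.
  have -> : f t = (L (pw (cl t)) - c%:~R * angle (w (cl t))) +
    c%:~R * (angle (w (cl t)) - cl t) by rewrite /f; ring.
  rewrite rpredD //.
    apply: LP; rewrite !normrM -mulrDr diamond_norm // mulr1 gtr0_norm //.
  by rewrite rpredM ?intr_int // angle_diamond.
have := int_valued_const cf fZ (- 2^-1) 2^-1.
rewrite /f /cl !clamp_id; try lra.
have -> : pw (- 2^-1) = pw 2^-1.
  rewrite /pw /w /diamond /= normrN; congr (_, _ + _ * _).
  case: (ger0P (- 2^-1 + 4^-1 : R)) => ?; case: (ger0P (- 2^-1 - 4^-1 : R)) => ?;
  case: (ger0P (2^-1 + 4^-1 : R)) => ?; case: (ger0P (2^-1 - 4^-1 : R)) => ?; lra.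
move=> E; have : c%:~R = 0 :> R by lra.
by move=> /eqP; rewrite intr_eq0 => /eqP.
Qed.

End ModZ.

(** * Three regions along a planar arc *)

Section PlanarSeparation.
Variable R : realType.
Local Notation P := (R * R)%type.

Definition angle_at (p z : P) : R := angle (z.1 - p.1, z.2 - p.2).

Lemma angle_at_continuous_modZ p z : z <> p -> continuous_modZ (angle_at p) z.
Proof.
move=> zp; have cf : {for z, continuous (fun z : P => (z.1 - p.1, z.2 - p.2))}.
  apply: (@continuous_pair _ _ _ (fun z : P => z.1 - p.1) (fun z : P => z.2 - p.2)).
    by apply: cvgB; [exact: fst_continuous|exact: cvg_cst].
  by apply: cvgB; [exact: snd_continuous|exact: cvg_cst].
apply: (continuous_modZ_comp cf); apply: angle_continuous_modZ => -[/eqP e1 /eqP e2].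
by apply: zp; rewrite [z]surjective_pairing [p]surjective_pairing; congr (_, _);
  apply/eqP; rewrite -subr_eq0.
Qed.

(** On the compact [A] the map [f] is closed, so that [g] inherits continuity on the image from its
    composite with [f]. *)
Lemma within_continuous_lift (T U W : topologicalType) (f : T -> U) (g : U -> W)
    (l : T -> W) (A : set T) :
  hausdorff_space U -> continuous f -> continuous l -> compact A ->
  (forall t, A t -> g (f t) = l t) -> {within f @` A, continuous g}.
Proof.
move=> hU cf cl cA gf; apply/continuous_closedP => C clC.
apply/closed_subspaceP; exists (f @` (A `&` l @^-1` C)).
  apply: compact_closed => //; apply: continuous_compact.
    exact: continuous_subspaceT.
  by apply: compact_closedI => //; exact: preimage_closed.
apply/seteqP; split=> z.
  by move=> [[t [At Ct] <-] _]; split; [rewrite /preimage /= /from_subspace gf|exists t].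
by move=> [Cz [t At E]]; split; [exists t => //; split=> //|exists t => //];
  rewrite /preimage /= -gf // E.
Qed.

Lemma planar_no_lift (U K : set P) (p q r : P) (c1 c2 c3 : int) (N : R) (th : P -> R) :
  open U -> (forall z, closure U z -> U z \/ K z) -> compact K ->
  (forall z, U z -> `|z.1| < N /\ `|z.2| < N) ->
  U p -> ~ U q -> ~ U r -> ~ K p -> ~ K q -> ~ K r ->
  {within K, continuous th} ->
  (forall z, K z -> th z -
     (c1%:~R * angle_at p z + c2%:~R * angle_at q z + c3%:~R * angle_at r z) \is a Num.int) ->
  c1 = 0.
Proof.
move=> oU clU cK UN Up Uq Ur Kp Kq Kr cth thK.
have [M M0 thM] : exists2 M : R, 0 < M & forall z, K z -> `|th z| <= M.
  have cthK : compact (th @` K) by exact: continuous_compact.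
  have [M [_ MP]] := compact_bounded cthK.
  exists (Num.max 1 (M + 1)); first by rewrite lt_max ltr01.
  by move=> z Kz; apply: (MP _ _ (th z)); [rewrite lt_max ltrDl ltr01 orbT|exists z].
have hP : hausdorff_space P by exact: norm_hausdorff.
have [Th [eTh cTh _]] := continuous_bounded_extension (@pseudometric_normal R P)
  (compact_closed hP cK) M0 cth thM.
pose h z := Th z + ((- c2)%:~R * angle_at q z + (- c3)%:~R * angle_at r z).
pose k z := c1%:~R * angle_at p z.
(* On [U] only the singular points [q] and [r] matter, and they are outside; off [U] only [p]
   matters, and it is inside. On the frontier of [U], which lies in [K], the two branches agree
   modulo 1. *)
pose H z := if `[< U z >] then h z else k z.
have ch z : z <> q -> z <> r -> continuous_modZ h z.
  move=> zq zr; apply: continuous_modZD.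
    by apply: continuous_continuous_modZ; exact: cTh.
  by apply: continuous_modZD; apply: continuous_modZM; exact: angle_at_continuous_modZ.
have ck z : z <> p -> continuous_modZ k z.
  by move=> zp; apply: continuous_modZM; exact: angle_at_continuous_modZ.
have HU z : U z -> H z = h z by move=> Uz; rewrite /H asboolT.
have HnU z : ~ U z -> H z = k z by move=> Uz; rewrite /H asboolF.
have cH z : continuous_modZ H z.
  have [Uz|Uz] := pselect (U z).
    have c := ch z ltac:(by move=> E; subst z) ltac:(by move=> E; subst z).
    apply: (continuous_modZ_glue c c); rewrite ?HU // ?subrr ?rpred0 //.
    have : nbhs z U by apply: open_nbhs_nbhs.
    by apply: filterS => y Uy; left; rewrite HU // subrr rpred0.
  have zp : z <> p by move=> E; subst z.
  have [cz|cz] := pselect (closure U z); last first.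
    have c := ck z zp.
    apply: (continuous_modZ_glue c c); rewrite ?HnU // ?subrr ?rpred0 //.
    have : nbhs z (~` closure U).
      by apply: open_nbhs_nbhs; split=> //; apply: closed_openC; exact: closed_closure.
    apply: filterS => y Uy; left; rewrite HnU ?subrr ?rpred0 // => Uy'.
    by apply: Uy; exact: subset_closure.
  have [//|Kz] := clU z cz.
  have cc := ch z ltac:(by move=> E; subst z) ltac:(by move=> E; subst z).
  apply: (continuous_modZ_glue cc (ck z zp)).
  - rewrite HnU // /h /k -eTh ?inE // -rpredN !intrN.
    have -> : - (c1%:~R * angle_at p z -
      (th z + (- c2%:~R * angle_at q z + - c3%:~R * angle_at r z))) =
      th z - (c1%:~R * angle_at p z + c2%:~R * angle_at q z + c3%:~R * angle_at r z) by ring.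
    exact: thK.
  - by rewrite HnU // subrr rpred0.
  - near=> y; have [Uy|Uy] := pselect (U y); [left|right].
      by rewrite HU // subrr rpred0.
    by rewrite HnU // subrr rpred0.
have N0 : 0 < N by have [pN _] := UN p Up; exact: le_lt_trans pN.
have N5 : - (5 * N) <= 5 * N by lra.
have [L cL LP] := liftable_box cH N5 N5.
(* [U] and [p] lie in the square of half-width [N] about the origin. The circle of size [4 * N]
   about [p] therefore avoids [U], so that [H] is [k] on it, and it stays in the box of half-width
   [5 * N]. *)
apply: (@angle_no_lift _ L p (4 * N) _ cL); first by lra.
move=> w wN; have [] := UN p Up; rewrite !ltr_norml => /andP[p1 p2] /andP[p3 p4].
have nU : ~ U (p.1 + w.1, p.2 + w.2).
  move=> /UN /= []; rewrite !ltr_norml => /andP[a1 a2] /andP[a3 a4].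
  have : `|w.1| < 2 * N by rewrite ltr_norml; apply/andP; split; lra.
  have : `|w.2| < 2 * N by rewrite ltr_norml; apply/andP; split; lra.
  lra.
have := LP (p.1 + w.1) (p.2 + w.2); rewrite HnU // /k /angle_at /=.
rewrite [p.1 + w.1 - p.1]addrAC subrr add0r [p.2 + w.2 - p.2]addrAC subrr add0r.
rewrite -surjective_pairing; apply.
  have : `|w.1| <= 4 * N by rewrite -wN lerDl.
  by rewrite ler_norml => /andP[b1 b2]; apply/andP; split; lra.
have : `|w.2| <= 4 * N by rewrite -wN lerDr.
by rewrite ler_norml => /andP[b1 b2]; apply/andP; split; lra.
Unshelve. all: by end_near. Qed.

(** [la] stands for a lift that is prescribed off the arc. The lift along the arc is shifted to
    agree with it at [a]; the integer [k] is what then prevents gluing at [b]. *)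
Lemma lift_along_arc (g : R -> P) (a b : R) (u la : P -> R) :
  a <= b -> continuous g -> (forall t, a <= t <= b -> continuous_modZ u (g t)) ->
  la (g a) - u (g a) \is a Num.int -> la (g b) - u (g b) \is a Num.int ->
  exists (l : R -> R) (k : int), [/\ continuous l,
    forall t, a <= t <= b -> l t - u (g t) \is a Num.int,
    l a = la (g a) & l b = la (g b) + k%:~R].
Proof.
move=> ab cg cu la_a la_b.
have [|l cl lP] := @lift_path R (u \o (g \o clamp a b)) a b _ ab.
  move=> t; apply: continuous_modZ_comp; last by apply: cu; exact: clamp_itv.
  by apply: (@continuous_comp _ _ _ (clamp a b) g); [exact: clamp_continuous|exact: cg].
have aab : a <= a <= b by rewrite lexx.
have bab : a <= b <= b by rewrite lexx andbT.
have lP' t : a <= t <= b -> l t - u (g t) \is a Num.int.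
  by move=> tab; have := lP t tab; rewrite /= clamp_id.
pose n := la (g a) - l a.
have nZ : n \is a Num.int.
  have -> : n = (la (g a) - u (g a)) - (l a - u (g a)) by rewrite /n; ring.
  by rewrite rpredB // lP'.
have kZ : l b + n - la (g b) \is a Num.int.
  have -> : l b + n - la (g b) = n + (l b - u (g b)) - (la (g b) - u (g b)) by ring.
  by rewrite rpredB // rpredD // lP'.
have [k kE] := intrP kZ; exists (fun t => l t + n), k; split.
- by move=> t; apply: cvgD; [exact: cl|exact: cvg_cst].
- move=> t tab; have -> : l t + n - u (g t) = (l t - u (g t)) + n by ring.
  by rewrite rpredD // lP'.
- by rewrite /n; ring.
- by rewrite -kE; ring.
Qed.

(** The centered difference jumps only where [z - p] and [z - q] point in opposite directions, that
    is, on the segment from [p] to [q], which stays in the square by convexity. *)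
Lemma angle_diff_lift (p q : P) (e : R) (z : P) :
  `|p.1| < e -> `|p.2| < e -> `|q.1| < e -> `|q.2| < e ->
  ~ (`|z.1| < e /\ `|z.2| < e) ->
  {for z, continuous (fun z => centered_rem (angle_at p z - angle_at q z))}.
Proof.
move=> p1 p2 q1 q2 ze.
have zp : z <> p by move=> E; apply: ze; rewrite E.
have zq : z <> q by move=> E; apply: ze; rewrite E.
have sh0 (s : P) : z <> s -> (z.1 - s.1, z.2 - s.2) <> (0, 0).
  move=> zs [/eqP e1 /eqP e2].
  by apply: zs; rewrite [z]surjective_pairing [s]surjective_pairing; congr (_, _);
    apply/eqP; rewrite -subr_eq0.
apply: (@centered_rem_continuous _ _ (fun z => angle_at p z - angle_at q z)).
  apply: continuous_modZD; first exact: angle_at_continuous_modZ.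
  have := continuous_modZM (-1) (angle_at_continuous_modZ zq).
  by under eq_fun do rewrite intrN mulN1r.
apply/negP => /(angle_opposite (sh0 _ zp) (sh0 _ zq)) [k k0] /= [E1 E2].
have conv (x y w : R) : `|x| < e -> `|y| < e -> w - x = - k * (w - y) -> `|w| < e.
  rewrite !ltr_norml => /andP[x1 x2] /andP[y1 y2] E.
  have {}E : w * (1 + k) = x + k * y by move: E; lra.
  have k1 : 0 < 1 + k by lra.
  by apply/andP; split; rewrite -(ltr_pM2r k1) E; nra.
by apply: ze; split; [exact: (conv p.1 q.1)|exact: (conv p.2 q.2)].
Qed.

(* The differences of the angles at three points lift on [A'] by their small
   representatives, and on the arc up to an integer jump at its end; two such jumps
   are linearly dependent over the integers, so that some combination lifts on [K]. *)
Lemma no_three_regions_along_arc (g : R -> P) (a b e N : R) (A' : set P) (U1 U2 U3 : set P)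
    (p1 p2 p3 : P) (K := A' `|` g @` `[a, b]) :
  a <= b -> continuous g ->
  (forall s t, a <= s <= b -> a <= t <= b -> g s = g t -> s = t) ->
  compact A' -> (forall z, A' z -> ~ (`|z.1| < e /\ `|z.2| < e)) ->
  A' (g a) -> A' (g b) -> (forall t, a <= t <= b -> A' (g t) -> t = a \/ t = b) ->
  open U1 -> open U2 -> open U3 ->
  (forall z, closure U1 z -> U1 z \/ K z) ->
  (forall z, closure U2 z -> U2 z \/ K z) ->
  (forall z, closure U3 z -> U3 z \/ K z) ->
  (forall z, U1 z \/ U2 z \/ U3 z -> `|z.1| < N /\ `|z.2| < N) ->
  U1 p1 -> U2 p2 -> U3 p3 ->
  ~ U1 p2 -> ~ U1 p3 -> ~ U2 p1 -> ~ U2 p3 -> ~ U3 p1 -> ~ U3 p2 ->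
  ~ K p1 -> ~ K p2 -> ~ K p3 ->
  `|p1.1| < e /\ `|p1.2| < e -> `|p2.1| < e /\ `|p2.2| < e ->
  `|p3.1| < e /\ `|p3.2| < e -> False.
Proof.
move=> ab cg ig cA eA Aga Agb Ag o1 o2 o3 cl1 cl2 cl3 UN.
move=> U11 U22 U33 U12 U13 U21 U23 U31 U32 K1 K2 K3 [e11 e12] [e21 e22] [e31 e32].
have hP : hausdorff_space P by exact: norm_hausdorff.
pose J := g @` `[a, b].
have cJ : compact J.
  apply: continuous_compact; first exact: continuous_subspaceT.
  exact: segment_compact.
have cK : compact K by exact: compactU.
have gK t : a <= t <= b -> K (g t) by move=> tab; right; exists t; rewrite //= in_itv.
pose u2 z := angle_at p1 z - angle_at p2 z.
pose u3 z := angle_at p1 z - angle_at p3 z.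
have cu (q : P) : ~ K q -> forall t, a <= t <= b ->
    continuous_modZ (fun z => angle_at p1 z - angle_at q z) (g t).
  move=> Kq t tab; have Kt := gK t tab.
  have tp : g t <> p1 by move=> E; rewrite E in Kt.
  have tq : g t <> q by move=> E; rewrite E in Kt.
  apply: continuous_modZD; first exact: angle_at_continuous_modZ.
  have := continuous_modZM (-1) (angle_at_continuous_modZ tq).
  by under eq_fun do rewrite intrN mulN1r.
have laZ (u : P -> R) z : centered_rem (u z) - u z \is a Num.int.
  by rewrite -rpredN opprB centered_rem_int.
have [l2 [k2 [cl2' l2P l2a l2b]]] :=
  @lift_along_arc g a b u2 (fun z => centered_rem (u2 z)) ab cg (cu _ K2) (laZ u2 _) (laZ u2 _).
have [l3 [k3 [cl3' l3P l3a l3b]]] :=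
  @lift_along_arc g a b u3 (fun z => centered_rem (u3 z)) ab cg (cu _ K3) (laZ u3 _) (laZ u3 _).
have [x [y [xy0 xyk]]] : exists x y : int, (x, y) != (0, 0) /\ x * k2 + y * k3 = 0.
  have [z2|nz2] := eqVneq k2 0.
    by exists 1, 0; rewrite z2; split=> //; lia.
  by exists k3, (- k2); split; [rewrite xpair_eqE; lia|lia].
pose La z := x%:~R * centered_rem (u2 z) + y%:~R * centered_rem (u3 z).
pose l t := x%:~R * l2 t + y%:~R * l3 t.
have cl : continuous l.
  by move=> t; apply: cvgD; apply: cvgM; (exact: cvg_cst || exact: cl2' || exact: cl3').
have la_a : l a = La (g a) by rewrite /l /La l2a l3a.
have la_b : l b = La (g b).
  have : x%:~R * k2%:~R + y%:~R * k3%:~R = 0 :> R by rewrite -!intrM -intrD xyk.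
  by rewrite /l /La l2b l3b => E; lra.
have aab : a <= a <= b by rewrite lexx.
(* The inverse of the injective arc; the default [a] is reached only off the arc. *)
pose ti (z : P) : R := xget a [set t | a <= t <= b /\ g t = z].
have tig t : a <= t <= b -> ti (g t) = t.
  move=> tab; rewrite /ti; case: xgetP => [s _ [sab E]|H].
    exact: ig.
  by case: (H t).
pose th z := if `[< A' z >] then La z else l (ti z).
have thA z : A' z -> th z = La z by move=> Az; rewrite /th asboolT.
have thJ t : a <= t <= b -> th (g t) = l t.
  move=> tab; have [At|At] := pselect (A' (g t)).
    by rewrite thA //; have [->|->] := Ag t tab At.
  by rewrite /th asboolF // tig.
have cth : {within K, continuous th}.
  apply: withinU_continuous; [exact: compact_closed|exact: compact_closed| |].
    apply: (@subspace_eq_continuous _ _ _ La) => [z|].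
      by rewrite inE => Az; (apply: thA || apply/esym; exact: thA).
    apply: continuous_in_subspaceT => z; rewrite inE => /eA ze.
    apply: cvgD; (apply: cvgM; first exact: cvg_cst).
      exact: (angle_diff_lift e11 e12 e21 e22 ze).
    exact: (angle_diff_lift e11 e12 e31 e32 ze).
  apply: (within_continuous_lift hP cg cl (@segment_compact _ a b)) => t.
  by rewrite /= in_itv /=; exact: thJ.
have thZ z : K z -> th z - (x%:~R * u2 z + y%:~R * u3 z) \is a Num.int.
  have comb (s t : R) : s - u2 z \is a Num.int -> t - u3 z \is a Num.int ->
      x%:~R * s + y%:~R * t - (x%:~R * u2 z + y%:~R * u3 z) \is a Num.int.
    move=> sZ tZ.
    have -> : x%:~R * s + y%:~R * t - (x%:~R * u2 z + y%:~R * u3 z) =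
      x%:~R * (s - u2 z) + y%:~R * (t - u3 z) by ring.
    by rewrite rpredD // rpredM // intr_int.
  move=> [Az|[t]]; first by rewrite thA // /La; apply: comb; exact: laZ.
  rewrite /= in_itv /= => tab E; subst z; rewrite thJ // /l.
  by apply: comb; [exact: l2P|exact: l3P].
have thZ' z (c1 c2 c3 : int) (q1 q2 q3 : P) : K z ->
  c1%:~R * angle_at q1 z + c2%:~R * angle_at q2 z + c3%:~R * angle_at q3 z =
  x%:~R * u2 z + y%:~R * u3 z ->
  th z - (c1%:~R * angle_at q1 z + c2%:~R * angle_at q2 z + c3%:~R * angle_at q3 z)
    \is a Num.int.
  by move=> Kz ->; exact: thZ.
(* The combination is [x + y] times the angle at [p1], minus [x] times that at [p2] and [y] times
   that at [p3]. Isolating the angle at [p3] kills [y], isolating that at [p2] kills [x]. *)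
have y0 : - y = 0.
  apply: (@planar_no_lift U3 K p3 p1 p2 (- y) (x + y) (- x) N th) => //.
    by move=> z Uz; apply: UN; right; right.
  move=> z Kz; apply: thZ' => //.
  by rewrite /u2 /u3 !(intrN, intrD); ring.
have x0 : - x = 0.
  apply: (@planar_no_lift U2 K p2 p1 p3 (- x) (x + y) (- y) N th) => //.
    by move=> z Uz; apply: UN; right; left.
  move=> z Kz; apply: thZ' => //.
  by rewrite /u2 /u3 !(intrN, intrD); ring.
by move/negP: xy0; apply; rewrite xpair_eqE; lia.
Qed.

End PlanarSeparation.

(** * Topology of the plane *)

Section Plane.
Variable R : realType.
Local Notation P := (R * R)%type.

Definition segm (c z : P) (t : R) : P :=
  (c.1 + t * (z.1 - c.1), c.2 + t * (z.2 - c.2)).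

Lemma segm_continuous c z : continuous (segm c z).
Proof.
move=> t.
have cx (a b : R) : {for t, continuous (fun t : R => a + t * b)}.
  by apply: cvgD; [exact: cvg_cst|apply: cvgM; [exact: cvg_id|exact: cvg_cst]].
exact: (continuous_pair (cx _ _) (cx _ _)).
Qed.

Lemma star_shaped_connected (A : set P) (c : P) : A c ->
  (forall z t, A z -> 0 <= t <= 1 -> A (segm c z t)) -> connected A.
Proof.
move=> Ac Ast.
have -> : A = \bigcup_(z in A) (segm c z @` `[0, 1]).
  apply/seteqP; split=> z.
    move=> Az; exists z => //; exists 1; first by rewrite /= in_itv /= ler01 lexx.
    by rewrite /segm !mul1r [c.1 + _]addrC subrK [c.2 + _]addrC subrK -surjective_pairing.
  by move=> [w Aw [t]]; rewrite /= in_itv /= => t01 <-; exact: Ast.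
apply: bigcup_connected.
  exists c => z Az; exists 0; first by rewrite /= in_itv /= ler01 lexx.
  by rewrite /segm !mul0r !addr0 -surjective_pairing.
move=> z Az; apply: connected_continuous_connected.
  by apply/connected_intervalP; exact: interval_is_interval.
by apply: continuous_subspaceT; exact: segm_continuous.
Qed.

Lemma punctured_plane_connected : connected [set z : P | z <> (0, 0)].
Proof.
(* Four open half planes, each star-shaped, joined in a chain of overlaps. *)
have -> : [set z : P | z <> (0, 0)] =
    (([set z : P | 0 < z.1] `|` [set z : P | 0 < z.2]) `|` [set z : P | z.1 < 0])
      `|` [set z : P | z.2 < 0].
  apply/seteqP; split=> -[x y] /=.
    move=> xy; have [x0|x0|x0] := ltgtP x 0; first by left; right.
      by left; left; left.
    have [y0|y0|y0] := ltgtP y 0; first by right.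
      by left; left; right.
    by case: xy; rewrite x0 y0.
  by move=> [[[|]|]|] + [E1 E2]; rewrite ?E1 ?E2 ltxx.
have conv (a b t : R) : 0 < a -> 0 < b -> 0 <= t <= 1 -> 0 < b + t * (a - b) by nra.
have cR : connected [set z : P | 0 < z.1].
  apply: (@star_shaped_connected _ (1, 1)) => [|z t z0 t01] /=; first exact: ltr01.
  by apply: conv => //; exact: ltr01.
have cU : connected [set z : P | 0 < z.2].
  apply: (@star_shaped_connected _ (1, 1)) => [|z t z0 t01] /=; first exact: ltr01.
  by apply: conv => //; exact: ltr01.
have cL : connected [set z : P | z.1 < 0].
  apply: (@star_shaped_connected _ (-1, -1)) => [|z t z0 t01] /=; first lra.
  have := @conv (- z.1) 1 t; move: z0 => /= z0; nra.
have cD : connected [set z : P | z.2 < 0].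
  apply: (@star_shaped_connected _ (-1, -1)) => [|z t z0 t01] /=; first lra.
  have := @conv (- z.2) 1 t; move: z0 => /= z0; nra.
apply: connectedU => //; last (apply: connectedU => //; last apply: connectedU => //).
- by exists (-1, -1); split; [right|]; rewrite /=; lra.
- by exists (-1, 1); split; [right|]; rewrite /=; lra.
- by exists (1, 1); split; rewrite /=; lra.
Qed.

Definition mnorm (z : P) : R := Num.max `|z.1| `|z.2|.

Lemma mnormE : mnorm = (fun z : P => `|z|). Proof. by []. Qed.

Lemma mnorm_continuous : continuous mnorm.
Proof. by rewrite mnormE; exact: norm_continuous. Qed.

Lemma mnorm_lt z e : (mnorm z < e) = (`|z.1| < e) && (`|z.2| < e).
Proof. by rewrite /mnorm gt_max. Qed.

Lemma mnorm_le z e : (mnorm z <= e) = (`|z.1| <= e) && (`|z.2| <= e).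
Proof. by rewrite /mnorm ge_max. Qed.

Lemma mnorm0 : mnorm (0, 0) = 0.
Proof. by rewrite /mnorm /= normr0 maxxx. Qed.

Lemma mnorm_ge0 z : 0 <= mnorm z.
Proof. by rewrite /mnorm le_max normr_ge0. Qed.

Lemma mnorm_gt0 z : z <> (0, 0) -> 0 < mnorm z.
Proof.
move=> z0; rewrite lt_neqAle mnorm_ge0 andbT eq_sym; apply/negP => /eqP E; apply: z0.
have : mnorm z <= 0 by rewrite E.
rewrite mnorm_le !normr_le0 => /andP[/eqP e1 /eqP e2].
by rewrite [z]surjective_pairing e1 e2.
Qed.

Definition scal (k : R) (z : P) : P := (k * z.1, k * z.2).

Lemma mnorm_scal k z : 0 <= k -> mnorm (scal k z) = k * mnorm z.
Proof. by move=> k0; rewrite /mnorm /scal /= !normrM (ger0_norm k0) maxr_pMr. Qed.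

Lemma scalM k l z : scal k (scal l z) = scal (k * l) z.
Proof. by rewrite /scal /= !mulrA. Qed.

Lemma scal1 z : scal 1 z = z.
Proof. by rewrite /scal !mul1r -surjective_pairing. Qed.

Lemma scal_neq0 k z : k != 0 -> z <> (0, 0) -> scal k z <> (0, 0).
Proof.
move=> k0 z0 E; apply: z0; rewrite -[z]scal1 -(mulVf k0) -scalM E.
by rewrite /scal /= !mulr0.
Qed.

Lemma scal_continuous (k : P -> R) z : {for z, continuous k} ->
  {for z, continuous (fun z => scal (k z) z)}.
Proof.
move=> ck; apply: (@continuous_pair _ _ _ (fun z => k z * z.1) (fun z => k z * z.2));
  by apply: cvgM => //; (exact: fst_continuous || exact: snd_continuous).
Qed.

Lemma square_connected (d : R) : 0 < d -> connected [set z : P | mnorm z < d].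
Proof.
move=> d0; apply: (@star_shaped_connected _ (0, 0)) => [|z t]; rewrite /= ?mnorm0 //.
move=> zd /andP[t0 t1].
have -> : segm (0, 0) z t = scal t z by rewrite /segm /scal !add0r !subr0.
by rewrite mnorm_scal // (le_lt_trans _ zd) // ler_piMl // mnorm_ge0.
Qed.

Lemma punctured_square_connected (d : R) : 0 < d ->
  connected [set z : P | z <> (0, 0) /\ mnorm z < d].
Proof.
(* Radial rescaling turns the norm [s] into [d * s / (1 + s)] and maps the punctured plane onto the
   punctured square. *)
move=> d0; pose k z := d / (1 + mnorm z).
have k0 z : 0 < 1 + mnorm z by rewrite ltr_pwDl ?mnorm_ge0.
have -> : [set z : P | z <> (0, 0) /\ mnorm z < d] =
    (fun z => scal (k z) z) @` [set z | z <> (0, 0)].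
  apply/seteqP; split=> z.
    move=> [z0 zd]; have dz : 0 < d - mnorm z by rewrite subr_gt0.
    exists (scal (d - mnorm z)^-1 z).
      by apply: scal_neq0 => //; rewrite invr_eq0 gt_eqF.
    rewrite scalM /k mnorm_scal ?invr_ge0 ?ltW // -[RHS]scal1; congr (scal _ _).
    by field; rewrite !gt_eqF //=; lra.
  move=> [w w0 <-]; split.
    by apply: scal_neq0 => //; rewrite /k mulf_neq0 ?invr_eq0 ?gt_eqF.
  rewrite mnorm_scal; last by rewrite divr_ge0 // ltW.
  by rewrite /k mulrAC ltr_pdivrMr // ltr_pM2l // ltrDr.
apply: connected_continuous_connected; first exact: punctured_plane_connected.
apply: continuous_subspaceT => z; apply: scal_continuous.
apply: cvgM; first exact: cvg_cst.
apply: cvgV; first by rewrite gt_eqF.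
by apply: cvgD; [exact: cvg_cst|exact: mnorm_continuous].
Qed.

Lemma square_complement_connected (r : R) : 0 < r -> connected [set z : P | r < mnorm z].
Proof.
(* Radial rescaling adds [r] to the norm. *)
move=> r0; pose k z := 1 + r / mnorm z.
have -> : [set z : P | r < mnorm z] = (fun z => scal (k z) z) @` [set z | z <> (0, 0)].
  apply/seteqP; split=> z.
    move=> /= rz; have z0 : 0 < mnorm z by exact: lt_trans rz.
    have zn0 : z <> (0, 0) by move=> E; rewrite E mnorm0 ltxx in z0.
    have rz' : 0 < mnorm z - r by rewrite subr_gt0.
    exists (scal ((mnorm z - r) / mnorm z) z).
      by apply: scal_neq0 => //; rewrite mulf_neq0 ?invr_eq0 ?gt_eqF.
    rewrite scalM /k mnorm_scal; last by rewrite divr_ge0 ?ltW.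
    by rewrite -[RHS]scal1; congr (scal _ _); field; rewrite !gt_eqF.
  move=> [w /mnorm_gt0 w0 <-] /=; rewrite mnorm_scal /k; last first.
    by rewrite addr_ge0 // divr_ge0 // ltW.
  by rewrite mulrDl mul1r divfK ?gt_eqF // ltrDr.
apply: connected_continuous_connected; first exact: punctured_plane_connected.
apply: continuous_in_subspaceT => z; rewrite inE /= => /mnorm_gt0 z0.
apply: scal_continuous; apply: cvgD; first exact: cvg_cst.
apply: cvgM; first exact: cvg_cst.
by apply: cvgV; [rewrite gt_eqF|exact: mnorm_continuous].
Qed.

Lemma closed_square_compact (r : R) : compact [set z : P | mnorm z <= r].
Proof.
have -> : [set z : P | mnorm z <= r] = `[- r, r]%classic `*` `[- r, r]%classic.
  apply/seteqP; split=> z /=; rewrite mnorm_le !in_itv /= !ler_norml.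
    by move=> /andP[].
  by move=> [-> ->].
by apply: compact_setX; exact: segment_compact.
Qed.

Lemma mnorm_near (Q : set P) : nbhs ((0, 0) : P) Q ->
  exists2 d, 0 < d & forall w, mnorm w <= d -> Q w.
Proof.
move=> /near_box[d d0 dQ]; exists d => // w; rewrite mnorm_le => /andP[w1 w2].
by apply: dQ; rewrite /= subr0.
Qed.

Lemma square_open (d : R) : open [set z : P | mnorm z < d].
Proof.
apply: (@open_comp _ _ mnorm [set t | t < d]); last exact: open_lt.
by move=> z _; exact: mnorm_continuous.
Qed.

Lemma compact_mnorm_bounded (K : set P) : compact K -> exists2 r, 0 < r &
  forall z, K z -> mnorm z <= r.
Proof.
move=> /compact_bounded[M [_ MP]]; exists (Num.max 1 (M + 1)).
  by rewrite lt_max ltr01.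
by move=> z Kz; apply: MP => //; rewrite lt_max ltrDl ltr01 orbT.
Qed.

Definition norm2sq (z : P) : R := z.1 ^+ 2 + z.2 ^+ 2.

Lemma norm2sq_continuous : continuous norm2sq.
Proof.
by move=> z; apply: cvgD; apply: cvgM; (exact: fst_continuous || exact: snd_continuous).
Qed.

Lemma norm2sq_ge0 z : 0 <= norm2sq z.
Proof. by rewrite addr_ge0 // sqr_ge0. Qed.

Lemma norm2sq_scal k z : norm2sq (scal k z) = k ^+ 2 * norm2sq z.
Proof. by rewrite /norm2sq /scal /= !exprMn mulrDr. Qed.

Lemma open_disc_plane : homeomorphic (open_disc R) P.
Proof.
pose k z : R := (Num.sqrt (1 + norm2sq z))^-1.
pose l z : R := (Num.sqrt (1 - norm2sq z))^-1.
have k0 z : 0 < 1 + norm2sq z by rewrite ltr_pwDl ?norm2sq_ge0.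
have kk z : k z ^+ 2 = (1 + norm2sq z)^-1 by rewrite /k exprVn sqr_sqrtr // ltW.
have kd z : scal (k z) z \in open_disc R.
  rewrite inE /open_disc /= -/(norm2sq (scal (k z) z)) norm2sq_scal kk mulrC.
  by rewrite ltr_pdivrMr // mul1r ltrDr.
exists (fun z : open_disc R => scal (l (val z)) (val z)).
exists (fun z => exist (fun x => x \in open_disc R) _ (kd z)).
split.
- move=> z; apply: val_inj => /=; have := valP z; rewrite inE /open_disc /=.
  rewrite -/(norm2sq (val z)) => z1; rewrite scalM.
  have z0 : 0 < 1 - norm2sq (val z) by rewrite subr_gt0.
  have E : 1 + norm2sq (scal (l (val z)) (val z)) = (1 - norm2sq (val z))^-1.
    rewrite norm2sq_scal /l exprVn sqr_sqrtr ?ltW //; field; rewrite gt_eqF //.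
  rewrite /k E sqrtrV ?ltW // invrK /l mulfV ?scal1 //.
  by rewrite gt_eqF // sqrtr_gt0.
- move=> z /=; rewrite scalM.
  have E : 1 - norm2sq (scal (k z) z) = (1 + norm2sq z)^-1.
    by rewrite norm2sq_scal kk; field; rewrite gt_eqF.
  rewrite /l E sqrtrV ?ltW // invrK /k mulfV ?scal1 //.
  by rewrite gt_eqF // sqrtr_gt0.
- move=> z; have := valP z; rewrite inE /open_disc /= -/(norm2sq (val z)) => z1.
  have -> : (fun z : open_disc R => scal (l (val z)) (val z)) =
    (fun z => scal (l z) z) \o (set_val : open_disc R -> P).
    by apply/funext => w; rewrite /= set_valE.
  apply: continuous_comp; first exact: initial_continuous.
  apply: scal_continuous; rewrite set_valE; apply: cvgV.
    by rewrite gt_eqF // sqrtr_gt0 subr_gt0.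
  apply: (@continuous_comp _ _ _ (fun z => 1 - norm2sq z) Num.sqrt).
    by apply: cvgB; [exact: cvg_cst|exact: norm2sq_continuous].
  exact: sqrt_continuous.
- apply/continuousP => _ [B oB <-].
  have -> : (fun z => exist (fun x => x \in open_disc R) _ (kd z)) @^-1` (set_val @^-1` B) =
    (fun z => scal (k z) z) @^-1` B by apply/seteqP; split=> z; rewrite /preimage /= set_valE.
  apply: open_comp oB => z _; apply: scal_continuous; apply: cvgV.
    by rewrite gt_eqF // sqrtr_gt0.
  apply: (@continuous_comp _ _ _ (fun z => 1 + norm2sq z) Num.sqrt).
    by apply: cvgD; [exact: cvg_cst|exact: norm2sq_continuous].
  exact: sqrt_continuous.
Qed.

Lemma homeomorphic_trans (X Y Z : topologicalType) :
  homeomorphic X Y -> homeomorphic Y Z -> homeomorphic X Z.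
Proof.
move=> [f [g [fK gK cf cg]]] [f' [g' [f'K g'K cf' cg']]].
exists (f' \o f), (g \o g'); split; [exact: can_comp|exact: can_comp| |].
  by move=> x; apply: continuous_comp; [exact: cf|exact: cf'].
by move=> x; apply: continuous_comp; [exact: cg'|exact: cg].
Qed.

(** A homeomorphism of the plane onto [U] whose inverse is extended to all of [X] by arbitrary
    values, so that no subspace type is involved. *)
Definition is_chart (X : topologicalType) (U : set X) (g : P -> X) (psi : X -> P) :=
  [/\ continuous g, cancel g psi, range g = U,
      forall y, U y -> g (psi y) = y & forall y, U y -> {for y, continuous psi}].

Lemma homeomorphic_chart (X : topologicalType) (U : set X) (x : X) :
  open U -> U x -> homeomorphic U P -> exists g psi, is_chart U g psi /\ g (0, 0) = x.
Proof.
move=> oU Ux [f [h [fK hK cf ch]]].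
pose sx : U := exist (fun y => y \in U) x (mem_set Ux).
pose c := f sx.
(* The translation by [c] moves the point [x] to the origin of the chart. *)
pose g (z : P) : X := set_val (h (c.1 + z.1, c.2 + z.2)).
pose sh (z : P) : P := (z.1 - c.1, z.2 - c.2).
pose F (y : X) : P := f (insubd sx y).
pose psi (y : X) : P := sh (F y).
have csh : continuous sh.
  move=> z; rewrite /sh; apply: (@continuous_pair _ _ _ (fun z : P => z.1 - c.1)
    (fun z => z.2 - c.2)); apply: cvgB;
    (exact: cvg_cst || exact: fst_continuous || exact: snd_continuous).
have gP z : U (g z) by rewrite /g set_valE; apply: set_mem; exact: valP.
have FU y (Uy : U y) : F y = f (exist (fun y => y \in U) y (mem_set Uy)).
  rewrite /F; congr f; apply: val_inj; rewrite /= insubdK //; exact: mem_set.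
have gpsi y : U y -> g (psi y) = y.
  move=> Uy; rewrite /g /psi (FU y Uy) /sh /=.
  rewrite [c.1 + _]addrC subrK [c.2 + _]addrC subrK -surjective_pairing fK.
  by rewrite set_valE.
have psig : cancel g psi.
  move=> z; rewrite /psi /F /g set_valE.
  have -> : insubd sx (val (h (c.1 + z.1, c.2 + z.2))) = h (c.1 + z.1, c.2 + z.2).
    by apply: val_inj; rewrite insubdK //; exact: valP.
  by rewrite hK /sh /= [_ + z.1]addrC addrK [_ + z.2]addrC addrK -surjective_pairing.
exists g, psi; split; last first.
  by rewrite /g !addr0 -surjective_pairing /c fK set_valE.
split=> //.
- move=> z; apply: (@continuous_comp _ _ _ (fun z : P => h (c.1 + z.1, c.2 + z.2)) set_val);
    last exact: initial_continuous.
  apply: (@continuous_comp _ _ _ (fun z : P => (c.1 + z.1, c.2 + z.2)) h); last exact: ch.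
  apply: (@continuous_pair _ _ _ (fun z : P => c.1 + z.1) (fun z => c.2 + z.2)); apply: cvgD;
    (exact: cvg_cst || exact: fst_continuous || exact: snd_continuous).
- by apply/seteqP; split=> [y [z _ <-]//|y Uy]; exists (psi y) => //; exact: gpsi.
- move=> y Uy; apply: (@continuous_comp _ _ _ F sh); last exact: csh.
  move=> W /=; rewrite nbhsE => -[W' [oW' W'y] W'W].
  have [B oB BE] := (continuousP f).1 cf _ oW'.
  have : nbhs y (B `&` U).
    apply: open_nbhs_nbhs; split; first exact: openI.
    split=> //; have : (f @^-1` W') (exist (fun y => y \in U) y (mem_set Uy)).
      by rewrite /preimage /= -FU.
    by rewrite -BE /preimage /= set_valE.
  apply: filterS => w [Bw Uw]; apply: W'W; rewrite (FU w Uw).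
  have : (set_val @^-1` B) (exist (fun y => y \in U) w (mem_set Uw)).
    by rewrite /preimage /= set_valE.
  by rewrite BE.
Qed.

End Plane.

(** * Topology of surfaces *)

Section Surface.
Variables (R : realType) (S : topologicalType).
Hypothesis surfS : is_surface R S.
Local Notation P := (R * R)%type.

Lemma surface_hausdorff : hausdorff_space S. Proof. by case: surfS. Qed.

Lemma surface_connected : connected [set: S]. Proof. by case: surfS. Qed.

Lemma surface_chart (x : S) : exists (U : set S) (g : P -> S) (psi : S -> P),
  [/\ open U, U x, is_chart U g psi & g (0, 0) = x].
Proof.
have [_ _ _ /(_ x)[U [oU Ux hU]]] := surfS.
by have [g [psi [cg g0]]] := homeomorphic_chart oU Ux hU; exists U, g, psi.
Qed.

Lemma chart_open (U : set S) (g : P -> S) psi (W : set P) :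
  open U -> is_chart U g psi -> open W -> open (g @` W).
Proof.
move=> oU [_ gK gU Ug cpsi] oW.
have -> : g @` W = U `&` psi @^-1` W.
  apply/seteqP; split=> [y [z Wz <-]|y [Uy Wy]].
    by split; [rewrite -gU; exists z|rewrite /preimage /= gK].
  by exists (psi y) => //; exact: Ug.
rewrite openE => y [Uy Wy].
have Ny : nbhs y (psi @^-1` W) by apply: (cpsi y Uy); apply: open_nbhs_nbhs.
by apply: filterI => //; apply: open_nbhs_nbhs.
Qed.

Lemma chart_image_connected (U : set S) (g : P -> S) psi (W : set P) :
  is_chart U g psi -> connected W -> connected (g @` W).
Proof.
move=> [cg _ _ _ _] cW; apply: connected_continuous_connected => //.
exact: continuous_subspaceT.
Qed.

Lemma chart_image_compact (U : set S) (g : P -> S) psi (W : set P) :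
  is_chart U g psi -> compact W -> compact (g @` W).
Proof.
move=> [cg _ _ _ _] cW; apply: continuous_compact => //.
exact: continuous_subspaceT.
Qed.

Lemma chart_near (U : set S) (g : P -> S) psi (x : S) (N : set S) :
  is_chart U g psi -> g (0, 0) = x -> nbhs x N ->
  exists2 d, 0 < d & forall w, mnorm w <= d -> N (g w).
Proof.
move=> [cg _ _ _ _] g0 Nx; have /mnorm_near[d d0 dN] : nbhs ((0, 0) : P) (g @^-1` N).
  by apply: cg; rewrite /= g0.
by exists d.
Qed.

(** Small punctured neighbourhoods that are connected and non-empty are what allows a discrete set
    to be removed from a surface without disconnecting it. *)
Lemma surface_punctured (x : S) (N : set S) : nbhs x N -> exists B : set S,
  [/\ open B, B x, B `<=` N, connected B & connected (B `\ x) /\ B `\ x !=set0].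
Proof.
move=> Nx; have [U [g [psi [oU Ux cg g0]]]] := surface_chart x.
have [d d0 dN] := chart_near cg g0 Nx.
have gI : injective g by have [_ gK _ _ _] := cg; exact: can_inj gK.
exists (g @` [set z | mnorm z < d]); split.
- by apply: (chart_open oU cg); exact: square_open.
- by exists (0, 0) => //=; rewrite mnorm0.
- by move=> y [z zd <-]; apply: dN; exact: ltW.
- by apply: (chart_image_connected cg); exact: square_connected.
have -> : (g @` [set z | mnorm z < d]) `\ x = g @` [set z | z <> (0, 0) /\ mnorm z < d].
  apply/seteqP; split=> y.
    move=> [[z zd <-] yx]; exists z => //; split=> // z0.
    by apply: yx; rewrite z0.
  move=> [z [z0 zd] <-]; split; first by exists z.
  by move=> /= E; apply: z0; apply: gI; rewrite g0.
split; first by apply: (chart_image_connected cg); exact: punctured_square_connected.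
exists (g (d / 2, 0)), (d / 2, 0) => //; split.
  by move=> [/eqP]; rewrite gt_eqF // divr_gt0.
rewrite mnorm_lt /= normr0 d0 andbT ger0_norm; lra.
Qed.

Lemma surface_locally_connected (x : S) (N : set S) : nbhs x N -> exists B : set S,
  [/\ open B, B x, B `<=` N & connected B].
Proof. by move=> /surface_punctured[B [oB Bx BN cB _]]; exists B. Qed.

Lemma surface_compact_nbhs (C : set S) : compact C -> exists2 N, compact N & C `<=` interior N.
Proof.
move=> cC.
apply: (@compact_induction S (fun A => exists2 N, compact N & A `<=` interior N)) cC _.
- by exists set0; [exact: compact0|].
- move=> A B [N cN AN] [N' cN' BN']; exists (N `|` N'); first exact: compactU.
  apply: subset_trans (@interiorU _ _ _).
  by move=> x [/AN|/BN']; [left|right].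
- by move=> A B AB [N cN BN]; exists N => //; exact: subset_trans BN.
- move=> x _; have [U [g [psi [oU Ux cg g0]]]] := surface_chart x.
  have oW := chart_open oU cg (@square_open R 1).
  exists (g @` [set z | mnorm z < 1]).
    by apply: open_nbhs_nbhs; split=> //; exists (0, 0) => //=; rewrite mnorm0.
  exists (g @` [set z | mnorm z <= 1]).
    by apply: (chart_image_compact cg); exact: closed_square_compact.
  rewrite -open_subsetE // => y [z z1 <-]; exists z => //; exact: ltW.
Qed.

(* A one-ended open set whose frontier has a compact neighbourhood [N] either stays
   in [N] near its end, or would stay away from its frontier. *)
Lemma disc_closure_compact (F : set S) :
  open F -> homeomorphic F (open_disc R) -> compact (frontier F) -> frontier F !=set0 ->
  compact (closure F).
Proof.
move=> oF hF cfr [x frx].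
have hP : homeomorphic F P := homeomorphic_trans hF (open_disc_plane R).
have intF : interior F = F by apply/interior_id.
have [y0 Fy0] : F !=set0.
  apply: contrapT => /set0P/negP; rewrite negbK => /eqP F0.
  by move: frx; rewrite /frontier F0 closure0 => -[].
have [g [psi [cg _]]] := homeomorphic_chart oF Fy0 hP.
have [cgc gK gF Fg cpsi] := cg.
have [N cN CN] := surface_compact_nbhs cfr.
have clN : closed N := compact_closed surface_hausdorff cN.
(* [B] is the rim of [N] inside the closure of [F]. It is off the frontier, hence in [F], and by
   compactness within radius [r] of the chart; beyond this radius the connected [E] cannot cross
   it. *)
pose B := N `&` (closure F `\` interior N).
have cB : compact B.
  apply: compact_closedI => //; apply: closedI; first exact: closed_closure.
  exact/open_closedC/open_interior.
have BF : B `<=` F.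
  move=> y [_ [cy ny]]; rewrite -intF; apply: contrapT => iy.
  by apply: ny; apply: CN.
have [r r0 rB] : exists2 r, 0 < r & forall z, (psi @` B) z -> mnorm z <= r.
  apply: compact_mnorm_bounded; apply: continuous_compact cB.
  apply: continuous_in_subspaceT => y; rewrite inE => /BF; exact: cpsi.
pose Q := g @` [set z | mnorm z <= r].
have cQ : compact Q by apply: (chart_image_compact cg); exact: closed_square_compact.
have clQ : closed Q := compact_closed surface_hausdorff cQ.
pose E := g @` [set z | r < mnorm z].
have cE : connected E.
  by apply: (chart_image_connected cg); exact: square_complement_connected.
have FQE y : F y -> Q y \/ E y.
  move=> Fy; have [yr|yr] := leP (mnorm (psi y)) r; [left|right].
    by exists (psi y) => //; exact: Fg.
  by exists (psi y) => //; exact: Fg.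
have EF : E `<=` F by move=> y [z _ <-]; rewrite -gF; exists z.
have EB y : E y -> ~ B y.
  move=> [z rz <-] Bz; have : mnorm z <= r by apply: rB; exists (g z).
  by rewrite leNgt rz.
have [||||EN|EN] := @connected_subset_openU S E (interior N) (~` N) cE.
- exact: open_interior.
- exact: closed_openC.
- move=> y Ey; have [Ny|] := pselect (N y); last by right.
  left; apply: contrapT => iy; apply: (EB y Ey); split=> //; split=> //.
  by apply: subset_closure; exact: EF.
- by rewrite -subset0 => y [[_ /interior_subset]].
- apply: (subclosed_compact (@closed_closure _ F) (compactU cQ cN)).
  rewrite [X in _ `<=` X](closure_id _).1; last exact: closedU.
  by apply: closureS => y /FQE[|/EN/interior_subset]; [left|right].
(* If [E] avoids [N], then near the frontier point [x] only [Q] is left of [F]; but [Q] is closed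
   and does not contain [x]. *)
exfalso; have [cx ix] := frx.
have Qx : ~ Q x.
  by move=> [z _ zx]; apply: ix; rewrite intF -gF; exists z.
have Nx : nbhs x (interior N `&` ~` Q).
  apply: open_nbhs_nbhs; split; first by apply: openI; [exact: open_interior|exact: closed_openC].
  by split=> //; apply: CN.
have [y [Fy [Ny Qy]]] := cx _ Nx.
have [//|Ey] := FQE y Fy.
by apply: (EN y Ey); exact: interior_subset.
Qed.

(** A connected punctured neighbourhood of a point of [D] lies on one side. Adding each such point
    to its side would turn a separation of the complement of [D] into one of the surface. *)
Lemma surface_discrete_complement (D A B : set S) :
  (forall v, D v -> exists2 N, nbhs v N & N `&` D = [set v]) ->
  open A -> open B -> (forall x, ~ D x -> A x \/ B x) ->
  A `&` B = set0 -> A `&` D = set0 -> B `&` D = set0 -> A !=set0 -> B = set0.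
Proof.
move=> dD oA oB AB dAB dAD dBD A0.
pose ext (C : set S) := C `|` [set v | D v /\ exists O, [/\ open O, O v & O `\ v `<=` C]].
have oext C : open C -> open (ext C).
  move=> oC; rewrite openE => x [Cx|[vD [ O [oO Ox OC]]]].
    have : nbhs x C by apply: open_nbhs_nbhs.
    by apply: filterS => y; left.
  have : nbhs x O by apply: open_nbhs_nbhs.
  apply: filterS => y Oy; have [->|yx] := pselect (y = x).
    by right; split=> //; exists O.
  by left; apply: OC.
have notD C x : C `&` D = set0 -> C x -> ~ D x.
  by move=> CD Cx Dx; have : (C `&` D) x by []; rewrite CD.
have cover x : ext A x \/ ext B x.
  have [Dx|Dx] := pselect (D x); last by case: (AB x Dx); [left; left|right; left].
  have [N Nx ND] := dD x Dx.
  have [ O [oO Ox ON _ [cO _]]] := surface_punctured Nx.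
  have [||OA|OB] := connected_subset_openU cO oA oB.
  - move=> y [Oy yx]; apply: AB => Dy; apply: yx.
    by have : (N `&` D) y by [split=> //; exact: ON]; rewrite ND.
  - rewrite -subset0 => y [[_ Ay] By].
    by have : (A `&` B) y by []; rewrite dAB.
  - by left; right; split=> //; exists O.
  - by right; right; split=> //; exists O.
have dis : ext A `&` ext B = set0.
  rewrite -subset0 => x [[Ax|[vD [ O [oO Ox OA]]]] [Bx|[vD' [ O' [oO' Ox' OB]]]]].
  - by have : (A `&` B) x by []; rewrite dAB.
  - exact: (notD _ _ dAD Ax).
  - exact: (notD _ _ dBD Bx).
  - have Nx : nbhs x (O `&` O') by apply: filterI; apply: open_nbhs_nbhs.
    have [W [_ _ WO _ [_ [y [Wy yx]]]]] := surface_punctured Nx.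
    have [Oy O'y] := WO y Wy.
    by have : (A `&` B) y by [split; [apply: OA|apply: OB]]; rewrite dAB.
have [||AT|BT] := connected_subset_openU surface_connected (oext _ oA) (oext _ oB).
- by move=> x _; exact: cover.
- by rewrite setTI dis.
- rewrite -subset0 => x Bx; have Ax := AT x I.
  by have : (ext A `&` ext B) x by [split=> //; left]; rewrite dis.
- have [x Ax] := A0; have Bx := BT x I.
  by have : (ext A `&` ext B) x by [split=> //; left]; rewrite dis.
Qed.

End Surface.

(** * Faces of a map *)

Section MapTopology.
Variables (R : realType) (S : topologicalType) (V : choiceType) (G : simple_graph V).
Variable M : graph_map R S G.
Hypothesis surfS : is_surface R S.
Variables p q : nat.
Hypothesis schl : schlafli_type M p q.

Local Notation Y := (realization R G).
Local Notation vx := (vertex_point R G).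
Local Notation face := (face_of M).

(** Incidence of a face with an edge is expressed throughout by the midpoint of the edge lying in
    the closure of the face. *)
Definition edge_mid u v (uv : adj G u v) : Y := edge_path uv 2^-1.

Lemma half_itv : 0 < (2^-1 : R) < 1. Proof. by apply/andP; split; lra. Qed.

Lemma map_inj : injective M. Proof. by have [] := map_embedding M. Qed.

Lemma map_continuous : continuous M.
Proof.
apply/continuousP => A oA; have [_ E] := map_embedding M.
by apply/E; exists A.
Qed.

Lemma segment_edge_pathP (e : set V) u v (uv : adj G u v) (t : R) : 0 < t < 1 ->
  segment e (edge_path uv t) <-> e u /\ e v.
Proof.
move=> /andP[t0 t1]; split=> [H|[eu ev] w ew].
  split; apply: contrapT => /H E.
    have : star u (edge_path uv t) by apply: star_edge_path; rewrite t1 ltW.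
    by rewrite /star /= /coord E ltxx.
  have : star v (edge_path uv t) by apply: star_edge_path_r; rewrite t0 ltW.
  by rewrite /star /= /coord E ltxx.
rewrite -[LHS]/(coord w (edge_path uv t)) coord_edge_path ?ltW //.
have /eqP/negbTE -> : w <> u by move=> E; apply: ew; rewrite E.
have /eqP/negbTE -> : w <> v by move=> E; apply: ew; rewrite E.
by rewrite !mulr0 addr0.
Qed.

Lemma segment_star (e : set V) v (y : Y) : segment e y -> star v y -> e v.
Proof.
move=> ey; rewrite /star /= => vy; apply: contrapT => /ey E.
by move: vy; rewrite /coord E ltxx.
Qed.

Lemma segment_vertexP (e : set V) v : segment e (vx v) <-> e v.
Proof.
split=> [H|ev w ew]; first exact: segment_star H (star_vertex _ _ _).
rewrite -[LHS]/(coord w (vx v)) coord_vertex.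
by have /eqP/negbTE -> : w <> v by move=> E; apply: ew; rewrite E.
Qed.

Lemma faceE F x : face F -> F x -> F = connected_component (~` range M) x.
Proof. by move=> [y _ <-] yx; exact: same_connected_component. Qed.

Lemma face_connected F : face F -> connected F.
Proof. by move=> [x _ <-]; exact: component_connected. Qed.

Lemma face_range F : face F -> F `<=` ~` range M.
Proof. by move=> [x _ <-]; exact: connected_component_sub. Qed.

Lemma face_neq0 F : face F -> F !=set0.
Proof. by move=> [x rx <-]; exists x; exact: connected_component_refl. Qed.

Lemma face_eq F F' x : face F -> face F' -> F x -> F' x -> F = F'.
Proof. by move=> fF fF' Fx F'x; rewrite (faceE fF Fx) (faceE fF' F'x). Qed.

Lemma face_cover x : ~ range M x -> exists2 F, face F & F x.
Proof.
move=> rx; exists (connected_component (~` range M) x); first by exists x.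
exact: connected_component_refl.
Qed.

Lemma face_cycle_frontier F : face F -> exists c : seq V,
  [/\ (2 < size c)%N, uniq c, cycle (adj G) c &
      frontier F = \bigcup_(v in [set` c]) M @` segment [set v; next c v]].
Proof.
move=> fF; have [_ /(_ F fF)[c [sc p2 uc frF]]] := schl.
by exists c; split=> //; [rewrite sc|exact: ucycle_uniq uc|exact: ucycle_cycle uc].
Qed.

Lemma face_frontier F : face F -> frontier F `<=` range M.
Proof.
by move=> /face_cycle_frontier[c [_ _ _ ->]] x [v _ [y _ <-]]; exists y.
Qed.

Lemma face_open F : face F -> open F.
Proof.
move=> fF; rewrite openE => x Fx; apply: contrapT => ix.
apply: (face_range fF Fx); apply: (face_frontier fF); split=> //.
exact: subset_closure.
Qed.

Lemma face_frontierE F y : face F -> closure F (M y) <-> frontier F (M y).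
Proof.
move=> fF; split=> [cy|[//]]; split=> // /interior_subset Fy.
by apply: (face_range fF Fy); exists y.
Qed.

Lemma face_closure F x : face F -> closure F x -> F x \/ frontier F x.
Proof.
move=> fF cx; have [Fx|Fx] := pselect (F x); [by left|right].
by split=> // /interior_subset.
Qed.

Lemma face_closure_eq F F' x : face F -> face F' -> closure F x -> F' x -> F = F'.
Proof.
move=> fF fF' cx F'x.
have [y [Fy F'y]] := cx F' (open_nbhs_nbhs (conj (face_open fF') F'x)).
exact: face_eq Fy F'y.
Qed.

Lemma face_cycle F : face F -> exists c : seq V,
  [/\ (2 < size c)%N, uniq c, cycle (adj G) c & forall y : Y,
      closure F (M y) <-> exists2 v, v \in c & segment [set v; next c v] y].
Proof.
move=> fF; have [c [sc uc cc frF]] := face_cycle_frontier fF.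
exists c; split=> // y; rewrite (face_frontierE _ fF) frF; split.
  by move=> [v vc [z zv /map_inj E]]; exists v; rewrite -?E.
by move=> [v vc vy]; exists v => //; exists y.
Qed.

(** The closure of a face meets the graph in whole closed edges, and one that contains a point of
    the star of [v] has [v] as an end. *)
Lemma face_closure_star F v y : face F -> star v y ->
  closure F (M y) -> closure F (M (vx v)).
Proof.
move=> /face_cycle[c [_ _ _ cE]] vy; rewrite !cE => -[w wc wy].
by exists w => //; apply/segment_vertexP; exact: segment_star wy vy.
Qed.

Lemma face_closure_mid F u v (uv : adj G u v) y : face F -> star u y -> star v y ->
  closure F (M y) -> closure F (M (edge_mid uv)).
Proof.
move=> /face_cycle[c [_ _ _ cE]] uy vy; rewrite !cE => -[w wc wy].
exists w => //; apply/(segment_edge_pathP _ uv half_itv).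
by split; [exact: segment_star wy uy|exact: segment_star wy vy].
Qed.

Lemma face_closure_edge F u v (uv : adj G u v) (t : R) : face F -> 0 < t < 1 ->
  closure F (M (edge_mid uv)) -> closure F (M (edge_path uv t)).
Proof.
move=> /face_cycle[c [_ _ _ cE]] t01; rewrite !cE => -[w wc].
by move=> /(segment_edge_pathP _ uv half_itv) H; exists w => //; apply/segment_edge_pathP.
Qed.

Lemma edge_point_stars u v (uv : adj G u v) (t : R) : 0 < t < 1 ->
  star u (edge_path uv t) /\ star v (edge_path uv t).
Proof.
move=> /andP[t0 t1]; split.
  by apply: star_edge_path; rewrite t1 ltW.
by apply: star_edge_path_r; rewrite t0 ltW.
Qed.

Lemma stars_edge_point u v (uv : adj G u v) (y : Y) : star u y -> star v y ->
  exists2 t, 0 < t < 1 & y = edge_path uv t.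
Proof.
move=> uy vy; have [E|[w [uw [t [t01 E]]]]] := starP uy.
  move: vy; rewrite E /star /= coord_vertex; case: eqVneq => [E'|]; last by rewrite ltxx.
  by move=> _; have /eqP[] := adj_neq uv.
have /andP[t0 t1] := t01; move: vy; rewrite E /star /= coord_edge_path ?t0 ?ltW //.
rewrite eq_sym (negbTE (adj_neq uv)) mulr0 add0r.
case: eqVneq => [E' |]; last by rewrite mulr0 ltxx.
subst w; rewrite mulr1 => t0'; exists t; first by rewrite t0' t1.
by congr (edge_path _ _); exact: bool_irrelevance.
Qed.

Lemma not_vertex_edge (y : Y) : (forall v, y <> vx v) ->
  exists u v (uv : adj G u v) t, 0 < t < 1 /\ y = edge_path uv t.
Proof.
move=> ny; have [[u E]|[u [v [uv [t [/andP[]]]]]]] := realizationP y; first by case: (ny u).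
rewrite le_eqVlt => /orP[/eqP <- _|t0].
  by rewrite edge_path0 => E; case: (ny u).
rewrite le_eqVlt => /orP[/eqP ->|t1]; first by rewrite edge_path1 => E; case: (ny v).
by move=> E; exists u, v, uv, t; rewrite t0 t1.
Qed.

(** [W] is the trace of an open set of the surface, in which a connected [B] is chosen. A face that
    meets [B] does not contain [M y], so its frontier, which lies on the graph, crosses [B], and
    hence [W]. *)
Lemma map_nbhs (W : set Y) (y : Y) : open W -> W y -> exists B : set S,
  [/\ open B, B (M y), connected B, forall z, B (M z) -> W z &
      forall F, face F -> B `&` F !=set0 -> exists2 z, W z & closure F (M z)].
Proof.
move=> oW Wy; have [_ ME] := map_embedding M.
have [B0 oB0 WE] := (ME W).1 oW.
have WB z : W z <-> B0 (M z) by rewrite WE.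
have [B [oB By BB0 cB]] := surface_locally_connected surfS
  (open_nbhs_nbhs (conj oB0 ((WB y).1 Wy))).
exists B; split=> // [z /BB0/WB//|F fF BF].
have [|x [Bx frx]] := connected_meets_frontier cB BF.
  by move=> /(_ _ By) Fy; apply: (face_range fF Fy); exists y.
have [z _ zx] := face_frontier fF frx; exists z; first by apply/WB/BB0; rewrite zx.
by rewrite zx; case: frx.
Qed.

Lemma face_closure_compact F : face F -> compact (closure F).
Proof.
move=> fF; have [c [sc uc cc frF]] := face_cycle_frontier fF.
apply: (disc_closure_compact surfS).
- exact: face_open.
- exact: (map_disc fF).
- rewrite frF; apply: finite_bigcup_compact_in; first exact: finite_seq.
  move=> v vc; have vn : adj G v (next c v) by exact: next_cycle.
  rewrite (segment_edge_path R vn); apply: continuous_compact.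
    by apply: continuous_subspaceT; exact: map_continuous.
  exact: edge_path_image_compact.
- case: c sc {uc cc} frF => // v s _ frF; exists (M (vx v)).
  rewrite frF; exists v; first by rewrite /= mem_head.
  by exists (vx v) => //; apply/segment_vertexP; left.
Qed.

Lemma edge_path_inj u v (uv : adj G u v) (s t : R) : 0 <= s <= 1 -> 0 <= t <= 1 ->
  edge_path uv s = edge_path uv t -> s = t.
Proof.
move=> s01 t01 E; have := congr1 (coord v) E; rewrite !coord_edge_path // eqxx eq_sym.
by rewrite (negbTE (adj_neq uv)) !mulr0 !mulr1 !add0r.
Qed.

(** A chart at the midpoint reduces this to [no_three_regions_along_arc]: the arc is a middle piece
    of the edge, the regions are the traces of the three faces on a small square. *)
Lemma two_faces_per_edge u v (uv : adj G u v) F1 F2 F3 :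
  face F1 -> face F2 -> face F3 ->
  closure F1 (M (edge_mid uv)) -> closure F2 (M (edge_mid uv)) ->
  closure F3 (M (edge_mid uv)) -> F1 <> F2 -> F1 <> F3 -> F2 <> F3 -> False.
Proof.
move=> f1 f2 f3 c1 c2 c3 n12 n13 n23.
set x := M (edge_mid uv) in c1 c2 c3.
pose g0 t := M (edge_path uv t).
have cg0 : continuous g0.
  move=> t; apply: (@continuous_comp _ _ _ (edge_path uv) M).
    exact: edge_path_continuous.
  exact: map_continuous.
have [U [g [psi [oU Ux cg gx]]]] := surface_chart surfS x.
have [cgc gK gU Ug cpsi] := cg.
pose W := star u `&` star v : set Y.
have oW : open W by apply: openI; exact: star_open.
have Wx : W (edge_mid uv) by exact: edge_point_stars half_itv.
have [B [oB Bx _ BW _]] := map_nbhs oW Wx.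
have [d d0 dB] := chart_near cg gx (open_nbhs_nbhs (conj oB Bx)).
have edge z : mnorm z <= d -> range M (g z) -> exists2 t, 0 < t < 1 & g z = g0 t.
  move=> zd [y _ yz]; have [uy vy] : W y by apply: BW; rewrite yz; exact: dB.
  by have [t t01 E] := stars_edge_point uv uy vy; exists t; rewrite // -yz E.
(* The points with parameter within [eta] of the midpoint stay in the open square; [e / 2] comes
   from continuity, and [4^-1] keeps them off the ends of the edge. *)
have [eta [eta0 eta1 etaP]] : exists eta, [/\ 0 < eta, eta < 2^-1 &
    forall t, 2^-1 - eta <= t <= 2^-1 + eta ->
      exists z : R * R, mnorm z < d /\ g z = g0 t].
  have : nbhs (2^-1 : R) (g0 @^-1` (g @` [set z | mnorm z < d])).
    apply: cg0; apply: open_nbhs_nbhs; split.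
      by apply: (chart_open oU cg); exact: square_open.
    by exists (0, 0); rewrite /= ?mnorm0.
  move=> /nbhs_ballP[e /= e0 eP]; exists (Num.min (e / 2) 4^-1).
  have m1 : Num.min (e / 2) 4^-1 <= e / 2 by rewrite ge_min lexx.
  have m2 : Num.min (e / 2) 4^-1 <= 4^-1 by rewrite ge_min lexx orbT.
  split; [by rewrite lt_min; apply/andP; split; lra|lra|].
  move=> t /andP[t1 t2].
  have [|z zd zt] := eP t; last by exists z.
  by rewrite /ball /= ltr_norml; apply/andP; split; lra.
pose a : R := 2^-1 - eta; pose b : R := 2^-1 + eta.
have ab : a <= b by rewrite /a /b; lra.
pose gam t := psi (g0 (clamp a b t)).
have clab t : a <= clamp a b t <= b by exact: clamp_itv.
have gamP t : a <= t <= b -> mnorm (gam t) < d /\ g (gam t) = g0 t.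
  move=> tab; rewrite /gam clamp_id //; have [z [zd zE]] := etaP t tab.
  by rewrite -zE gK.
have cgam : continuous gam.
  move=> t; apply: (@continuous_comp _ _ _ (g0 \o clamp a b) psi).
    by apply: (@continuous_comp _ _ _ (clamp a b) g0); [exact: clamp_continuous|exact: cg0].
  by apply: cpsi; have [z [_ zE]] := etaP _ (clab t); rewrite /= -zE -gU; exists z.
have in01 t : a <= t <= b -> 0 <= t <= 1.
  by rewrite /a /b => /andP[t1 t2]; apply/andP; split; lra.
have g0I s t : 0 <= s <= 1 -> 0 <= t <= 1 -> g0 s = g0 t -> s = t.
  by move=> s01 t01 /map_inj; exact: edge_path_inj.
pose T := g0 @` `[0, a] `|` g0 @` `[b, 1].
have clT : closed T.
  apply: closedU; (apply: (compact_closed (surface_hausdorff surfS)));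
    (apply: continuous_compact; [exact: continuous_subspaceT|exact: segment_compact]).
have TP s : 0 <= s <= 1 -> ~ (a < s < b) -> T (g0 s).
  move=> /andP[s0 s1] sab; have [sa|sa] := leP s a.
    by left; exists s; rewrite //= in_itv /= s0.
  right; exists s; rewrite //= in_itv /= s1 andbT leNgt; apply/negP => sb.
  by apply: sab; rewrite sa.
have PT s : 0 <= s <= 1 -> T (g0 s) -> s <= a \/ b <= s.
  move=> s01 [[t]|[t]]; rewrite /= in_itv /= => /andP[t1 t2] /g0I E; [left|right].
    by rewrite -E //; apply/andP; split; [|move: t2; rewrite /a]; lra.
  by rewrite -E //; apply/andP; split; [move: t1; rewrite /b|]; lra.
(* Apart from the middle piece, the frontiers of the traces can only lie on the boundary of the
   square and on the rest of the edge, since no other edge enters the square. *)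
pose A' := [set z : R * R | mnorm z <= d] `&` ([set z | mnorm z = d] `|` g @^-1` T).
have cA' : compact A'.
  apply: compact_closedI; first exact: closed_square_compact.
  apply: closedU; last exact: preimage_closed.
  have -> : [set z : R * R | mnorm z = d] = @mnorm R @^-1` [set d] by [].
  by apply: preimage_closed; [move=> z _; exact: mnorm_continuous|exact: closed_eq].
have clA' : closed A' := compact_closed (@norm_hausdorff _ _) cA'.
have A'0 : ~ A' (0, 0).
  move=> [_ [E|T0]]; first by move: E; rewrite /= mnorm0; lra.
  have xE : g0 2^-1 = g (0, 0) by rewrite gx.
  have h01 : 0 <= (2^-1 : R) <= 1 by apply/andP; split; lra.
  move: T0; rewrite /preimage /= -xE => /(PT _ h01)[]; rewrite /a /b; lra.
(* The midpoint is off [A'], hence so is a small square about it, in which the three points will be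
   chosen. *)
have [e e0 eA'] : exists2 e, 0 < e & forall w, mnorm w <= e -> ~ A' w.
  apply: mnorm_near; apply: open_nbhs_nbhs; split=> //.
  exact: closed_openC.
have face_near F : face F -> closure F x ->
    exists2 z, mnorm z < Num.min d e & F (g z).
  move=> fF cx; have [|y [Fy [z ze zy]]] := cx (g @` [set z | mnorm z < Num.min d e]).
    apply: open_nbhs_nbhs; split; first by apply: (chart_open oU cg); exact: square_open.
    by exists (0, 0); rewrite //= mnorm0 lt_min d0.
  by exists z; rewrite // zy.
(* A face may cross the square in many pieces; all are kept, as a region need not be connected. *)
pose Ui (F : set S) := [set z : R * R | mnorm z < d] `&` g @^-1` F.
have oUi F : face F -> open (Ui F).
  move=> fF; apply: openI; first exact: square_open.
  by apply: open_comp; [move=> z _; exact: cgc|exact: face_open].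
pose K := A' `|` gam @` `[a, b].
have clUi F : face F -> forall z, closure (Ui F) z -> Ui F z \/ K z.
  move=> fF z cz.
  have zd : mnorm z <= d.
    have clQ : closed [set z : R * R | mnorm z <= d].
      by apply: compact_closed; [exact: norm_hausdorff|exact: closed_square_compact].
    by apply: clQ; apply: closureS cz => w [/ltW].
  have cgz : closure F (g z).
    move=> N /cgc Nz; have [w [[_ Fw] Nw]] := cz _ Nz.
    by exists (g w).
  move: (zd); rewrite le_eqVlt => /orP[/eqP E|zd'].
    by right; left; split=> //; left.
  have [Fz|/(face_frontier fF)/(edge z zd)[t t01 E]] := face_closure fF cgz.
    by left.
  have t01' : 0 <= t <= 1 by case/andP: t01 => *; rewrite !ltW.
  right; have [tab|tab] := pselect (a < t < b).
    right; exists t; first by rewrite /= in_itv /=; case/andP: tab => *; rewrite !ltW.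
    rewrite /gam clamp_id -?E ?gK //; by case/andP: tab => *; rewrite !ltW.
  by left; split=> //; right; rewrite /preimage /= E; exact: TP.
have nK F z : face F -> mnorm z < Num.min d e -> F (g z) -> ~ K z.
  rewrite lt_min => fF /andP[zd ze] Fz [Az|[t]].
    by apply: (eA' z) => //; exact: ltW.
  rewrite /= in_itv /= => tab E; apply: (face_range fF Fz); rewrite -E (gamP t tab).2.
  by exists (edge_path uv t).
have [z1 z1d z1F] := face_near _ f1 c1.
have [z2 z2d z2F] := face_near _ f2 c2.
have [z3 z3d z3F] := face_near _ f3 c3.
have mind z : mnorm z < Num.min d e -> mnorm z < d by rewrite lt_min => /andP[].
have mine z : mnorm z < Num.min d e -> `|z.1| < e /\ `|z.2| < e.
  by rewrite lt_min => /andP[_]; rewrite mnorm_lt => /andP[].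
have sep F F' z : face F -> face F' -> F <> F' -> F' (g z) -> ~ Ui F z.
  by move=> fF fF' ne F'z [_ Fz]; apply: ne; exact: face_eq Fz F'z.
apply: (@no_three_regions_along_arc R gam a b e d A' (Ui F1) (Ui F2) (Ui F3) z1 z2 z3) => //;
  try exact: oUi; try exact: clUi; try (exact: nK z1F || exact: nK z2F || exact: nK z3F);
  try exact: mine.
- move=> s t sab tab E; apply: g0I; [exact: in01|exact: in01|].
  by rewrite -(gamP s sab).2 -(gamP t tab).2 E.
- move=> z Az [za zb]; apply: (eA' z) => //.
  by rewrite ltW // mnorm_lt za zb.
- have aab : a <= a <= b by rewrite lexx.
  have [ga1 ga2] := gamP a aab; split; first exact: ltW.
  right; rewrite /preimage /= ga2; apply: TP; first exact: in01.
  by rewrite ltxx.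
- have bab : a <= b <= b by rewrite lexx andbT.
  have [gb1 gb2] := gamP b bab; split; first exact: ltW.
  right; rewrite /preimage /= gb2; apply: TP; first exact: in01.
  by rewrite ltxx andbF.
- move=> t tab [_ [E|]].
    by have [] := gamP t tab; rewrite E ltxx.
  have [_ E] := gamP t tab; rewrite /preimage /= E => /(PT t (in01 t tab)).
  case/andP: tab => t1 t2 [ta|tb]; [left|right]; apply/eqP; rewrite eq_le.
    by rewrite ta t1.
  by rewrite tb t2.
- by move=> z; rewrite /Ui => -[|[|]] [/= + _]; rewrite mnorm_lt => /andP[].
- by split=> //; exact: mind.
- by split=> //; exact: mind.
- by split=> //; exact: mind.
- exact: (sep F1 F2).
- exact: (sep F1 F3).
- by apply: (sep F2 F1) => //; exact: nesym.
- exact: (sep F2 F3).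
- by apply: (sep F3 F1) => //; exact: nesym.
- by apply: (sep F3 F2) => //; exact: nesym.
Qed.

End MapTopology.

(** * Stars and preautomorphisms *)

Section MapFaces.
Variables (R : realType) (S : topologicalType) (V : choiceType) (G : simple_graph V).
Variable M : graph_map R S G.
Hypothesis surfS : is_surface R S.
Variables p q : nat.
Hypothesis schl : schlafli_type M p q.

Local Notation Y := (realization R G).
Local Notation vx := (vertex_point R G).
Local Notation face := (face_of M).
Local Notation mid := (edge_mid R).

Let vertices : set S := [set M (vx v) | v in setT].

Lemma star_vertexP u v : star u (vx v) -> u = v.
Proof. by rewrite /star /= coord_vertex; case: eqVneq => // _; rewrite ltxx. Qed.

Lemma vertices_isolated x : vertices x -> exists2 N, nbhs x N & N `&` vertices = [set x].
Proof.
move=> [v _ <-]; have [B [oB Bv _ BW _]] :=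
  map_nbhs surfS schl (@star_open R V G v) (star_vertex R G v).
exists B; first exact: open_nbhs_nbhs.
apply/seteqP; split=> [y [By [w _ wy]]|y ->]; last by split=> //; exists v.
by rewrite -wy in By *; rewrite (star_vertexP (BW _ By)).
Qed.

(** The connectedness of the surface minus its vertices in combinatorial form. Off the vertices, the
    points in the closure of a face with [Q] form an open set, and so do the others. *)
Lemma face_propagation (Q : set S -> Prop) :
  (forall F F' u v (uv : adj G u v), face F -> face F' ->
     closure F (M (mid uv)) -> closure F' (M (mid uv)) -> Q F -> Q F') ->
  (exists2 F, face F & Q F) ->
  forall x, ~ vertices x -> exists F, [/\ face F, Q F & closure F x].
Proof.
move=> Qcl [F0 fF0 QF0].
pose T x := exists F, [/\ face F, Q F & closure F x].
(* Inside a face nothing changes. Near an inner point of an edge, every face that comes close has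
   the midpoint of that edge in its closure, so that [Q] passes between these faces. *)
have loc x : ~ vertices x -> exists2 N, nbhs x N &
    forall y, N y -> ~ vertices y /\ (T x <-> T y).
  move=> nx; have [[z _ zx]|/face_cover[F fF Fx]] := pselect (range M x); last first.
    exists F; first by apply: open_nbhs_nbhs; split=> //; exact: (face_open schl fF).
    have only F' y : F y -> face F' -> closure F' y -> F' = F.
      by move=> Fy fF' cy; exact: (face_closure_eq schl fF' fF cy).
    move=> y Fy; split.
      by move=> [v _ vy]; apply: (face_range fF Fy); exists (vx v).
    split=> -[F' [fF' QF']]; [move=> /(only _ _ Fx fF') E|move=> /(only _ _ Fy fF') E];
      exists F; rewrite -E; split=> //; rewrite E; exact: subset_closure.
  have [|u [v [uv [t [t01 zE]]]]] := not_vertex_edge (y := z).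
    by move=> v zv; apply: nx; exists v; rewrite // -zv.
  subst z x.
  have oW : open (star u `&` star v : set Y) by apply: openI; exact: star_open.
  have [B [oB Bx _ BW BF]] := map_nbhs surfS schl oW (edge_point_stars uv t01).
  have cmid F s : face F -> 0 < s < 1 -> closure F (M (edge_path uv s)) ->
      closure F (M (mid uv)).
    move=> fF s01; have [us vs] := edge_point_stars uv s01.
    by move=> cs; exact: (face_closure_mid schl fF us vs cs).
  exists B; first exact: open_nbhs_nbhs.
  move=> y By; split.
    move=> [w _ wy]; have [uw vw] : (star u `&` star v) (vx w) by apply: BW; rewrite wy.
    by have /eqP[] := adj_neq uv; rewrite (star_vertexP uw) (star_vertexP vw).
  have [[z _ zy]|/face_cover[F' fF' F'y]] := pselect (range M y).
    have [uz vz] : (star u `&` star v) z by apply: BW; rewrite zy.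
    have [s s01 zE] := stars_edge_point uv uz vz; subst z y.
    by split=> -[F [fF QF cF]]; exists F; split=> //;
      apply: (face_closure_edge schl) => //; apply: cmid cF.
  have [|z [uz vz] cz] := BF F' fF'; first by exists y.
  have c' := face_closure_mid schl (uv := uv) fF' uz vz cz.
  split=> -[F [fF QF cF]].
    exists F'; split=> //; last exact: subset_closure.
    exact: (Qcl F F' u v uv fF fF' (cmid _ _ fF t01 cF) c' QF).
  have E := face_closure_eq schl fF fF' cF F'y; subst F'.
  by exists F; split=> //; apply: (face_closure_edge schl).
pose A := ~` vertices `&` T; pose B := ~` vertices `&` ~` T.
have oA : open A.
  rewrite openE => x [nx Tx]; have [N Nx NP] := loc x nx; apply: filterS Nx => y Ny.
  by have [ny Ty] := NP y Ny; split=> //; apply/Ty.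
have oB : open B.
  rewrite openE => x [nx Tx]; have [N Nx NP] := loc x nx; apply: filterS Nx => y Ny.
  by have [ny Ty] := NP y Ny; split=> //; move/Ty.
have B0 : B = set0.
  apply: (surface_discrete_complement surfS vertices_isolated oA oB).
  - by move=> x nx; have [Tx|Tx] := pselect (T x); [left|right].
  - by rewrite -subset0 => x [[_ Tx] [_ /(_ Tx)]].
  - by rewrite -subset0 => x [[nx _] /nx].
  - by rewrite -subset0 => x [[nx _] /nx].
  - have [x Fx] := face_neq0 fF0; exists x; split.
      by move=> [v _ vx']; apply: (face_range fF0 Fx); exists (vx v).
    by exists F0; split=> //; exact: subset_closure.
move=> x nx; apply: contrapT => Tx.
by have : B x by []; rewrite B0.
Qed.

Lemma edge_mid_not_vertex u v (uv : adj G u v) : ~ vertices (M (mid uv)).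
Proof.
move=> [w _ /map_inj E]; have [uw vw] := edge_point_stars uv (half_itv R).
have /eqP[] := adj_neq uv.
by rewrite -[edge_path _ _]E in uw vw; rewrite (star_vertexP uw) (star_vertexP vw).
Qed.

Lemma edge_face u v (uv : adj G u v) : (exists F, face F) ->
  exists2 F, face F & closure F (M (mid uv)).
Proof.
move=> [F0 fF0].
have [F [fF _ cF]] : exists F, [/\ face F, True & closure F (M (mid uv))].
  apply: (@face_propagation (fun=> True)) => //; first by exists F0.
  exact: edge_mid_not_vertex.
by exists F.
Qed.

Lemma face_edge_at F v : face F -> closure F (M (vx v)) ->
  exists w (vw : adj G v w), closure F (M (mid vw)).
Proof.
move=> fF; have [c [_ _ cc cE]] := face_cycle schl fF.
move=> /cE[x xc /segment_vertexP[E|E]]; have xn := next_cycle cc xc.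
  have {}E : v = x by []; subst v; exists (next c x), xn; apply/cE; exists x => //.
  by apply/(segment_edge_pathP _ xn (half_itv R)); split; [left|right].
have {}E : v = next c x by []; subst v; have nx : adj G (next c x) x by rewrite adj_sym.
exists x, nx; apply/cE; exists x => //.
by apply/(segment_edge_pathP _ nx (half_itv R)); split; [right|left].
Qed.

Lemma finite_no_three (T : Type) (A : set T) :
  (forall x y z, A x -> A y -> A z -> x <> y -> x <> z -> y <> z -> False) ->
  finite_set A.
Proof.
move=> A3; have [[x Ax]|A0] := pselect (A !=set0); last first.
  by apply: (@sub_finite_set _ _ set0) => // x Ax; case: A0; exists x.
have [[y [Ay xy]]|H] := pselect (exists y, A y /\ x <> y).
  apply: (@sub_finite_set _ _ [set x; y]); last exact: finite_set2.
  move=> z Az; apply: contrapT => /not_orP[zx zy].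
  by apply: (A3 x y z) => //; exact: nesym.
apply: (@sub_finite_set _ _ [set x]); last exact: finite_set1.
by move=> z Az; apply: contrapT => zx; apply: H; exists z; split=> //; exact: nesym.
Qed.

(** Each face at [v] contains one of the finitely many edges at [v], and an edge is in at most two
    faces. *)
Lemma faces_at_finite v : finite_set [set F | face F /\ closure F (M (vx v))].
Proof.
apply: (@sub_finite_set _ _ (\bigcup_(w in [set w | adj G v w])
  [set F | face F /\ exists vw : adj G v w, closure F (M (mid vw))])).
  move=> F [fF /(face_edge_at fF)[w [vw cw]]].
  by exists w => //; split=> //; exists vw.
apply: bigcup_finite; first exact: (map_locally_finite M).
move=> w vw; apply: finite_no_three => F1 F2 F3 [f1 [e1 c1]] [f2 [e2 c2]] [f3 [e3 c3]].
apply: (two_faces_per_edge surfS schl (uv := vw)) => //.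
- by rewrite (bool_irrelevance vw e1).
- by rewrite (bool_irrelevance vw e2).
- by rewrite (bool_irrelevance vw e3).
Qed.

Lemma face_vertices_finite F : face F -> finite_set [set v | closure F (M (vx v))].
Proof.
move=> fF; have [c [_ _ cc cE]] := face_cycle schl fF.
apply: (@sub_finite_set _ _ [set` c]); last exact: finite_seq.
by move=> v /cE[x xc /segment_vertexP[->|->]] //=; rewrite mem_next.
Qed.

Definition coface (v w : V) : Prop :=
  exists F, [/\ face F, closure F (M (vx v)) & closure F (M (vx w))].

Lemma coface_finite v : finite_set [set w | coface v w].
Proof.
apply: (@sub_finite_set _ _ (\bigcup_(F in [set F | face F /\ closure F (M (vx v))])
  [set w | closure F (M (vx w))])).
  by move=> w [F [fF Fv Fw]]; exists F.
apply: bigcup_finite; first exact: faces_at_finite.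
by move=> F [fF _]; exact: face_vertices_finite.
Qed.

(** * The cover of the surface by open stars *)

Section Stars.
Hypothesis has_face : exists F, face F.
Hypothesis has_edge : forall v, exists w, adj G v w.

(** Faces are taken whole, so that two stars meet exactly when their vertices share a face
    ([open_star_meetP]), a relation preserved by automorphisms. *)
Definition open_star (v : V) : set S :=
  [set x | (exists F, [/\ face F, F x & closure F (M (vx v))]) \/
           (exists2 y, x = M y & star v y)].

Lemma star_face v y : star v y -> exists2 F, face F & closure F (M y).
Proof.
move=> /starP[->|[w [vw [t [/andP[t0 t1] ->]]]]].
  have [w vw] := has_edge v; have [F fF cF] := edge_face vw has_face.
  exists F => //; have [vm _] := edge_point_stars vw (half_itv R).
  exact: (face_closure_star schl fF vm).
have [F fF cF] := edge_face vw has_face; exists F => //.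
move: t0; rewrite le_eqVlt => /orP[/eqP <-|t0].
  rewrite edge_path0; have [vm _] := edge_point_stars vw (half_itv R).
  exact: (face_closure_star schl fF vm).
by apply: (face_closure_edge schl) => //; rewrite t0.
Qed.

Lemma open_star_vertex v : open_star v (M (vx v)).
Proof. by right; exists (vx v) => //; exact: star_vertex. Qed.

Lemma open_star_open v : open (open_star v).
Proof.
rewrite openE => x [[F [fF Fx cF]]|[y -> vy]].
  have : nbhs x F by apply: open_nbhs_nbhs; split=> //; exact: (face_open schl fF).
  by apply: filterS => z Fz; left; exists F.
have [B [oB By _ BW BF]] := map_nbhs surfS schl (@star_open R V G v) vy.
have : nbhs (M y) B by exact: open_nbhs_nbhs.
apply: filterS => z Bz.
have [[y' _ E]|/face_cover[F fF Fz]] := pselect (range M z).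
  by right; exists y' => //; apply: BW; rewrite E.
left; exists F; split=> //.
have [|y' vy' cy'] := BF F fF; first by exists z.
exact: (face_closure_star schl fF vy').
Qed.

Lemma connected_setU1_closure (X : topologicalType) (A : set X) (x : X) :
  connected A -> closure A x -> connected (A `|` [set x]).
Proof.
move=> cA Ax; apply/connectedP => E [E0 EU sE].
have side b : A `<=` E b -> False.
  move=> AE; have [y Ey] := E0 (~~ b).
  have yx : y = x.
    have : (A `|` [set x]) y by rewrite EU; case: b Ey {AE} => ?; [left|right].
    move=> [Ay|//]; have : (E false `&` E true) y.
      by case: b Ey AE => Ey AE; split=> //; exact: AE.
    by rewrite (separated_disjoint sE).
  rewrite yx in Ey.
  have : (closure (E b) `&` E (~~ b)) x by split=> //; exact: closureS AE _ Ax.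
  by case: b {AE Ey}; [rewrite /negb setIC sE.2|rewrite /negb sE.1].
have [|AE|AE] := connected_subset sE _ cA.
- by rewrite -EU; exact: subsetUl.
- exact: side AE.
- exact: side AE.
Qed.

Lemma open_star_connected v : connected (open_star v).
Proof.
pose C := [set C : set S | [/\ connected C, C (M (vx v)) & C `<=` open_star v]].
have -> : open_star v = \bigcup_(A in C) A.
  apply/seteqP; split=> [x|x [A [_ _ AS] /AS]//].
  move=> [[F [fF Fx cF]]|[y -> vy]].
    exists (F `|` [set M (vx v)]); last by left.
    split; [|by right|].
      by apply: connected_setU1_closure => //; exact: (face_connected fF).
    by move=> z [Fz|->]; [left; exists F|exact: open_star_vertex].
  have [A [cA Av Ay AS]] := star_path vy; exists (M @` A); last by exists y.
  split; [|by exists (vx v)|].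
    by apply: connected_continuous_connected => //; apply: continuous_subspaceT;
      exact: map_continuous.
  by move=> z [y' /AS vy' <-]; right; exists y'.
by apply: bigcup_connected; [exists (M (vx v)) => A []|move=> A []].
Qed.

Lemma open_star_compact v : compact (closure (open_star v)).
Proof.
pose K := \bigcup_(F in [set F | face F /\ closure F (M (vx v))]) closure F.
have cK : compact K.
  apply: finite_bigcup_compact_in; first exact: faces_at_finite.
  by move=> F [fF _]; exact: (face_closure_compact surfS schl fF).
apply: (subclosed_compact (@closed_closure _ _) cK).
rewrite [X in _ `<=` X](closure_id K).1; last first.
  exact: (compact_closed (surface_hausdorff surfS) cK).
apply: closureS => x [[F [fF Fx cF]]|[y -> vy]].
  by exists F => //; exact: subset_closure.
have [F fF cF] := star_face vy; exists F => //; split=> //.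
exact: (face_closure_star schl fF vy).
Qed.

Lemma open_star_cover x : exists v, open_star v x.
Proof.
have [[y _ <-]|/face_cover[F fF Fx]] := pselect (range M x).
  by have [v vy] := realization_star y; exists v; right; exists y.
have [c [sc _ _ cE]] := face_cycle schl fF.
case: c sc cE => // v c _ cE; exists v; left; exists F; split=> //; apply/cE.
by exists v; [rewrite mem_head|apply/segment_vertexP; left].
Qed.

Lemma open_star_meetP v w : open_star v `&` open_star w !=set0 <-> coface v w.
Proof.
split; last first.
  move=> [F [fF Fv Fw]]; have [x Fx] := face_neq0 fF.
  by exists x; split; left; exists F.
move=> [x [[[F [fF Fx Fv]]|[y xy vy]] [[F' [fF' F'x F'w]]|[y' xy' wy']]]].
- by exists F; split=> //; rewrite (face_eq fF fF' Fx F'x).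
- by case: (face_range fF Fx); exists y'.
- by case: (face_range fF' F'x); exists y.
have E : y' = y by apply: (@map_inj _ _ _ _ M); rewrite -xy.
have [F fF cF] := star_face vy; rewrite E in wy'.
by exists F; split=> //; [exact: (face_closure_star schl fF vy)|
  exact: (face_closure_star schl fF wy')].
Qed.

End Stars.


(** * Preautomorphisms that fix a flag *)

Section Preaut.
Implicit Types f h : preaut M.

Lemma realization_map_coord (g : graph_aut G) w (y : Y) :
  coord w (realization_map g y) = coord (ga_inv g w) y.
Proof. by []. Qed.

Lemma realization_map_edge (g : graph_aut G) u v (uv : adj G u v)
    (guv : adj G (g u) (g v)) (t : R) : 0 <= t <= 1 ->
  realization_map g (edge_path uv t) = edge_path guv t.
Proof.
move=> t01; apply: val_inj; apply/funext => w.
rewrite -[LHS]/(coord w (realization_map g (edge_path uv t))).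
rewrite -[RHS]/(coord w (edge_path guv t)).
by rewrite realization_map_coord !coord_edge_path // !(can2_eq (ga_invK g) (ga_funK g)).
Qed.

Lemma realization_map_vertex (g : graph_aut G) v :
  realization_map g (vx v) = vx (g v) :> Y.
Proof.
apply: val_inj; apply/funext => w.
rewrite -[LHS]/(coord w (realization_map g (vx v))) -[RHS]/(coord w (vx (g v))).
by rewrite realization_map_coord !coord_vertex (can2_eq (ga_invK g) (ga_funK g)).
Qed.

Lemma preaut_vertex f v : f (M (vx v)) = M (vx (map_phi f v)).
Proof. by rewrite -map_phiE realization_map_vertex. Qed.

Lemma preaut_mid f u v (uv : adj G u v) (guv : adj G (map_phi f u) (map_phi f v)) :
  f (M (mid uv)) = M (mid guv).
Proof.
rewrite -map_phiE (realization_map_edge uv guv) //.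
by have /andP[h0 h1] := half_itv R; rewrite !ltW.
Qed.

Lemma preaut_adj f u v : adj G u v -> adj G (map_phi f u) (map_phi f v).
Proof. by rewrite ga_adj. Qed.

Lemma preaut_closure f (F : set S) x : closure F x -> closure (f @` F) (f x).
Proof.
move=> cx N /(@pa_cont _ _ _ _ _ f x) /cx[y [Fy Ny]].
by exists (f y); split=> //; exists y.
Qed.

Lemma preaut_imageK f (F : set S) : (f^-1)%g @` (f @` F) = F.
Proof.
apply/seteqP; split=> [x [y [z Fz <-] <-]|x Fx]; first by rewrite /= pa_funK.
by exists (f x); [exists x|rewrite /= pa_funK].
Qed.

Lemma preaut_range f x : range M x -> range M (f x).
Proof. by move=> [y _ <-]; exists (realization_map (map_phi f) y); rewrite ?map_phiE. Qed.

Lemma preaut_rangeC f x : ~ range M x -> ~ range M (f x).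
Proof. by move=> nx /(preaut_range f^-1%g) /=; rewrite pa_funK. Qed.

Lemma preaut_face f F : face F -> face (f @` F).
Proof.
have sub (h : preaut M) F' x : face F' -> F' x ->
    h @` F' `<=` connected_component (~` range M) (h x).
  move=> fF' F'x; apply: connected_component_max; first by exists x.
    by move=> y [z /(face_range fF') nz <-]; exact: preaut_rangeC.
  apply: connected_continuous_connected; first exact: (face_connected fF').
  by apply: continuous_subspaceT; exact: pa_cont.
move=> fF; have [x Fx] := face_neq0 fF.
have nfx := preaut_rangeC (f := f) (face_range fF Fx).
exists (f x) => //; apply/seteqP; split; last exact: sub.
move=> y cy; exists ((f^-1)%g y); last by rewrite /= pa_invK.
rewrite (faceE fF Fx) -[x](pa_funK f).
apply: (sub (f^-1)%g (connected_component (~` range M) (f x)) (f x)).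
- by exists (f x).
- exact: connected_component_refl.
- by exists y.
Qed.

Lemma preaut_coface f v w : coface v w -> coface (map_phi f v) (map_phi f w).
Proof.
move=> [F [fF Fv Fw]]; exists (f @` F); rewrite -!preaut_vertex.
by split; [exact: preaut_face|exact: preaut_closure|exact: preaut_closure].
Qed.

Lemma cycle_induction (c : seq V) (Q : V -> Prop) x : uniq c -> x \in c -> Q x ->
  (forall y, y \in c -> Q y -> Q (next c y)) -> forall y, y \in c -> Q y.
Proof.
move=> uc xc Qx Qn y yc.
have [i s E] := rot_to xc.
have fc : fcycle (next c) (x :: s).
  by rewrite -E rot_cycle; exact: cycle_next.
have sub z : z \in x :: s -> z \in c by rewrite -E mem_rot.
have : y \in x :: s by rewrite -E mem_rot.
move: fc; rewrite /= rcons_path => /andP[+ _].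
have : Q x /\ x \in c by [].
have {E xc Qx} : {subset s <= c} by move=> z zs; apply: sub; rewrite inE zs orbT.
elim: s x {sub} => [|z s IHs] x sc [Qx xc] /=; first by move=> _; rewrite inE => /eqP ->.
move=> /andP[/eqP xz zs]; rewrite inE => /orP[/eqP ->//|].
apply: IHs => //; first by move=> w ws; apply: sc; rewrite inE ws orbT.
by rewrite -xz mem_next xc; split=> //; exact: Qn.
Qed.

(** The boundary of the face is a cycle preserved by [f]. Once both ends of one of its edges are
    fixed, so are those of the next edge, and so on around. *)
Lemma preaut_fix_face f F u v (uv : adj G u v) : face F -> f @` F = F ->
  closure F (M (mid uv)) -> map_phi f u = u -> map_phi f v = v ->
  forall w, closure F (M (vx w)) -> map_phi f w = w.
Proof.
move=> fF fixF cuv fu fv.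
have [c [_ uc cc cE]] := face_cycle schl fF.
have edgeP a b (ab : adj G a b) : closure F (M (mid ab)) <->
    exists2 x, x \in c & [set x; next c x] a /\ [set x; next c x] b.
  by rewrite cE; split=> -[x xc H]; exists x => //;
    apply/(segment_edge_pathP _ ab (half_itv R)).
pose g := map_phi f; pose Q x := g x = x /\ g (next c x) = next c x.
have inj : injective (next c) by exact: can_inj (prev_next uc).
have [x xc Qx] : exists2 x, x \in c & Q x.
  have [x xc [xu xv]] := (edgeP _ _ uv).1 cuv; exists x => //.
  have uv' := adj_neq uv; rewrite /Q /g.
  have {}xu : u = x \/ u = next c x := xu; have {}xv : v = x \/ v = next c x := xv.
  by move: fu fv uv'; case: xu => ->; case: xv => ->; rewrite ?eqxx.
have QQ y : y \in c -> Q y -> Q (next c y).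
  move=> yc [gy gn]; split=> //; set n := next c y in gn *.
  have nn : adj G n (next c n) by apply: next_cycle => //; rewrite mem_next.
  have gnn := preaut_adj f nn; rewrite -/g in gnn.
  have : closure F (M (mid gnn)).
    rewrite -(preaut_mid nn) -fixF; apply: preaut_closure; apply/edgeP.
    by exists n; rewrite ?mem_next //; split; [left|right].
  (* The image of the next edge is an edge of the cycle at [n]. Its other end is the successor of
     [n], as wanted, or its predecessor [y]; in that case injectivity shows that the successor is
     [y], which is fixed. *)
  move=> /edgeP[z zc []]; have := adj_neq gnn; rewrite gn => ne [] /= E1 [] /= E2.
  - by move: ne; rewrite E2 E1 eqxx.
  - by rewrite E2 -E1.
  - have zy : z = y by apply: inj; rewrite -E1.
    have /(can_inj (ga_funK g)) -> : g (next c n) = g y by rewrite E2 zy gy.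
    exact: gy.
  - by move: ne; rewrite E2 E1 eqxx.
move=> w /cE[y yc /segment_vertexP[->|->]].
  by have [] := cycle_induction uc xc Qx QQ yc.
by have [_] := cycle_induction uc xc Qx QQ yc.
Qed.

Lemma preaut_fix_flag f F u v (uv : adj G u v) : face F -> f @` F = F ->
  (forall w, exists w', adj G w w') ->
  closure F (M (mid uv)) -> map_phi f u = u -> map_phi f v = v ->
  forall w, map_phi f w = w.
Proof.
move=> fF fixF has_edge cuv fu fv w.
have [w' ww'] := has_edge w.
pose Q F := f @` F = F /\ forall w, closure F (M (vx w)) -> map_phi f w = w.
have [F' [fF' [_ QF'] cF']] : exists F', [/\ face F', Q F' & closure F' (M (mid ww'))].
  apply: face_propagation; last exact: edge_mid_not_vertex.
    move=> F1 F2 a b ab f1 f2 c1 c2 [fix1 Q1].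
    have [am bm] := edge_point_stars ab (half_itv R).
    have ga := Q1 a (face_closure_star schl f1 am c1).
    have gb := Q1 b (face_closure_star schl f1 bm c1).
    (* If [f] moved [F2], then [F1], [F2] and the image of [F2] would be three faces at the same
       edge. *)
    have fix2 : f @` F2 = F2.
      apply: contrapT => n2; have [E|n12] := pselect (F1 = F2); first by rewrite -E in n2.
      apply: (two_faces_per_edge surfS schl f1 f2 (preaut_face f f2) c1 c2) => //.
      - have gab : adj G (map_phi f a) (map_phi f b) by exact: preaut_adj.
        have := @preaut_closure f _ _ c2; rewrite (preaut_mid ab gab) => c3.
        have [am' bm'] := edge_point_stars gab (half_itv R).
        have am2 : star a (mid gab) := eq_ind _ (fun z => star z (mid gab)) am' _ ga.
        have bm2 : star b (mid gab) := eq_ind _ (fun z => star z (mid gab)) bm' _ gb.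
        exact: (face_closure_mid schl (preaut_face f f2) am2 bm2 c3).
      - by move=> E; apply: n12; rewrite -(preaut_imageK f F1) fix1 E preaut_imageK.
      - by move=> E; apply: n2; rewrite -E.
    by split=> //; exact: (preaut_fix_face f2 fix2 c2 ga gb).
  by exists F => //; split=> //; exact: (preaut_fix_face fF fixF cuv fu fv).
have [wm _] := edge_point_stars ww' (half_itv R).
exact: (QF' w (face_closure_star schl fF' wm cF')).
Qed.

End Preaut.
End MapFaces.

(** * The automorphism group *)

Section AutomorphismGroup.
Local Open Scope quotient_scope.
Variables (R : realType) (S : topologicalType) (V : choiceType) (G : simple_graph V).
Variable M : graph_map R S G.
Hypothesis surfS : is_surface R S.
Variables p q : nat.
Hypothesis schl : schlafli_type M p q.

Local Notation vx := (vertex_point R G).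
Local Notation face := (face_of M).
Local Notation mid := (edge_mid R).
Local Notation phi := (@map_phi R S V G M).

(** The action on vertices depends only on [a], but the one on faces may depend on the
    representative, so one is chosen for each [a]. *)
Definition aut_repr (a : Aut M) : preaut M :=
  repr (a : {eq_quot (ker_equiv phi)}).

Definition aut_act (a : Aut M) : graph_aut G := map_phi (aut_repr a).

Lemma aut_act_pi (f : preaut M) : aut_act (quotient_pi phi f) = map_phi f.
Proof. exact: f_repr. Qed.

Lemma aut_actM a b v : aut_act (a * b)%g v = aut_act a (aut_act b v).
Proof.
have [f ->] := quotient_piK a; have [h ->] := quotient_piK b.
rewrite -[(_ * _)%g]/(q_mul _ _) q_mulE !aut_act_pi.
by rewrite map_phiM.
Qed.

Lemma aut_act1 v : aut_act 1%g v = v.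
Proof. by rewrite -[1%g]/(q_one _) /q_one aut_act_pi map_phi1. Qed.

Lemma aut_actK a v : aut_act a^-1%g (aut_act a v) = v.
Proof. by rewrite -aut_actM mulVg aut_act1. Qed.

Lemma aut_act_inj a b : aut_act a = aut_act b -> a = b.
Proof.
have [f ->] := quotient_piK a; have [h ->] := quotient_piK b.
by rewrite !aut_act_pi => E; apply/quotient_piP.
Qed.

Lemma aut_coface a v w : coface M v w -> coface M (aut_act a v) (aut_act a w).
Proof. exact: preaut_coface. Qed.

Lemma aut_cofaceK a v w : coface M (aut_act a v) (aut_act a w) -> coface M v w.
Proof. by move=> /(aut_coface a^-1%g); rewrite !aut_actK. Qed.

Section Transitive.
Variables (v0 : V).
Hypothesis has_face : exists F, face F.
Hypothesis has_edge : forall v, exists w, adj G v w.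
Hypothesis trans : forall v, exists a, aut_act a v0 = v.

Lemma finite_set_inj_on (T U : Type) (A : set T) (f : T -> U) :
  (forall x y, A x -> A y -> f x = f y -> x = y) -> finite_set (f @` A) -> finite_set A.
Proof.
move=> fI; rewrite (eq_finite_set (inj_card_eq _)) //.
by move=> x y; rewrite !inE; exact: fI.
Qed.

Lemma stabilizer_finite u : finite_set [set a | aut_act a v0 = u].
Proof.
have [w0 vw] := has_edge v0; have [F0 fF0 cF0] := edge_face surfS schl vw has_face.
(* Two automorphisms that send [v0] to [u] and agree on the key differ by one that fixes a flag. The
   possible keys are finitely many: neighbours of [u] paired with faces at [u]. *)
pose key (a : Aut M) := (aut_act a w0, aut_repr a @` F0).
apply: (@finite_set_inj_on _ _ _ key).
  move=> a b au bu [kw kF]; apply: aut_act_inj.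
  pose h : preaut M := ((aut_repr b)^-1 * aut_repr a)%g.
  have hE w : map_phi h w = ga_inv (aut_act b) (aut_act a w).
    by rewrite /h map_phiM gmulfV.
  have hF : h @` F0 = F0.
    rewrite -[RHS](preaut_imageK (aut_repr b)) -kF image_comp.
    by [].
  have hfix := preaut_fix_flag surfS schl (f := h) (uv := vw) fF0 hF has_edge cF0.
  apply: graph_aut_ext => w; apply: (can_inj (ga_invK (aut_act b))).
  rewrite ga_funK -hE; apply: hfix.
    by rewrite hE au -bu ga_funK.
  by rewrite hE kw ga_funK.
apply: (@sub_finite_set _ _ ([set w | adj G u w] `*`
    [set F | face F /\ closure F (M (vx u))])).
  move=> _ [a au <-]; split; rewrite /=.
    by rewrite -[u]au; exact: preaut_adj.
  split; first exact: preaut_face.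
  rewrite -au -preaut_vertex; apply: preaut_closure.
  have [vm _] := edge_point_stars vw (half_itv R).
  exact: (face_closure_star schl fF0 vm cF0).
apply: finite_setX; first exact: (map_locally_finite M).
exact: (faces_at_finite surfS schl).
Qed.

(** Each star is listed once for every automorphism that leads to its vertex; the cover remains
    locally finite because stabilizers are finite. *)
Let cell (a : Aut M) : set S := open_star M (aut_act a v0).
Let B : set (Aut M) := [set b | coface M v0 (aut_act b v0)].

Lemma aut_coface_finite v : finite_set [set a | coface M v (aut_act a v0)].
Proof.
apply: (@sub_finite_set _ _ (\bigcup_(w in [set w | coface M v w])
   [set a | aut_act a v0 = w])); first by move=> a va; exists (aut_act a v0).
by apply: bigcup_finite; [exact: (coface_finite surfS schl)|
  move=> w _; exact: stabilizer_finite].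
Qed.

Lemma aut_nerveP a b : nerve cell a b <-> B (a^-1 * b)%g.
Proof.
rewrite /nerve /cell /B /=.
split.
  move=> /(open_star_meetP surfS schl has_face has_edge).
  move=> H; apply: (@aut_cofaceK a).
  by rewrite -aut_actM mulgA mulgV mul1g.
move=> /(aut_coface a); rewrite -aut_actM mulgA mulgV mul1g => H.
exact/(open_star_meetP surfS schl has_face has_edge).
Qed.

Lemma cell_locally_finite x :
  exists2 N, nbhs (x : S) N & finite_set [set a | N `&` cell a !=set0].
Proof.
have [v vx_] := open_star_cover schl x; exists (open_star M v).
  by apply: open_nbhs_nbhs; split=> //; exact: (open_star_open surfS schl).
apply: sub_finite_set (aut_coface_finite v) => a.
by move=> /(open_star_meetP surfS schl has_face has_edge).
Qed.

Lemma cell_cover x : exists a, cell a x.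
Proof.
have [v vx_] := open_star_cover schl x; have [a av] := trans v.
by exists a; rewrite /cell av.
Qed.

Lemma cell_neq0 a : cell a !=set0.
Proof. by exists (M (vx (aut_act a v0))); exact: open_star_vertex. Qed.

Lemma cell_open a : open (cell a).
Proof. exact: (open_star_open surfS schl). Qed.

Lemma aut_nerve_connected : graph_connected (nerve cell).
Proof.
exact: (nerve_connected cell_open cell_neq0 cell_cover (surface_connected surfS)).
Qed.

(** A subgroup that contains [B] is closed under steps of the nerve, which is connected because the
    surface is. *)
Lemma aut_coface_generates : generates B.
Proof.
move=> H [H1 HV] BH; apply: aut_nerve_connected; first by exists 1%g; rewrite inE in H1.
move=> a b Ha /aut_nerveP /BH Hab.
have := HV a (a^-1 * b)^-1%g; rewrite !inE.
have HVV x : H x -> H x^-1%g.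
  by move=> Hx; have := HV 1%g x; rewrite !inE in H1 *; rewrite mul1g; apply.
by rewrite invgK mulgA mulgV mul1g; apply=> //; exact: HVV.
Qed.

Lemma Ends_aut_ultrafilters :
  Ends S #= end_ultrafilters (nerve cell) /\
  finite_coboundary (nerve cell) = almost_invariant (H := Aut M).
Proof.
have nsym g h : nerve cell g h -> nerve cell h g by exact: nerve_sym.
split.
  apply: Ends_end_ultrafilters.
  - exact: cell_open.
  - by move=> a; exact: open_star_connected.
  - exact: cell_neq0.
  - by move=> a; exact: (open_star_compact surfS schl has_face has_edge).
  - exact: cell_cover.
  - exact: cell_locally_finite.
  - exact: aut_nerve_connected.
  - by exists 1%g.
apply: (group_finite_coboundary (aut_coface_finite v0) aut_coface_generates) => //.
  by move=> g s Bs; apply/aut_nerveP; rewrite mulgA mulVg mul1g.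
by move=> g h /aut_nerveP.
Qed.

End Transitive.

(** * From orbits of flags to transitivity on vertices *)

Section Flags.

Lemma flag_edge (P : flag_data S V) : flags M P -> exists w,
  exists vw : adj G P.1.1 w, P.1.2 = [set P.1.1; w] /\ closure P.2 (M (mid vw)).
Proof.
case: P => [[v e] F] [/= [x [y [xy ->]]] ev fF sF].
have vE : v = x \/ v = y := ev.
have c z (vz : adj G v z) : [set x; y] v -> [set x; y] z -> closure F (M (mid vz)).
  move=> xv xz; suff [] : frontier F (M (mid vz)) by [].
  apply: sF; exists (mid vz) => //.
  by apply/(segment_edge_pathP _ vz (half_itv R)).
case: vE => E; subst v.
  by exists y, xy; split=> //; apply: c; [left|right].
have yx : adj G y x by rewrite adj_sym.
by exists x, yx; split; [rewrite setUC|apply: c; [right|left]].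
Qed.

Lemma edge_flag F u v (uv : adj G u v) : face F -> closure F (M (mid uv)) ->
  flags M (u, [set u; v], F).
Proof.
move=> fF; have [c [_ _ _ cE]] := face_cycle schl fF.
move=> /cE[x xc /(segment_edge_pathP _ uv (half_itv R))[xu xv]].
split=> //=; [by exists u, v|by left|].
move=> _ [y uvy <-]; apply/(face_frontierE _ fF)/cE; exists x => // w xw.
by apply: uvy => -[E|E]; apply: xw; rewrite E.
Qed.

Lemma flag_orbit_refl P : flag_orbit M P P.
Proof.
exists (quotient_pi phi 1%g), 1%g => //.
case: P => [[v e] F]; rewrite /preaut_flag map_phi1 /=; congr (_, _, _).
  by apply/seteqP; split=> [x [y ey <-]//|x ex]; exists x.
by apply/seteqP; split=> [x [y ey <-]//|x ex]; exists x.
Qed.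

Lemma flag_orbit_vertex P P' : flag_orbit M P = flag_orbit M P' ->
  exists a, aut_act a P'.1.1 = P.1.1.
Proof.
move=> E; have := flag_orbit_refl P; rewrite E => -[a [f _ fP]].
by exists (quotient_pi phi f); rewrite aut_act_pi -fP.
Qed.

Lemma card_II_bij (T : Type) (X : set T) n : X #= `I_n ->
  exists k : T -> nat, (forall x, X x -> (k x < n)%N) /\
    (forall x y, X x -> X y -> k x = k y -> x = y) /\
    ((0 < n)%N -> X !=set0).
Proof.
move=> /card_set_bijP[k [kX kI kS]]; exists k; split; first exact: kX.
split=> [x y Xx Xy|n0]; first by apply: kI; rewrite inE.
by have [x Xx _] := kS 0%N n0; exists x.
Qed.

(** In the chiral case, changing the edge of [P0] gives a flag [P1] with the same vertex in the
    other orbit. Every flag is then in the orbit of [P0] or [P1], and both reach all vertices from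
    that one vertex. *)
Lemma flags_transitive : regular_map M \/ chiral_map M -> exists P0, flags M P0 /\
  forall P, flags M P -> P.1.1 = P0.1.1 \/ exists a, aut_act a P0.1.1 = P.1.1.
Proof.
have orbP P : flags M P -> flag_orbits M (flag_orbit M P) by move=> fP; exists P.
move=> [[_ /card_II_bij[k [k1 [kI k0]]]]|[_ /card_II_bij[k [k1 [kI k0]]] chir]].
  have [_ [P0 fP0 _]] := k0 isT; exists P0; split=> // P fP; right.
  apply: flag_orbit_vertex; apply: kI; [exact: orbP|exact: orbP|].
  have := k1 _ (orbP _ fP); have := k1 _ (orbP _ fP0).
  by rewrite !ltnS !leqn0 => /eqP-> /eqP->.
have [_ [P0 fP0 _]] := k0 isT; exists P0; split=> // P fP; right.
have [w [vw [eE cF]]] := flag_edge fP0.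
have fF : face P0.2 by case: fP0.
have [P1 [fP1 P1E adjP]] : exists P1, [/\ flags M P1, P1.1.1 = P0.1.1 & flag_adjacent P0 P1].
  have [c [sc uc cc cE]] := face_cycle schl fF.
  set v := P0.1.1 in vw eE cF.
  have other x : adj G v x -> x <> w -> (exists2 z, z \in c &
      [set z; next c z] v /\ [set z; next c z] x) ->
      exists P1, [/\ flags M P1, P1.1.1 = P0.1.1 & flag_adjacent P0 P1].
    move=> vx_ xw [z zc zvx]; exists (v, [set v; x], P0.2); split=> //.
      apply: (edge_flag (uv := vx_)) => //; apply/cE; exists z => //.
      exact/(segment_edge_pathP _ vx_ (half_itv R)).
    constructor 2; split=> //=; rewrite eE => E.
    have : [set v; w] x by rewrite E; right.
    by move=> [Ex|Ex]; [have /eqP[] := adj_neq vx_|apply: xw].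
  have vc : v \in c.
    have [vm _] := edge_point_stars vw (half_itv R).
    have /cE[z zc /segment_vertexP[->|->]] := face_closure_star schl fF vm cF => //.
    by rewrite mem_next.
  have vn := next_cycle cc vc.
  have pv : adj G v (prev c v) by rewrite adj_sym; exact: prev_cycle.
  have [nw|nw] := eqVneq (next c v) w.
    apply: (other (prev c v) pv); last first.
      exists (prev c v); first by rewrite mem_prev.
      by split; [right; rewrite /= (next_prev uc)|left].
    rewrite -nw => pn.
    have nn : next c (next c v) = v by rewrite -pn next_prev.
    (* If the predecessor of [v] were its successor, the cycle would close up after two steps,
       whereas its size exceeds 2. *)
    case: (rot_to vc) => i s E; move: sc nn; rewrite -(size_rot i) -!(next_rot i uc).
    have : uniq (v :: s) by rewrite -E rot_uniq.
    rewrite E; case: s {E} => [|a [|b s]] //=; rewrite !eqxx !inE !negb_or.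
    move=> /andP[/and3P[va vb _] _] _.
    by rewrite eq_sym (negbTE va) => bv; rewrite bv eqxx in vb.
  by apply: (other _ vn) => [/eqP|]; [rewrite (negbTE nw)|exists v => //; split; [left|right]].
have ne : flag_orbit M P0 <> flag_orbit M P1 by exact: chir.
have kne : k (flag_orbit M P0) <> k (flag_orbit M P1).
  by move=> E; apply: ne; apply: kI => //; exact: orbP.
have [E|E] : k (flag_orbit M P) = k (flag_orbit M P0) \/
    k (flag_orbit M P) = k (flag_orbit M P1).
- have := k1 _ (orbP _ fP); have := k1 _ (orbP _ fP0); have := k1 _ (orbP _ fP1); lia.
- by apply: flag_orbit_vertex; apply: kI => //; exact: orbP.
- by rewrite -P1E; apply: flag_orbit_vertex; apply: kI => //; exact: orbP.
Qed.

End Flags.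

Lemma map_vertex_transitive : regular_map M \/ chiral_map M ->
  [/\ exists F, face F, forall v, exists w, adj G v w &
      exists v0, forall v, exists a, aut_act a v0 = v].
Proof.
move=> /flags_transitive[P0 [fP0 trans]].
have hf : exists F, face F by exists P0.2; case: fP0.
have [w0 [vw0 _]] := flag_edge fP0.
have he v : exists w, adj G v w.
  (* The vertex of [P0] has a neighbour, so the common degree [q] is positive. *)
  apply: contrapT => nv.
  have q0 : (0 < q)%N.
    have [k [k1 _]] := card_II_bij (schl.1 P0.1.1).
    exact: leq_ltn_trans (k1 w0 vw0).
  by have [k [_ [_ /(_ q0)[w vw]]]] := card_II_bij (schl.1 v); apply: nv; exists w.
split=> //; exists P0.1.1 => v.
have [w vw] := he v; have [F fF cF] := edge_face surfS schl vw hf.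
have [E|//] := trans _ (edge_flag fF cF).
by exists 1%g; rewrite aut_act1 -E.
Qed.

End AutomorphismGroup.

Theorem theorem1p1 (R : realType) (S : topologicalType) (V : choiceType)
    (G : simple_graph V) (M : graph_map R S G) :
  is_surface R S -> regular_map M \/ chiral_map M ->
  (exists A : set (Aut M), finite_set A /\ generates A) /\
  (forall A : set (Aut M), finite_set A -> generates A ->
     Ends S #= group_ends R A).
Proof.
move=> surfS rc.
have [p [q schl]] : exists p q, schlafli_type M p q by case: rc => [[]|[]].
have [hf he [v0 trans]] := map_vertex_transitive surfS schl rc.
have [eS cS] := Ends_aut_ultrafilters surfS schl hf he trans.
split.
  exists [set b | coface M v0 (aut_act b v0)].
  by split; [exact: (aut_coface_finite surfS schl)|exact: (aut_coface_generates surfS schl)].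
move=> A fA gA; have [eA cA] := group_ends_ultrafilters R fA gA.
apply: card_eq_trans eS _; rewrite card_eq_sym; apply: card_eq_trans eA _.
(* [end_ultrafilters] depends on the relation only through its sets of finite coboundary, and on
   both sides these are the almost invariant sets. *)
by rewrite /end_ultrafilters cS cA; exact: card_eqxx.
Qed.
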